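(* Let $n\ge 2$ and $m\ge 1$ be integers, $p\in[1,n)$, $Q\in\mathcal{K}_o^{1,m}$, and $K\in\mathcal{L}_o^{n,1}$. Then $$\frac{\Phi_{p,Q}(K)}{\Phi_{p,Q}(B_2^n)}\le\frac{S_p(K)}{S_p(B_2^n)},$$ with equality if $K$ is an origin-symmetric ball.
   Context: $M_{n,m}(\mathbb{R})$ is the space of real $n\times m$ matrices with inner product $\mathrm{tr}(x^{\mathrm T}y)$ and the induced norm; $S^{nm-1}$ is its unit sphere and $du$ the spherical (Hausdorff) measure on it. $M_{n,1}(\mathbb{R})$ and $M_{1,m}(\mathbb{R})$ are identified with $\mathbb{R}^n$ and $\mathbb{R}^m$. $B_2^n$ is the Euclidean unit ball of $\mathbb{R}^n$; an origin-symmetric ball is $rB_2^n$, $r>0$. $\mathcal{K}_o^{1,m}$ is the set of compact convex sets with nonempty interior in $M_{1,m}(\mathbb{R})$ containing the origin $o$. The support function is $h_Q(x)=\max\{x\cdot y:y\in Q\}$. $\mathcal{L}_o^{n,1}$ is the set of Lipschitz star bodies about $o$ in $\mathbb{R}^n$: compact sets $K$ that are star-shaped about $o$, whose radial function $\rho_K(x)=\sup\{\lambda\ge0:\lambda x\in K\}$ is strictly positive and continuous on $S^{n-1}$, and whose boundary is Lipschitz, i.e. $\rho_K|_{S^{n-1}}$ is Lipschitz. For such $K$, $\partial^*K=\{x\in\partial K:\nabla\rho_K(x)\text{ exists}\}$, which is $\mathcal{H}^{n-1}$-almost all of $\partial K$, and $\nu_K(z)$ is the outer unit normal at $z\in\partial^*K$.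 The $L_p$ surface area is $$S_p(K)=\int_{\partial^*K}(z\cdot\nu_K(z))^{1-p}\,d\mathcal{H}^{n-1}(z).$$ For $x\in M_{n,m}(\mathbb{R})$, $$h_{\Pi_{p,Q}K}(x)=\Big(\int_{\partial^*K}h_Q(\nu_K(z)^{\mathrm T}x)^p\,(z\cdot\nu_K(z))^{1-p}\,d\mathcal{H}^{n-1}(z)\Big)^{1/p}$$ (with $\nu_K(z)^{\mathrm T}x\in M_{1,m}(\mathbb{R})$ the matrix product), and the $m$th order $p$-integral affine surface area is $\Phi_{p,Q}(K)=\Big(\int_{S^{nm-1}}h_{\Pi_{p,Q}K}(u)^{-nm}\,du\Big)^{-\frac{p}{nm}}$. *)

(* Defs.v *)
From HB Require Import structures.
From mathcomp Require Import all_boot all_order all_algebra.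
From mathcomp Require Import all_classical all_reals all_analysis.

Set Implicit Arguments.
Unset Strict Implicit.
Unset Printing Implicit Defensive.

Import Order.TTheory GRing.Theory Num.Theory numFieldNormedType.Exports.

Local Open Scope classical_set_scope.
Local Open Scope ring_scope.

(* The library norm on 'M[R]_(n, m) is the maximum norm: it is only used for
   the topology and for differentiability, which do not depend on the choice
   of a norm. Lengths, spheres, balls and diameters are Euclidean. *)
Section euclidean.
Context {R : realType} {n m : nat}.
Implicit Types x y : 'M[R]_(n, m).

Definition mdot x y : R := \tr (x^T *m y).

Definition enorm x : R := Num.sqrt (mdot x x).

Definition esphere : set 'M[R]_(n, m) := [set x | enorm x = 1].

Definition eball : set 'M[R]_(n, m) := [set x | enorm x <= 1].

Definition ediam (A : set 'M[R]_(n, m)) : \bar R :=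
  ereal_sup [set (enorm (xy.1 - xy.2))%:E | xy in A `*` A].

End euclidean.
Arguments esphere R n m : clear implicits.
Arguments eball R n m : clear implicits.

(* Volume of the Euclidean unit ball of R^s, that is
   pi ^ (s / 2) / Gamma (s / 2 + 1), through the recursion
   omega_(s + 2) = 2 pi / (s + 2) * omega_s. *)
Fixpoint unit_ball_volume (R : realType) (s : nat) : R :=
  match s with
  | 0 => 1
  | 1 => 2
  | s'.+2 => 2 * pi / s'.+2%:R * unit_ball_volume R s'
  end.

(* s-dimensional Hausdorff measure, normalized so that it agrees with the
   Lebesgue measure on R^s. *)
Section hausdorff_measure.
Local Open Scope ereal_scope.
Context {R : realType} {n m : nat} (s : nat).
Local Notation M := 'M[R]_(n, m).
Implicit Types A : set M.

Definition hausdorff_gauge A : \bar R :=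
  if A == set0 then 0
  else (unit_ball_volume R s)%:E * ((2^-1)%:E * ediam A) ^+ s.

Definition hausdorff_cover (delta : R) A : set (nat -> set M) :=
  [set F | (forall k, ediam (F k) <= delta%:E) /\ A `<=` \bigcup_k F k].

Definition hausdorff_content (delta : R) A : \bar R :=
  ereal_inf [set \sum_(k <oo) hausdorff_gauge (F k)
            | F in hausdorff_cover delta A].

Definition hausdorff A : \bar R :=
  ereal_sup [set hausdorff_content delta A | delta in [set d : R | (0 < d)%R]].

Lemma unit_ball_volume_ge0 k : (0 <= unit_ball_volume R k)%R.
Proof.
suff : ((0 <= unit_ball_volume R k) && (0 <= unit_ball_volume R k.+1))%R.
  by case/andP.
elim: k => [|k /andP[k0 k1]]; first by rewrite /= ler01 ler0n.
by rewrite k1 /= mulr_ge0// divr_ge0// mulr_ge0// pi_ge0.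
Qed.

Lemma ediam_ge0 A : A != set0 -> 0 <= ediam A.
Proof.
move=> /set0P[x Ax]; apply: (@le_trans _ _ (enorm (x - x))%:E).
  by rewrite lee_fin sqrtr_ge0.
by apply: ereal_sup_ubound; exists (x, x).
Qed.

Lemma hausdorff_gauge_ge0 A : 0 <= hausdorff_gauge A.
Proof.
rewrite /hausdorff_gauge; case: ifPn => // A0.
by rewrite mule_ge0 ?lee_fin ?unit_ball_volume_ge0// expe_ge0// mule_ge0//
  ?lee_fin ?invr_ge0// ediam_ge0.
Qed.
Hint Resolve hausdorff_gauge_ge0 : core.

Lemma hausdorff_content_ge0 delta A : 0 <= hausdorff_content delta A.
Proof.
by apply: le_ereal_inf_tmp => _ [F _ <-]; apply: nneseries_ge0 => k _ _.
Qed.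

Lemma hausdorff_content_sigma_subadditive (delta : R) :
  (0 < delta)%R -> sigma_subadditive (hausdorff_content delta).
Proof.
move=> delta0 A; have [[i ioo]|] :=
    pselect (exists i, hausdorff_content delta (A i) = +oo).
  rewrite (eseries_pinfty _ _ ioo) ?leey// => k _.
  by rewrite -ltNye (lt_le_trans _ (hausdorff_content_ge0 _ _)).
rewrite -forallNE => Aoo.
suff add2e (e : {posnum R}) : hausdorff_content delta (\bigcup_k A k) <=
    \sum_(i <oo) hausdorff_content delta (A i) + e%:num%:E.
  by apply/lee_addgt0Pr => _/posnumP[].
rewrite (le_trans _ (epsilon_trick _ _ _))//; last first.
  by move=> k; exact: hausdorff_content_ge0.
pose P k (B : nat -> set M) := hausdorff_cover delta (A k) B /\
  \sum_(j <oo) hausdorff_gauge (B j) <=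
  hausdorff_content delta (A k) + (e%:num / (2 ^ k.+1)%:R)%:E.
have [G PG] : {G : nat -> nat -> set M & forall k, P k (G k)}.
  apply: (@choice _ _ P) => k; rewrite /P.
  have fk : hausdorff_content delta (A k) \is a fin_num.
    rewrite ge0_fin_numE ?hausdorff_content_ge0// ltey; apply/eqP.
    exact: Aoo.
  have ek : (0 < e%:num / (2 ^ k.+1)%:R)%R by [].
  have [_ [B AB <-] BS] := lb_ereal_inf_adherent ek fk.
  by exists B; split => //; exact: ltW.
have muG_ge0 x : 0 <= (hausdorff_gauge \o uncurry G) x.
  exact: hausdorff_gauge_ge0.
apply: (@le_trans _ _
    (\esum_(i in setT) (hausdorff_gauge \o uncurry G) i)).
  apply: ereal_inf_lbound => /=.
  have /card_esym/ppcard_eqP[f] := card_nat2.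
  exists (uncurry G \o f).
    split => [i|]; first by rewrite /= /uncurry; case: (f i) => a b;
      exact: (PG a).1.1.
    move=> t [i _ /((PG i).1.2)[j _ Gt]].
    by exists (f^-1%FUN (i, j)) => //=; rewrite invK ?inE.
  rewrite -(esum_pred_image (hausdorff_gauge \o uncurry G) _ xpredT)
    ?[fun=> _]set_true//.
  by rewrite image_eq.
rewrite (_ : esum _ _ = \sum_(i <oo) \sum_(j <oo) hausdorff_gauge (G i j));
    last first.
  pose J : nat -> set (nat * nat) := fun i => [set (i, j) | j in setT].
  rewrite (_ : setT = \bigcup_k J k); last first.
    by rewrite predeqE => -[a b]; split => // _; exists a => //; exists b.
  rewrite esum_bigcupT /=; last 2 first.
    - apply/trivIsetP => i j _ _ ij.
      rewrite predeqE => -[k l] /=; split => //= -[] [_] _ [<-{k} _].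
      by move=> [l' _] [] /esym/eqP; rewrite (negbTE ij).
    - by move=> /= [k l].
  rewrite -(image_id [set: nat]) -fun_true esum_pred_image//; last first.
    by move=> k _; apply: esum_ge0.
  apply: eq_eseriesr => /= j _.
  rewrite -(esum_pred_image (hausdorff_gauge \o uncurry G) (pair j) predT)//=;
    last by move=> ? ? _ _; exact: (@can_inj _ _ _ snd).
  by congr esum; rewrite predeqE => -[a b]; split; move=> [i _ <-]; exists i.
by apply: lee_nneseries => i *; [exact: nneseries_ge0|exact: (PG i).2].
Qed.

Lemma hausdorff_content0 (delta : R) : (0 < delta)%R ->
  hausdorff_content delta set0 = 0.
Proof.
move=> delta0; apply/eqP; rewrite eq_le hausdorff_content_ge0 andbT.
apply: ereal_inf_lbound; exists (fun=> set0).
  split=> // _; rewrite /ediam set0X image_set0 ereal_sup0.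
  exact: leNye.
by rewrite eseries0// => k _ _; rewrite /hausdorff_gauge eqxx.
Qed.

Lemma hausdorff0 : hausdorff set0 = 0.
Proof.
rewrite /hausdorff (_ : image _ _ = [set 0]) ?ereal_sup1//.
apply/seteqP; split=> [_ [d d0 <-]|_ ->]; first exact: hausdorff_content0.
by exists 1%R => /=; rewrite ?ltr01// hausdorff_content0.
Qed.

Lemma hausdorff_ge0 A : 0 <= hausdorff A.
Proof.
apply: (le_trans (hausdorff_content_ge0 1 A)); apply: ereal_sup_ubound.
by exists 1%R => //=; exact: ltr01.
Qed.

Lemma le_hausdorff : {homo hausdorff : A B / A `<=` B >-> A <= B}.
Proof.
move=> A B AB; apply: ge_ereal_sup => _ [d d0 <-].
apply: (@le_trans _ _ (hausdorff_content d B)); last first.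
  by apply: ereal_sup_ubound; exists d.
apply: ereal_inf_le_tmp => _ [F [Fd BF] <-]; exists F => //; split => //.
exact: subset_trans AB BF.
Qed.

Lemma hausdorff_sigma_subadditive : sigma_subadditive hausdorff.
Proof.
move=> A; apply: ge_ereal_sup => _ [d d0 <-].
apply: (le_trans (hausdorff_content_sigma_subadditive d0 A)).
apply: lee_nneseries => k *; first exact: hausdorff_content_ge0.
by apply: ereal_sup_ubound; exists d.
Qed.

HB.instance Definition _ := isOuterMeasure.Build R M hausdorff
  hausdorff0 hausdorff_ge0 le_hausdorff hausdorff_sigma_subadditive.

Definition hausdorff_measure :
  set (caratheodory_type (hausdorff : set M -> \bar R)) -> \bar R := hausdorff.

Let hausdorff_measure0 : hausdorff_measure set0 = 0.
Proof. exact: caratheodory_measure0. Qed.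

Let hausdorff_measure_ge0 A : 0 <= hausdorff_measure A.
Proof. exact: caratheodory_measure_ge0. Qed.

Let hausdorff_measure_sigma_additive : semi_sigma_additive hausdorff_measure.
Proof. exact: caratheodory_measure_sigma_additive. Qed.

HB.instance Definition _ := isMeasure.Build _ _ _ hausdorff_measure
  hausdorff_measure0 hausdorff_measure_ge0 hausdorff_measure_sigma_additive.

(* The sigma-algebra is that of the Caratheodory-measurable sets, which
   contains the Borel sets. The value is real: an infinite integral would give
   0, but all the integrals used below are finite for a Lipschitz star body. *)
Definition hausdorff_integral (D : set M) (f : M -> R) : R :=
  (\int[hausdorff_measure]_(x in D) f x)%R.

End hausdorff_measure.
Arguments hausdorff {R n m} s.
Arguments hausdorff_integral {R n m} s.

Definition supp_fun {R : realType} {m : nat} (Q : set 'rV[R]_m)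
    (x : 'rV[R]_m) : R :=
  sup [set mdot x y | y in Q].

(* Compact convex sets with nonempty interior that contain the origin, which
   is allowed to lie on the boundary. *)
Definition convex_body_o {R : realType} {m : nat} (Q : set 'rV[R]_m) : Prop :=
  [/\ compact Q, convex_set (Q : set (convex_lmodType 'rV[R]_m)),
      interior Q !=set0 & Q 0].

Section star_bodies.
Context {R : realType} {n : nat}.
Implicit Types (K : set 'cV[R]_n) (z : 'cV[R]_n).

Definition radial K z : R := sup [set l : R | 0 <= l /\ K (l *: z)].

Definition star_shaped_o K : Prop :=
  forall z (t : R), K z -> 0 <= t <= 1 -> K (t *: z).

Definition lipschitz_star_body K : Prop :=
  [/\ compact K,
      star_shaped_o K,
      forall z, esphere R n 1 z -> 0 < radial K z,
      {within esphere R n 1, continuous (radial K)} &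
      exists L : R, forall x y, esphere R n 1 x -> esphere R n 1 y ->
        `|radial K x - radial K y| <= L * enorm (x - y)].

Definition regular_boundary K : set 'cV[R]_n :=
  [set z | (closure K `\` interior K) z /\ differentiable (radial K) z].

Definition radial_gradient K z : 'cV[R]_n :=
  \col_i 'd (radial K) z (delta_mx i 0).

(* A Lipschitz star body K is, away from the origin, the superlevel set
   {z | 1 <= radial K z}, and radial K is homogeneous of degree -1; hence the
   gradient at a boundary point is nonzero and points into K. *)
Definition outer_normal K z : 'cV[R]_n :=
  - (enorm (radial_gradient K z))^-1 *: radial_gradient K z.

Definition Lp_surface_area (p : R) K : R :=
  hausdorff_integral n.-1 (regular_boundary K)
    (fun z => mdot z (outer_normal K z) `^ (1 - p)).

End star_bodies.

Section affine_surface_area.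
Context {R : realType} {n m : nat}.
Implicit Types (p : R) (Q : set 'rV[R]_m) (K : set 'cV[R]_n).

Definition supp_proj_body p Q K (x : 'M[R]_(n, m)) : R :=
  hausdorff_integral n.-1 (regular_boundary K)
    (fun z => supp_fun Q ((outer_normal K z)^T *m x) `^ p *
              mdot z (outer_normal K z) `^ (1 - p)) `^ p^-1.

Definition affine_surface_area p Q K : R :=
  hausdorff_integral (n * m).-1 (esphere R n m)
    (fun u => supp_proj_body p Q K u `^ (- (n * m)%:R)) `^ (- (p / (n * m)%:R)).

End affine_surface_area.

(* Main.v *)
(* Write N = n m, q = -N/p < 0 and F_K(u) = h_{Pi_{p,Q} K}(u)^p, so that
   Phi(K) = (int_S F_K^q)^(1/q) over the unit sphere S of M_{n,m}. With
   lam = S_p(K)/S_p(B), the tangent line of the convex function t^q at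
   s = lam F_B(u) gives
     F_K^q >= lam^q (1 - q) F_B^q + q lam^(q-1) F_B^(q-1) F_K.
   The integral of F_B^(q-1) F_K over S is c S_p(K), with c independent of K:
   by Tonelli it is an average over the normals v of K of
     int_S F_B(u)^(q-1) h_Q(v^T u)^p du,
   which does not depend on the unit vector v, since F_B and the Hausdorff
   measure of S are invariant under u |-> g u for orthogonal g. Integrating
   the inequality gives int_S F_K^q >= lam^q int_S F_B^q, hence the claim, as
   1/q < 0. For K = r B one has F_K = r^(n-p) F_B.

   The argument needs F_K > 0 on S. Otherwise there is a nonzero a with
   v . a <= 0 at almost every normal v of K. The gauge of K is Lipschitz, so
   by Rademacher's theorem it would be nonincreasing in the direction a along
   some half-line, although it grows at least linearly at infinity. *)
Require Import Defs.
From HB Require Import structures.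
From mathcomp Require Import all_boot all_order all_algebra.
From mathcomp Require Import all_classical all_reals all_analysis.
From mathcomp Require Import finmap measurable_realfun.
From mathcomp Require Import ring lra.

Set Implicit Arguments.
Unset Strict Implicit.
Unset Printing Implicit Defensive.

Import Order.TTheory GRing.Theory Num.Theory Num.Def numFieldNormedType.Exports.
Local Open Scope classical_set_scope.
Local Open Scope ring_scope.

(** * The Euclidean norm on matrices *)

(** All measures are Hausdorff measures built from covers, so the usual tools of R^N have to be
    recovered for them. Two substitutes shape the proof. Fubini is replaced by Tonelli for (x, t)
    |-> x + t v: a Borel set that is null on every line in one direction is null. Polar coordinates
    are replaced by a statement on null sets: a cone over an (N-1)-null set is N-null. It carries a
    null set of the boundary of K to the space, where Rademacher's theorem applies. That theorem is
    reached by enlarging the set of coordinates along which the function is differentiable; the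
    points lost at each stage are porous on lines, hence null by Lebesgue density. The nonsmooth
    body K is handled through the gauge 1 / radial, which, unlike the radial function, is Lipschitz
    on the whole space and homogeneous of degree 1. As integrals are real numbers with default value
    0, linearity needs finiteness everywhere; bounded measurable integrands on sets of finite
    measure provide it. *)

Section euclidean_space.
Context {R : realType} {n m : nat}.
Implicit Types (x y z : 'M[R]_(n, m)) (a : R).

Lemma mdotE x y : mdot x y = \sum_i \sum_j x i j * y i j.
Proof.
rewrite /mdot /mxtrace exchange_big /=; apply: eq_bigr => j _.
by rewrite mxE; apply: eq_bigr => i _; rewrite mxE.
Qed.

Lemma mdotC x y : mdot x y = mdot y x.
Proof.
by rewrite !mdotE; apply: eq_bigr => i _; apply: eq_bigr => j _; rewrite mulrC.
Qed.

Lemma mdotDl x y z : mdot (x + y) z = mdot x z + mdot y z.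
Proof. by rewrite /mdot linearD mulmxDl linearD. Qed.

Lemma mdotZl a x y : mdot (a *: x) y = a * mdot x y.
Proof. by rewrite /mdot linearZ -scalemxAl linearZ. Qed.

Lemma mdotDr x y z : mdot z (x + y) = mdot z x + mdot z y.
Proof. by rewrite mdotC mdotDl !(mdotC z). Qed.

Lemma mdotZr a x y : mdot y (a *: x) = a * mdot y x.
Proof. by rewrite mdotC mdotZl (mdotC y). Qed.

Lemma mdotNl x y : mdot (- x) y = - mdot x y.
Proof. by rewrite -scaleN1r mdotZl mulN1r. Qed.

Lemma mdotNr x y : mdot y (- x) = - mdot y x.
Proof. by rewrite mdotC mdotNl (mdotC y). Qed.

Lemma mdot0l x : mdot 0 x = 0.
Proof. by rewrite -(scale0r x) mdotZl mul0r. Qed.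

Lemma mdot0r x : mdot x 0 = 0.
Proof. by rewrite mdotC mdot0l. Qed.

Lemma sqr_le_mdot x i j : x i j ^+ 2 <= mdot x x.
Proof.
rewrite mdotE (bigD1 i)//= (bigD1 j)//= -expr2 -addrA lerDl addr_ge0//.
  by apply: sumr_ge0 => k _; rewrite -expr2 sqr_ge0.
by apply: sumr_ge0 => k _; apply: sumr_ge0 => l _; rewrite -expr2 sqr_ge0.
Qed.

Lemma mdot_ge0 x : 0 <= mdot x x.
Proof.
rewrite mdotE; apply: sumr_ge0 => i _; apply: sumr_ge0 => j _.
by rewrite -expr2 sqr_ge0.
Qed.

Lemma enorm_ge0 x : 0 <= enorm x.
Proof. exact: sqrtr_ge0. Qed.

Lemma sqr_enorm x : enorm x ^+ 2 = mdot x x.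
Proof. by rewrite sqr_sqrtr// mdot_ge0. Qed.

Lemma enorm_coord x i j : `|x i j| <= enorm x.
Proof. by rewrite -sqrtr_sqr ler_sqrt ?mdot_ge0// sqr_le_mdot. Qed.

Lemma enorm_eq0 x : (enorm x == 0) = (x == 0).
Proof.
apply/eqP/eqP => [x0|->]; last by rewrite /enorm mdot0l sqrtr0.
apply/matrixP => i j; rewrite mxE; apply/eqP.
by rewrite -normr_le0 -x0 enorm_coord.
Qed.

Lemma enorm0 : enorm (0 : 'M[R]_(n, m)) = 0.
Proof. by apply/eqP; rewrite enorm_eq0. Qed.

Lemma enorm_gt0 x : (0 < enorm x) = (x != 0).
Proof. by rewrite lt_neqAle enorm_ge0 andbT eq_sym enorm_eq0. Qed.

Lemma enormZ a x : enorm (a *: x) = `|a| * enorm x.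
Proof.
by rewrite /enorm mdotZl mdotZr mulrA -expr2 sqrtrM ?sqr_ge0// sqrtr_sqr.
Qed.

Lemma enormN x : enorm (- x) = enorm x.
Proof. by rewrite -scaleN1r enormZ normrN1 mul1r. Qed.

Lemma enormBC x y : enorm (x - y) = enorm (y - x).
Proof. by rewrite -enormN opprB. Qed.

Lemma mdot_le x y : mdot x y <= enorm x * enorm y.
Proof.
have [->|y0] := eqVneq y 0; first by rewrite mdot0r enorm0 mulr0.
have [->|x0] := eqVneq x 0; first by rewrite mdot0l enorm0 mul0r.
have := mdot_ge0 (enorm y *: x - enorm x *: y).
rewrite !(mdotDl, mdotDr, mdotNl, mdotNr, mdotZl, mdotZr).
rewrite -!sqr_enorm (mdotC y x).
have px : 0 < enorm x by rewrite enorm_gt0.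
have py : 0 < enorm y by rewrite enorm_gt0.
set a := enorm x; set b := enorm y; set c := mdot x y => H.
rewrite -subr_ge0 -(pmulr_rge0 _ (_ : 0 < a * b * 2)) ?mulr_gt0//.
by apply: (le_trans H); rewrite le_eqVlt; apply/orP; left; apply/eqP; ring.
Qed.

Lemma normr_mdot_le x y : `|mdot x y| <= enorm x * enorm y.
Proof.
by rewrite ler_norml mdot_le andbT lerNl -mdotNl -(enormN x) mdot_le.
Qed.

Lemma enormD x y : enorm (x + y) <= enorm x + enorm y.
Proof.
rewrite -(@ler_pXn2r _ 2) ?nnegrE ?addr_ge0 ?enorm_ge0//.
rewrite sqr_enorm mdotDl !mdotDr -!sqr_enorm (mdotC y x) sqrrD.
have := mdot_le x y; lra.
Qed.

Lemma enormB x y : enorm (x - y) <= enorm x + enorm y.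
Proof. by rewrite -(enormN y) enormD. Qed.

Lemma enorm_dist x y : `|enorm x - enorm y| <= enorm (x - y).
Proof.
have := enormD (x - y) y; rewrite subrK => h1.
have := enormD (y - x) x; rewrite subrK (enormBC y) => h2.
by rewrite ler_norml; lra.
Qed.

Lemma mx_norm_le_enorm x : `|x| <= enorm x.
Proof.
rewrite [leLHS]/normr /= mx_normrE.
elim/big_ind : _ => [|u v hu hv|i _]; first exact: enorm_ge0.
  by rewrite ge_max hu hv.
exact: enorm_coord.
Qed.

Lemma coord_le_mx_norm x i j : `|x i j| <= `|x|.
Proof.
rewrite [leRHS]/normr /= mx_normrE.
by rewrite (@le_bigmax _ _ _ 0 (fun k : 'I_n * 'I_m => `|x k.1 k.2|) (i, j)).
Qed.

(** The constant is deliberately crude: nm squares add up to at most nm a^2 <= (nm a)^2 as soon as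
    nm >= 1, which a nonzero matrix guarantees. *)
Lemma enorm_le_bound x a : 0 <= a -> (forall i j, `|x i j| <= a) ->
  enorm x <= (n * m)%:R * a.
Proof.
move=> a0 xa; have [->|x0] := eqVneq x 0.
  by rewrite enorm0 mulr_ge0.
have nm : (0 < n * m)%N.
  rewrite lt0n; apply: contra x0 => nm; apply/eqP/matrixP => i j.
  move: nm; rewrite muln_eq0 => /orP[] /eqP k0.
    by have := ltn_ord i; rewrite [X in (_ < X)%N]k0.
  by have := ltn_ord j; rewrite [X in (_ < X)%N]k0.
rewrite -(@ler_pXn2r _ 2) ?nnegrE ?mulr_ge0 ?enorm_ge0//.
rewrite sqr_enorm mdotE; apply: (@le_trans _ _ (\sum_(i < n) \sum_(j < m) a ^+ 2)).
  by apply: ler_sum => i _; apply: ler_sum => j _; rewrite -expr2 -real_normK ?num_real//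
    ler_pXn2r ?nnegrE.
under eq_bigr do rewrite sumr_const card_ord.
rewrite sumr_const card_ord -mulrnA (mulnC m n) -[leLHS]mulr_natl [leRHS]exprMn.
rewrite ler_wpM2r ?sqr_ge0// expr2 ler_peMr// ler1n; exact: nm.
Qed.

Lemma enorm_le_mx_norm x : enorm x <= (n * m)%:R * `|x|.
Proof. by apply: enorm_le_bound => // i j; exact: coord_le_mx_norm. Qed.

(** Bridge between the topology of the library, given by the maximum norm, and Euclidean distances;
    the two norms compare with the constants 1 and nm. *)
Lemma nbhs_enormP x (A : set 'M[R]_(n, m)) :
  nbhs x A <-> exists2 e, 0 < e & forall y, enorm (y - x) < e -> A y.
Proof.
split=> [xA|[e e0 eA]].
  have /nbhs_normP[e /= e0 eA] : \near x, A x by exact: xA.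
  exists e => // y yx; apply: eA; rewrite /ball_ /=.
  by rewrite -normrN opprB (le_lt_trans (mx_norm_le_enorm _)).
(* The added 1 keeps the divisor positive for empty matrices. *)
apply/(@nbhs_normP R 'M[R]_(n, m) x A); exists (e / ((n * m)%:R + 1)) => /=.
  by rewrite divr_gt0// ltr_wpDl.
move=> y; rewrite /ball_/= -normrN opprB ltr_pdivlMr ?ltr_wpDl// => yx.
apply: eA; apply: (le_lt_trans (enorm_le_mx_norm _)).
by rewrite (le_lt_trans _ yx)// mulrC ler_wpM2l// lerDl.
Qed.

Lemma enorm_continuous : continuous (@enorm R n m).
Proof.
move=> x; apply/(@cvgrPdist_lt R R^o _ (nbhs x) (nbhs_filter x)) => e e0.
apply/nbhs_enormP; exists e => // y yx.
by rewrite (le_lt_trans (enorm_dist _ _))// enormBC.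
Qed.

End euclidean_space.

(** * Hausdorff measures *)

Section ereal_power.
Context {R : realType}.
Local Open Scope ereal_scope.
Implicit Types x y : \bar R.

Lemma lee_expe x y k : 0 <= x -> x <= y -> x ^+ k <= y ^+ k.
Proof.
move=> x0 xy; elim: k => [|k ih]; first by rewrite !expe0.
by rewrite !expeS lee_pmul// expe_ge0.
Qed.

Lemma expeMl (r : R) x k : (r%:E * x) ^+ k = (r ^+ k)%:E * x ^+ k.
Proof.
elim: k => [|k ih]; first by rewrite !expe0 expr0 mul1e.
by rewrite !expeS ih exprS EFinM muleACA.
Qed.

End ereal_power.

Lemma unit_ball_volume_gt0 (R : realType) k : 0 < unit_ball_volume R k.
Proof.
suff : ((0 < unit_ball_volume R k) && (0 < unit_ball_volume R k.+1))%R.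
  by case/andP.
elim: k => [|k /andP[k0 k1]]; first by rewrite /= ltr01 ltr0n.
by rewrite k1 /= mulr_gt0// divr_gt0// mulr_gt0// pi_gt0.
Qed.

Section hausdorff_basics.
Context {R : realType} {n m : nat}.
Local Open Scope ereal_scope.
Implicit Types A B : set 'M[R]_(n, m).

Lemma enorm_le_ediam A x y : A x -> A y -> (enorm (x - y))%:E <= ediam A.
Proof. by move=> Ax Ay; apply: ereal_sup_ubound; exists (x, y). Qed.

Lemma ediam_le A (d : \bar R) :
  (forall x y, A x -> A y -> (enorm (x - y))%:E <= d) -> ediam A <= d.
Proof.
by move=> h; apply: ge_ereal_sup => _ [[x y] [/= Ax Ay] <-]; exact: h.
Qed.

Lemma hausdorff_gauge0 s : hausdorff_gauge s (set0 : set 'M[R]_(n, m)) = 0.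
Proof. by rewrite /hausdorff_gauge eqxx. Qed.

Lemma hausdorff_gauge_le_pow s A (d : R) : (0 <= d)%R -> ediam A <= d%:E ->
  hausdorff_gauge s A <= (unit_ball_volume R s * (d / 2) ^+ s)%:E.
Proof.
move=> d0 Ad; rewrite /hausdorff_gauge; case: ifPn => [_|A0].
  by rewrite lee_fin mulr_ge0 ?unit_ball_volume_ge0// exprn_ge0// divr_ge0.
rewrite EFinM lee_wpmul2l ?lee_fin ?unit_ball_volume_ge0// EFin_expe lee_expe//.
  by rewrite mule_ge0 ?lee_fin ?invr_ge0// ediam_ge0.
by rewrite EFinM muleC lee_wpmul2r.
Qed.

Lemma hausdorff_content_le_hausdorff s (d : R) A : (0 < d)%R ->
  hausdorff_content s d A <= hausdorff s A.
Proof. by move=> d0; apply: ereal_sup_ubound; exists d. Qed.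

Lemma hausdorff_le s A (c : \bar R) :
  (forall d : R, (0 < d)%R -> hausdorff_content s d A <= c) ->
  hausdorff s A <= c.
Proof. by move=> h; apply: ge_ereal_sup => _ [d d0 <-]; exact: h. Qed.

Lemma le_hausdorff_content s (d : R) A B : A `<=` B ->
  hausdorff_content s d A <= hausdorff_content s d B.
Proof.
move=> AB; apply: ereal_inf_le_tmp => _ [F [Fd BF] <-]; exists F => //; split => //.
exact: subset_trans AB BF.
Qed.

Lemma hausdorff_content_le_gauge s (d : R) A : (0 < d)%R -> ediam A <= d%:E ->
  hausdorff_content s d A <= hausdorff_gauge s A.
Proof.
move=> d0 Ad; apply: ereal_inf_lbound.
exists (fun k => if k is 0%N then A else set0).
  split; last by move=> x Ax; exists 0%N.
  move=> [|k]//; apply: ediam_le => x y //.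
rewrite (nneseries_recl (P := xpredT)) //=; last first.
  by move=> [|k] _; exact: hausdorff_gauge_ge0.
rewrite eseries0 ?adde0// => -[|k]// _ _; exact: hausdorff_gauge0.
Qed.

Lemma hausdorff_content_finite_cover s (d : R) (I : finType) (P : pred I)
    (F : I -> set 'M[R]_(n, m)) A :
  (0 < d)%R -> A `<=` \bigcup_(i in [set i | P i]) F i ->
  (forall i, P i -> ediam (F i) <= d%:E) ->
  hausdorff_content s d A <= \sum_(i | P i) hausdorff_gauge s (F i).
Proof.
move=> d0 AF Fd.
pose G k := if insub k is Some i then
  (if P (enum_val i) then F (enum_val (i : 'I_#|I|)) else set0) else set0.
have GE (i : 'I_#|I|) : G i = if P (enum_val i) then F (enum_val i) else set0.
  by rewrite /G valK.
have AG : A `<=` \bigcup_k G k.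
  move=> x /AF[i /= Pi Fx]; exists (enum_rank i) => //.
  by rewrite GE enum_rankK Pi.
apply: (le_trans (le_hausdorff_content s d AG)).
apply: (le_trans (@hausdorff_content_sigma_subadditive R n m s d d0 G)).
rewrite (nneseries_split 0 #|I|) => [|k _]; last exact: hausdorff_content_ge0.
rewrite add0n [X in _ + X]eseries0 ?adde0.
  rewrite big_mkord [leRHS]big_mkcond/=.
  rewrite [leRHS](reindex (fun i : 'I_#|I| => enum_val i))/=; last first.
    by exists enum_rank => i _; rewrite ?enum_valK ?enum_rankK.
  apply: lee_sum => i _; rewrite GE; case: ifPn => Pi.
    by rewrite hausdorff_content_le_gauge ?Fd.
  by rewrite hausdorff_content0.
move=> k Ik _; rewrite /G insubN ?hausdorff_content0// -leqNgt//.
Qed.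

End hausdorff_basics.

Section hausdorff_image.
Context {R : realType} {n m n' m' : nat}.
Local Open Scope ereal_scope.
Implicit Types (A : set 'M[R]_(n, m)) (f : 'M[R]_(n, m) -> 'M[R]_(n', m')).

Lemma hausdorff_content_image s (L d : R) f A : (0 < L)%R -> (0 < d)%R ->
  (forall x y, A x -> A y -> (enorm (f x - f y) <= L * enorm (x - y))%R) ->
  hausdorff_content s (L * d) (f @` A) <=
  (L ^+ s)%:E * hausdorff_content s d A.
Proof.
move=> L0 d0 fL; rewrite -lee_pdivrMl ?exprn_gt0//.
apply: le_ereal_inf_tmp => _ [F [Fd AF] <-].
rewrite lee_pdivrMl ?exprn_gt0// -nneseriesZl => [|k _]; last first.
  exact: hausdorff_gauge_ge0.
(* Only the part of [F k] inside [A] is mapped, since the Lipschitz bound holds on [A] alone. *)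
have fAF k : ediam (f @` (A `&` F k)) <= L%:E * ediam (F k).
  apply: ediam_le => _ _ [x [Ax Fx] <-] [y [Ay Fy] <-].
  apply: (@le_trans _ _ (L%:E * (enorm (x - y))%:E)).
    by rewrite -EFinM lee_fin fL.
  by apply: lee_wpmul2l; [rewrite lee_fin ltW|exact: enorm_le_ediam].
apply: (@le_trans _ _
    (\sum_(k <oo) hausdorff_gauge s (f @` (A `&` F k)))).
  apply: ereal_inf_lbound; exists (fun k => f @` (A `&` F k)) => //; split.
    move=> k; apply: (le_trans (fAF k)).
    by rewrite EFinM; apply: lee_wpmul2l; [rewrite lee_fin ltW|exact: Fd].
  by move=> _ [x Ax <-]; have [k _ Fx] := AF x Ax; exists k => //; exists x.
apply: lee_nneseries => k *; first exact: hausdorff_gauge_ge0.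
rewrite [leLHS]/hausdorff_gauge; case: ifPn => [_|fAk0].
  apply: mule_ge0; first by rewrite lee_fin exprn_ge0 ?ltW.
  exact: hausdorff_gauge_ge0.
rewrite /hausdorff_gauge ifF; last first.
  apply/negbTE/set0P; move/set0P : fAk0 => [_ [x [_ Fx] _]]; by exists x.
rewrite muleCA lee_wpmul2l ?lee_fin ?unit_ball_volume_ge0// -expeMl.
rewrite lee_expe ?mule_ge0 ?lee_fin ?ediam_ge0// muleCA lee_wpmul2l//.
Qed.

Lemma hausdorff_image s (L : R) f A : (0 < L)%R ->
  (forall x y, A x -> A y -> (enorm (f x - f y) <= L * enorm (x - y))%R) ->
  hausdorff s (f @` A) <= (L ^+ s)%:E * hausdorff s A.
Proof.
move=> L0 fL; apply: hausdorff_le => d d0.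
have -> : d = (L * (L^-1 * d))%R by rewrite mulVKf// gt_eqF.
apply: (le_trans (hausdorff_content_image s _ _ fL)) => //.
  by rewrite mulr_gt0 ?invr_gt0.
apply: lee_wpmul2l; first by rewrite lee_fin exprn_ge0 ?ltW.
by apply: hausdorff_content_le_hausdorff; rewrite mulr_gt0 ?invr_gt0.
Qed.

End hausdorff_image.

Section hausdorff_similarity.
Context {R : realType} {n m : nat}.
Local Open Scope ereal_scope.
Implicit Types (A : set 'M[R]_(n, m)) (f g : 'M[R]_(n, m) -> 'M[R]_(n, m)).

Lemma hausdorff_similarity s (L : R) f g A : (0 < L)%R ->
  cancel f g -> cancel g f ->
  (forall x y, enorm (f x - f y) = L * enorm (x - y))%R ->
  hausdorff s (f @` A) = (L ^+ s)%:E * hausdorff s A.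
Proof.
move=> L0 fg gf fL; apply/eqP; rewrite eq_le; apply/andP; split.
  by apply: hausdorff_image => // x y _ _; rewrite fL.
rewrite muleC -lee_pdivlMr ?exprn_gt0// muleC -exprVn.
have {1}-> : A = g @` (f @` A).
  by rewrite image_comp (_ : g \o f = idfun) ?image_id//; exact/funext.
apply: hausdorff_image; first by rewrite invr_gt0.
move=> _ _ [x _ <-] [y _ <-]; rewrite !fg fL mulrA mulVf ?mul1r//.
by rewrite gt_eqF.
Qed.

End hausdorff_similarity.

(** * Finite measure of the faces of a cube *)

Section hausdorff_grid.
Context {R : realType} {n m : nat}.
Local Notation M := 'M[R]_(n, m).

Lemma grid_point (N : nat) (y : R) : `|y| <= 1 ->
  exists k : 'I_N.+1, `|y - (-1 + 2 * k%:R / N.+1%:R)| <= 2 / N.+1%:R.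
Proof.
rewrite ler_norml => /andP[y1 y2].
have N0 : 0 < N.+1%:R :> R by [].
pose t := (y + 1) * N.+1%:R / 2.
have t0 : 0 <= t by rewrite divr_ge0// mulr_ge0// -lerBlDr sub0r.
have tN : t <= N.+1%:R by rewrite /t ler_pdivrMr// mulrC ler_wpM2l//; lra.
have yt : y = -1 + 2 * t / N.+1%:R by rewrite /t; field; rewrite gt_eqF.
have /truncn_itv/andP[h1 h2] := t0.
have [kN|kN] := ltnP (truncn t) N.+1.
  exists (Ordinal kN) => /=; rewrite [in leLHS]yt.
  rewrite (_ : _ - _ = 2 * (t - (truncn t)%:R) / N.+1%:R); last by ring.
  rewrite ger0_norm; last by rewrite divr_ge0// mulr_ge0// subr_ge0.
  by rewrite ler_pM2r ?invr_gt0//; move: h2; rewrite -natr1; lra.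
(* Only y = 1 is left; the last grid point is at distance exactly 2 / (N + 1) from it. *)
exists ord_max => /=; rewrite [in leLHS]yt.
have -> : t = N.+1%:R.
  by apply/eqP; rewrite eq_le tN (le_trans _ h1)// ler_nat.
rewrite (_ : _ - _ = 2 / N.+1%:R); last first.
  by rewrite -natr1 in N0 *; field; move: N0; lra.
by rewrite ger0_norm// divr_ge0.
Qed.

(** A grid in the free coordinates gives (N + 1)^#|I| pieces of diameter at most 4 nm / (N + 1), so
    the powers of N + 1 cancel in the sum of the gauges and the bound does not depend on the
    scale. *)
Lemma hausdorff_face_lty (I : {set 'I_n * 'I_m}) (c : M) :
  (hausdorff #|I| [set y : M | (forall i j, (i, j) \in I -> (`|y i j| <= 1)%R) /\
    (forall i j, (i, j) \notin I -> y i j = c i j)] < +oo)%E.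
Proof.
set A := [set y : M | _].
pose C : R := unit_ball_volume R #|I| * (2 * (n * m)%:R) ^+ #|I|.
apply: (@le_lt_trans _ _ C%:E); last by rewrite ltry.
apply: hausdorff_le => d d0.
pose N := truncn ((n * m)%:R * 4 / d).
have N0 : 0 < N.+1%:R :> R by [].
have dN : (n * m)%:R * (4 / N.+1%:R) <= d.
  rewrite mulrA ler_pdivrMr// [leRHS]mulrC -ler_pdivrMr//.
  exact/ltW/truncnS_gt.
(* Grid indices are frozen to [ord0] outside [I]: the number of pieces is then a power with exponent
   #|I| instead of nm. *)
pose P := [pred g | g \in pffun_on (ord0 : 'I_N.+1) (mem I) predT].
pose F (g : {ffun 'I_n * 'I_m -> 'I_N.+1}) := [set y : M | A y /\
  forall i j, (i, j) \in I ->
    `|y i j - (-1 + 2 * (g (i, j))%:R / N.+1%:R)| <= 2 / N.+1%:R].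
have FE g : (ediam (F g) <= ((n * m)%:R * (4 / N.+1%:R))%:E)%E.
  apply: ediam_le => x y [Ax Fx] [Ay Fy]; rewrite lee_fin.
  apply: enorm_le_bound => [|i j]; first by rewrite divr_ge0.
  have [ijI|ijI] := boolP ((i, j) \in I).
    rewrite !mxE; have := Fx _ _ ijI; have := Fy _ _ ijI.
    rewrite !ler_norml (_ : 4 / N.+1%:R = 2 / N.+1%:R + 2 / N.+1%:R); last by field; rewrite gt_eqF.
    by move: (-1 + _) (2 / N.+1%:R) => u v; lra.
  by rewrite !mxE Ax.2// Ay.2// subrr normr0 divr_ge0.
have AF : A `<=` \bigcup_(g in [set g | P g]) F g.
  move=> y Ay; have /choice[g gP] : forall ij : 'I_n * 'I_m, exists k : 'I_N.+1,
      if ij \in I then `|y ij.1 ij.2 - (-1 + 2 * k%:R / N.+1%:R)| <= 2 / N.+1%:R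
      else k == ord0.
    move=> [i j]; have [ijI|_] := boolP ((i, j) \in I); last by exists ord0.
    exact: grid_point (Ay.1 i j ijI).
  exists [ffun ij => g ij].
    apply/pfamilyP; split=> //.
    apply/supportP => ij ijI; rewrite ffunE; apply/eqP.
    by have := gP ij; rewrite (negbTE ijI).
  split=> // i j ijI; rewrite ffunE.
  by have := gP (i, j); rewrite ijI.
apply: (le_trans (hausdorff_content_finite_cover _ d0 AF _)) => [g _|].
  by rewrite (le_trans (FE g))// lee_fin.
apply: (@le_trans _ _ (\sum_(g | P g)
    (unit_ball_volume R #|I| * ((n * m)%:R * (4 / N.+1%:R) / 2) ^+ #|I|)%:E)%E).
  apply: lee_sum => g _; apply: hausdorff_gauge_le_pow (FE g).
  by apply: mulr_ge0 => //; exact: divr_ge0.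
rewrite sumEFin lee_fin sumr_const.
rewrite (_ : #|P| = (N.+1 ^ #|I|)%N); last first.
  by rewrite /P card_pffun_on cardT size_enum_ord.
rewrite -[leLHS]mulr_natl natrX mulrCA -exprMn /C le_eqVlt; apply/orP; left; apply/eqP.
by congr (_ * _ ^+ _); field; rewrite gt_eqF.
Qed.

End hausdorff_grid.

(** * Covers of null sets with small total cost *)

Section null_cover.
Context {R : realType} {n m : nat}.
Local Open Scope ereal_scope.
Implicit Types Z : set 'M[R]_(n, m).

Lemma ediam0 : ediam (set0 : set 'M[R]_(n, m)) = -oo.
Proof. by rewrite /ediam set0X image_set0 ereal_sup0. Qed.

(** The radii are positive even where the covering set is a point or empty: later arguments divide
    by [r k] or enlarge [F k] to an open ball of comparable radius. *)
Lemma hausdorff0_cover s Z (e d : R) : (0 < s)%N -> hausdorff s Z = 0 ->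
  (0 < e)%R -> (0 < d)%R ->
  exists F : nat -> set 'M[R]_(n, m), exists r : nat -> R,
  [/\ Z `<=` \bigcup_k F k, forall k, (0 < r k <= d)%R,
      forall k, ediam (F k) <= (r k)%:E &
      \sum_(k <oo) ((r k) ^+ s)%:E <= e%:E].
Proof.
move=> s0 Z0 e0 d0; set w := unit_ball_volume R s.
have w0 : (0 < w)%R by exact: unit_ball_volume_gt0.
have c0 : hausdorff_content s d Z = 0.
  apply/eqP; rewrite eq_le hausdorff_content_ge0 andbT -Z0.
  exact: hausdorff_content_le_hausdorff.
(* The factor turns gauges w (diam / 2)^s back into powers diam^s, within half of the budget e. *)
pose e' := (w / 2 ^+ s * (e / 2))%R.
have e'0 : (0 < e')%R by rewrite mulr_gt0// divr_gt0// exprn_gt0.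
have [_ [F [Fd ZF] <-]] : exists2 x, [set \sum_(k <oo) hausdorff_gauge s (F k)
    | F in hausdorff_cover d Z] x & x < hausdorff_content s d Z + e'%:E.
  by apply: lb_ereal_inf_adherent => //; rewrite -/(hausdorff_content s d Z) c0.
rewrite c0 add0e => Fe.
(* The bound by 1 gives h^s <= h because s > 0, so these floors add at most e / 2 to the sum. *)
pose h k : R := minr 1%R (minr d (e / 2 / (2 ^ k.+1)%:R)%R).
have h0 k : (0 < h k)%R.
  by rewrite !lt_min ltr01 d0 divr_gt0 ?divr_gt0// ltr0n expn_gt0.
(* [fine] sends the diameter -oo of the empty set to 0. *)
pose r k := maxr (fine (ediam (F k))) (h k).
exists F, r; split=> //.
- move=> k; rewrite lt_max h0 orbT ge_max !ge_min lexx !orbT andbT/=.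
  have [F0|/set0P/set0P F0] := eqVneq (F k) set0.
    by rewrite F0 ediam0/= ltW.
  rewrite -lee_fin fineK// ge0_fin_numE ?ediam_ge0//.
  by rewrite (le_lt_trans (Fd k))// ltry.
- move=> k; rewrite /r; have := Fd k.
  have [F0|/set0P/set0P F0] := eqVneq (F k) set0.
    by move=> _; rewrite F0 ediam0 leNye.
  move=> Fkd; have {1}<- : (fine (ediam (F k)))%:E = ediam (F k).
    by rewrite fineK// ge0_fin_numE ?ediam_ge0// (le_lt_trans Fkd)// ltry.
  by rewrite lee_fin le_max lexx.
apply: (@le_trans _ _ (\sum_(k <oo) ((2 ^+ s / w)%:E * hausdorff_gauge s (F k) +
    (e / 2 / (2 ^ k.+1)%:R)%:E))).
  apply: lee_nneseries => k *.
    by rewrite lee_fin exprn_ge0// le_max (ltW (h0 k)) orbT.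
  have g0 : 0 <= (2 ^+ s / w)%:E * hausdorff_gauge s (F k).
    by apply: mule_ge0; [rewrite lee_fin divr_ge0// ltW|exact: hausdorff_gauge_ge0].
  rewrite /r maxElt; case: ifPn => _.
    rewrite -[leLHS]add0e; apply: leeD => //; rewrite lee_fin.
    apply: (@le_trans _ _ (h k)); last by rewrite !ge_min lexx !orbT.
    rewrite -[leRHS]expr1 ler_wiXn2l ?(ltW (h0 k))//.
    by rewrite ge_min lexx.
  rewrite -[leLHS]adde0; apply: leeD; last first.
    by rewrite lee_fin divr_ge0 ?divr_ge0// ltW.
  have [F0|/set0P/set0P F0] := eqVneq (F k) set0.
    rewrite F0 ediam0/= expr0n gtn_eqF//=.
    by rewrite -F0.
  rewrite /hausdorff_gauge (negbTE F0) -/w muleA -EFinM divfK ?gt_eqF//.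
  have Ff : ediam (F k) \is a fin_num.
    by rewrite ge0_fin_numE ?ediam_ge0// (le_lt_trans (Fd k))// ltry.
  by rewrite -expeMl muleA -EFinM mulfV// mul1e EFin_expe fineK.
rewrite nneseriesD; last 2 first.
- move=> k _ _; apply: mule_ge0; [by rewrite lee_fin divr_ge0// ltW|].
  exact: hausdorff_gauge_ge0.
- by move=> k _ _; rewrite lee_fin divr_ge0 ?divr_ge0// ltW.
rewrite nneseriesZl => [|k _]; last exact: hausdorff_gauge_ge0.
have -> : e%:E = (e / 2)%:E + (e / 2)%:E by rewrite -EFinD -splitr.
apply: leeD.
  rewrite -lee_pdivlMl ?divr_gt0 ?exprn_gt0//; apply: (le_trans (ltW Fe)).
  by rewrite -EFinM lee_fin /e' invf_div.
by apply: epsilon_trick0; rewrite divr_ge0// ltW.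
Qed.

End null_cover.

Section matrix_compact.
Context {R : realType} {n m : nat}.
Local Notation M := 'M[R]_(n, m).

Lemma mx_norm_le (p q : nat) (x : 'M[R]_(p, q)) (a : R) : 0 <= a ->
  (forall i j, `|x i j| <= a) -> `|x| <= a.
Proof.
move=> a0 xa; rewrite [leLHS]/normr /= mx_normrE.
by elim/big_ind : _ => // u v hu hv; rewrite ge_max hu.
Qed.

Lemma lipschitz_mx_continuous (p q : nat) (V : normedModType R) (f : 'M[R]_(p, q) -> V) (L : R) :
  0 < L -> (forall x y, `|f x - f y| <= L * `|x - y|) -> continuous f.
Proof.
move=> L0 fL x; apply/(@cvgrPdist_lt R V _ (nbhs x) (nbhs_filter x)) => e e0.
apply/nbhs_enormP; exists (e / L); first by rewrite divr_gt0.
move=> y yx; apply: (le_lt_trans (fL _ _)).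
rewrite mulrC -ltr_pdivlMr// (le_lt_trans _ yx)// -normrN opprB.
exact: mx_norm_le_enorm.
Qed.

Lemma vec_mx_continuous : continuous (@vec_mx R n m).
Proof.
apply: (@lipschitz_mx_continuous _ _ _ _ 1) => // x y; rewrite mul1r.
apply: mx_norm_le => // i j.
have -> : (vec_mx x - vec_mx y) i j = (x - y) 0 (mxvec_index i j).
  by rewrite -(mxvecE (vec_mx x - vec_mx y)) linearB/= !vec_mxK.
exact: coord_le_mx_norm.
Qed.

(** Heine-Borel is transported from row vectors along [vec_mx]. *)
Lemma mx_closed_bounded_compact (A : set M) (a : R) :
  closed A -> (forall x, A x -> enorm x <= a) -> compact A.
Proof.
move=> cA bA; rewrite (_ : A = @vec_mx R n m @` (@vec_mx R n m @^-1` A)).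
  apply: continuous_compact.
    by apply: continuous_subspaceT; exact: vec_mx_continuous.
  apply: bounded_closed_compact; last first.
    by apply: closed_comp => // x _; exact: vec_mx_continuous.
  exists a; split; first exact: num_real.
  move=> b ab x /= Ax; apply: mx_norm_le.
    by rewrite (le_trans (enorm_ge0 (vec_mx x)))// (le_trans (bA _ Ax))// ltW.
  move=> i j; rewrite ord1 -[x]vec_mxK; case/mxvec_indexP: j => k l.
  by rewrite mxvecE (le_trans (enorm_coord _ _ _))// (le_trans (bA _ Ax))// ltW.
apply/seteqP; split=> [x Ax|_ [x Ax <-]//].
by exists (mxvec x); rewrite /= mxvecK.
Qed.

End matrix_compact.

(** * Positivity of the measure of a cube *)

Section hausdorff_positive.
Context {R : realType} {n m : nat}.
Local Notation M := 'M[R]_(n, m).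

(** Any two such integers differ by less than 2r, so subtracting the smallest one embeds them in an
    interval of [(truncn (2 * r)).+1] integers. *)
Lemma card_ord_near (N : nat) (c r : R) : 0 < r ->
  #|[set k : 'I_N | `|k%:R - c| < r]%SET|%:R <= 2 * r + 1.
Proof.
move=> r0; set S := [set k : 'I_N | _]%SET.
have [->|[k0 k0S]] := set_0Vmem S.
  by rewrite cards0 addr_ge0// mulr_ge0// ltW.
have [k kS kmin] := @arg_minnP _ k0 (mem S) (fun k => val k) k0S.
pose K := truncn (2 * r).
apply: (@le_trans _ _ K.+1%:R); last first.
  rewrite -natr1 lerD2r; have /truncn_itv/andP[] // : 0 <= 2 * r.
  by rewrite mulr_ge0// ltW.
have inS (j : 'I_N) : j \in S -> (j - k < K.+1)%N.
  move=> jS; rewrite ltnS truncn_ge_nat ?mulr_ge0 ?(ltW r0)//.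
  rewrite natrB ?kmin//; move: jS kS; rewrite !inE !ltr_norml; lra.
rewrite ler_nat -[K.+1]card_ord.
rewrite -(card_in_imset (f := fun j : 'I_N => inord (j - k) : 'I_K.+1)).
  exact: max_card.
move=> i j iS jS /(congr1 val); rewrite /= !inordK ?inS// => ij.
by apply/val_inj; rewrite /= -(subnK (kmin _ iS)) ij subnK// kmin.
Qed.

Lemma enorm_ball_open (x : M) (r : R) : open [set y : M | enorm (y - x) < r].
Proof.
rewrite openE => y /= yr; apply/nbhs_enormP; exists (r - enorm (y - x)).
  by rewrite subr_gt0.
move=> z zy /=; rewrite -(subrK y z) -addrA.
by rewrite (le_lt_trans (enormD _ _))// -ltrBrDr.
Qed.

Lemma cube_compact : compact [set y : M | forall i j, 0 <= y i j <= 1].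
Proof.
apply: (@mx_closed_bounded_compact _ _ _ _ ((n * m)%:R * 1)); last first.
  move=> x x01; apply: enorm_le_bound => // i j.
  by have /andP[h1 h2] := x01 i j; rewrite ger0_norm.
rewrite (_ : [set y | _] = \bigcap_(ij in [set: 'I_n * 'I_m])
   ((fun y : M => y ij.1 ij.2) @^-1` `[0, 1]%classic)).
  apply: closed_bigI => ij _; apply: closed_comp => [y _|].
    exact: coord_continuous.
  exact: itv_closed.
apply/seteqP; split=> [y y01 ij _|y y01 i j] /=; first by rewrite in_itv/= y01.
by have := y01 (i, j) I; rewrite /= in_itv.
Qed.

(* Finitely many small balls would cover the cube; counting the points of a
   fine grid in each of them bounds the number of grid points in the cube. *)
Lemma hausdorff_cube_gt0 : (0 < n * m)%N ->
  (0 < hausdorff (n * m) [set y : M | forall i j, (0 <= y i j <= 1)%R])%E.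
Proof.
move=> nm0; rewrite lt_neqAle hausdorff_ge0 andbT eq_sym; apply/negP => /eqP H0.
set N := (n * m)%N in nm0 H0 *.
(* A ball of radius 2 r_k contains at most (4 r_k L + 1)^N <= (5 r_k L)^N points of the grid of mesh
   1 / L; with this e the L^N grid points would number at most L^N / 2. *)
pose e : R := (2 * 5 ^+ N)^-1.
have e0 : 0 < e by rewrite invr_gt0 mulr_gt0// exprn_gt0.
have [F [r [QF r0 Fr re]]] := hausdorff0_cover nm0 H0 e0 ltr01.
have rk0 k : 0 < r k by case/andP: (r0 k).
pose x k := xget (0 : M) (F k).
pose U k := [set y : M | enorm (y - x k) < 2 * r k].
have QU : [set y : M | forall i j, 0 <= y i j <= 1] `<=` \bigcup_k U k.
  move=> y /QF[k _ Fy]; exists k => //; rewrite /U /=.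
  apply: (@le_lt_trans _ _ (r k)); last by rewrite ltr_pMl// ltr1n.
  rewrite -lee_fin (le_trans _ (Fr k))//; apply: enorm_le_ediam => //.
  by apply: (xgetPex (0 : M)); exists y.
have := cube_compact; rewrite compact_cover.
move=> /(_ _ setT U (fun k _ => @enorm_ball_open (x k) (2 * r k)) QU)[D _ QD].
(* The mesh is so fine that 1 <= r_k L for each of the finitely many balls, which absorbs the
   additive 1 of the count. *)
pose L := (truncn (\sum_(k <- D) (r k)^-1)).+1.
have L0 : 0 < L%:R :> R by [].
have Lr k : k \in D -> 1 <= r k * L%:R.
  move=> kD; rewrite mulrC -ler_pdivrMr// mul1r.
  apply: (@le_trans _ _ (\sum_(k <- D) (r k)^-1)); last exact/ltW/truncnS_gt.
  rewrite (big_rem k)//= lerDl; apply: sumr_ge0 => j _.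
  by rewrite invr_ge0 ltW.
pose S k (ij : 'I_n * 'I_m) :=
  [set a : 'I_L | `|a%:R - L%:R * x k ij.1 ij.2| < 2 * r k * L%:R]%SET.
pose T := {ffun 'I_n * 'I_m -> 'I_L}.
have cT : (#|T|%:R = L%:R ^+ N :> R).
  by rewrite card_ffun card_ord card_prod !card_ord natrX.
have gS (g : T) : exists2 k, k \in D & g \in family (S k).
  have [|k /= kD Ug] := QD (\matrix_(i, j) ((g (i, j))%:R / L%:R)).
    move=> i j; rewrite mxE divr_ge0//= ler_pdivrMr// mul1r ler_nat.
    exact/ltnW.
  exists k => //; apply/familyP => -[i j]; rewrite inE/=.
  have -> : (g (i, j))%:R - L%:R * x k i j = L%:R * ((g (i, j))%:R / L%:R - x k i j).
    by field; rewrite gt_eqF.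
  rewrite normrM gtr0_norm// mulrC ltr_pM2r//.
  have := enorm_coord (\matrix_(i, j) ((g (i, j))%:R / L%:R) - x k) i j.
  by rewrite !mxE => /le_lt_trans; apply.
have cS k : k \in D -> #|family (S k)|%:R <= (5 * r k * L%:R) ^+ N.
  move=> kD; rewrite card_family foldrE big_map big_enum/= natr_prod.
  apply: (@le_trans _ _ (\prod_(ij : 'I_n * 'I_m) (5 * r k * L%:R))).
    apply: ler_prod => ij _; rewrite ler0n/=.
    apply: (le_trans (card_ord_near _ _ _)); first by rewrite !mulr_gt0.
    by have := Lr k kD; lra.
  by rewrite prodr_const card_prod !card_ord.
have : L%:R ^+ N <= \sum_(k <- D) (5 * r k * L%:R) ^+ N.
  rewrite -cT; apply: (@le_trans _ _ (\sum_(k <- D) #|family (S k)|%:R)); last first.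
    by rewrite big_seq [leRHS]big_seq; apply: ler_sum.
  rewrite -natr_sum ler_nat.
  under eq_bigr do rewrite -sum1_card big_mkcond.
  rewrite exchange_big/= -sum1_card; apply: leq_sum => g _.
  have [k kD gk] := gS g.
  by rewrite (big_rem k)//= gk.
apply/negP; rewrite -ltNge.
under eq_bigr do rewrite mulrAC exprMn.
rewrite -mulr_sumr exprMn (mulrC (5 ^+ N)) -mulrA gtr_pMr ?exprn_gt0//.
have re' : \sum_(k <- D) r k ^+ N <= e.
  rewrite -lee_fin (le_trans _ re)// -sumEFin.
  apply: (@lee_sum_fset_lim R (fun k => (r k ^+ N)%:E) D xpredT) => k _.
  by rewrite lee_fin exprn_ge0// ltW.
apply: (@le_lt_trans _ _ (5 ^+ N * e)).
  by rewrite ler_wpM2l// exprn_ge0.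
by rewrite /e invfM mulrCA divff ?mulr1 ?invf_lt1 ?ltr1n// expf_neq0.
Qed.

End hausdorff_positive.

(** * Cones over null sets *)

Section hausdorff_cone.
Context {R : realType} {n m : nat}.
Local Open Scope ereal_scope.
Implicit Types Z : set 'M[R]_(n, m).

(** Over a piece of diameter r, the segment [0, b] is cut into about b / r intervals of length r.
    Each slab has diameter O(r), so the cone over the piece costs O(r^(s+1) / r) = O(r^s), and the
    sum of these is small. *)
Lemma hausdorff0_cone s Z (a b : R) : (0 < s)%N -> (0 < b)%R ->
  hausdorff s Z = 0 -> (forall z, Z z -> enorm z <= a)%R ->
  hausdorff s.+1 [set tz.1 *: tz.2 | tz in `[0%R, b] `*` Z] = 0.
Proof.
move=> s0 b0 Z0 Za; apply/eqP; rewrite eq_le hausdorff_ge0 andbT.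
apply: hausdorff_le => d d0; apply/lee_addgt0Pr => e e0; rewrite add0e.
(* Diameter constant of a slab, from t z - t' z' = t (z - z') + (t - t') z'. The absolute value
   covers an empty [Z] with a negative [a]. *)
pose K : R := (`|a| + b + 1)%R.
have K0 : (0 < K)%R by rewrite /K; have := normr_ge0 a; lra.
pose c : R := ((b + 1) * (unit_ball_volume R s.+1 * (K / 2) ^+ s.+1))%R.
have c0 : (0 < c)%R.
  by rewrite !mulr_gt0// ?unit_ball_volume_gt0// ?exprn_gt0 ?divr_gt0//; lra.
(* Radii at most 1 give N + 1 <= (b + 1) / r_k slabs; radii at most d / K keep the slabs within the
   scale d. *)
have [|F [r [ZF r0 Fr re]]] := hausdorff0_cover s0 Z0 (divr_gt0 e0 c0) (d := minr 1%R (d / K)%R).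
  by rewrite lt_min ltr01 divr_gt0.
pose C k := [set tz.1 *: tz.2 | tz in `[0%R, b] `*` (Z `&` F k)].
have CC : [set tz.1 *: tz.2 | tz in `[0%R, b] `*` Z] `<=` \bigcup_k C k.
  move=> _ [[t z] [/= tb Zz] <-]; have [k _ Fz] := ZF z Zz.
  by exists k => //; exists (t, z).
apply: (le_trans (le_hausdorff_content s.+1 d CC)).
apply: (le_trans (@hausdorff_content_sigma_subadditive R n m s.+1 d d0 C)).
apply: (@le_trans _ _ (\sum_(k <oo) c%:E * ((r k) ^+ s)%:E)); last first.
  rewrite nneseriesZl => [|k _]; last first.
    by rewrite lee_fin exprn_ge0// ltW//; case/andP: (r0 k).
  by rewrite -lee_pdivlMl// -EFinM mulrC.
apply: lee_nneseries => k *; first exact: hausdorff_content_ge0.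
have /andP[rk0] := r0 k; rewrite le_min => /andP[rk1 rkd].
pose N := truncn (b / r k).
pose P (j : 'I_N.+1) := [set tz.1 *: tz.2 | tz in
  [set t | (0 <= t <= b) && (j%:R * r k <= t <= j.+1%:R * r k)]%R `*` (Z `&` F k)].
have CP : C k `<=` \bigcup_(j in [set j | xpredT j]) P j.
  move=> _ [[t z] [/= tb [Zz Fz]] <-].
  move: tb; rewrite in_itv/= => /andP[t0 tb].
  have tr0 : (0 <= t / r k)%R by rewrite divr_ge0// ltW.
  have /truncn_itv/andP[h1 h2] := tr0.
  have tN : (truncn (t / r k) < N.+1)%N.
    rewrite ltnS; apply: le_truncn; rewrite ler_pM2r ?invr_gt0//.
  exists (Ordinal tN) => //; exists (t, z) => //; split=> //=.
  by rewrite t0 tb/= -ler_pdivlMr// h1/= -ler_pdivrMr// ltW.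
have Pd j : ediam (P j) <= (K * r k)%:E.
  apply: ediam_le => X Y [[t z] [/= /andP[/andP[t0 tb] /andP[t1 t2]] [Zz Fz]] <-{X}].
  move=> [[t' z'] [/= /andP[/andP[t'0 t'b] /andP[t'1 t'2]] [Zz' Fz']] <-{Y}].
  rewrite lee_fin (_ : (_ - _ = t *: (z - z') + (t - t') *: z')%R); last first.
    by rewrite scalerBr scalerBl addrA subrK.
  apply: (le_trans (enormD _ _)); rewrite !enormZ (ger0_norm t0).
  have zz : (enorm (z - z') <= r k)%R.
    by rewrite -lee_fin (le_trans _ (Fr k))// enorm_le_ediam.
  have za : (enorm z' <= `|a|)%R by rewrite (le_trans (Za _ Zz'))// ler_norm.
  have tt : (`|t - t'| <= r k)%R.
    by move: t1 t2 t'1 t'2; rewrite -natr1 !mulrDl mul1r ler_norml; lra.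
  have h1 : (t * enorm (z - z') <= b * r k)%R by rewrite ler_pM// enorm_ge0.
  have h2 : (`|t - t'| * enorm z' <= r k * `|a|)%R by rewrite ler_pM// enorm_ge0.
  by rewrite /K; move: h1 h2 rk0; lra.
apply: (le_trans (hausdorff_content_finite_cover _ d0 CP _)) => [j _|].
  by rewrite (le_trans (Pd j))// lee_fin -ler_pdivlMl// mulrC.
apply: (@le_trans _ _ (\sum_(j < N.+1)
   (unit_ball_volume R s.+1 * (K * r k / 2) ^+ s.+1)%:E)).
  apply: lee_sum => j _; apply: hausdorff_gauge_le_pow (Pd j).
  by rewrite mulr_ge0// ltW.
rewrite sumEFin -EFinM lee_fin sumr_const card_ord -[leLHS]mulr_natl.
have Nb : (N.+1%:R <= (b + 1) / r k)%R.
  rewrite -natr1 mulrDl lerD//.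
    by have /truncn_itv/andP[] // : (0 <= b / r k)%R; rewrite divr_ge0// ltW.
  by rewrite mul1r invf_ge1.
apply: (@le_trans _ _ ((b + 1) / r k * (unit_ball_volume R s.+1 * (K * r k / 2) ^+ s.+1))%R).
  rewrite ler_wpM2r// mulr_ge0 ?unit_ball_volume_ge0// exprn_ge0// divr_ge0//.
  by rewrite mulr_ge0 ?ltW.
rewrite le_eqVlt; apply/orP; left; apply/eqP.
by rewrite (mulrAC K) exprMn [(r k ^+ s.+1)%R]exprS /c; field; rewrite gt_eqF.
Qed.

End hausdorff_cone.

(** * Borel sets and Hausdorff measures *)

Section hausdorff_metric.
Context {R : realType} {n m : nat} (s : nat).
Local Notation M := 'M[R]_(n, m).
Local Notation H := (hausdorff s : set M -> \bar R).
Local Open Scope ereal_scope.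
Implicit Types (A B X : set M).

Lemma hausdorffS A B : A `<=` B -> H A <= H B.
Proof. exact: le_hausdorff. Qed.

(** A covering set of diameter at most d < e cannot meet both [A] and [B], so every cover of the
    union splits into a cover of each. *)
Lemma hausdorff_contentU_separated A B (d e : R) : (0 < d < e)%R ->
  (forall x y, A x -> B y -> e <= enorm (x - y))%R ->
  hausdorff_content s d A + hausdorff_content s d B <=
  hausdorff_content s d (A `|` B).
Proof.
move=> /andP[d0 de] AB; apply: le_ereal_inf_tmp => _ [F [Fd ABF] <-].
pose P C k := if pselect (C `&` F k !=set0) then F k else set0.
have Pcontent C : C `<=` A `|` B ->
    hausdorff_content s d C <= \sum_(k <oo) hausdorff_gauge s (P C k).
  move=> CAB; apply: ereal_inf_lbound; exists (P C) => //; split=> [k|x Cx].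
    by rewrite /P; case: pselect => /= _; rewrite ?ediam0 ?leNye// Fd.
  have [k _ Fx] := ABF x (CAB x Cx); exists k => //.
  by rewrite /P; case: pselect => //= -[]; exists x.
apply: (@le_trans _ _ (\sum_(k <oo) hausdorff_gauge s (P A k) +
    \sum_(k <oo) hausdorff_gauge s (P B k))).
  by apply: leeD; apply: Pcontent; [exact: subsetUl|exact: subsetUr].
rewrite -nneseriesD; last 2 first.
- by move=> k _ _; exact: hausdorff_gauge_ge0.
- by move=> k _ _; exact: hausdorff_gauge_ge0.
apply: lee_nneseries => k *.
  by apply: adde_ge0; exact: hausdorff_gauge_ge0.
rewrite /P; case: pselect => /= [[x [Ax Fx]]|_]; last first.
  rewrite hausdorff_gauge0 add0e; case: pselect => //= _.
  by rewrite hausdorff_gauge0 hausdorff_gauge_ge0.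
case: pselect => /= [[y [By Fy]]|_]; last by rewrite hausdorff_gauge0 adde0.
exfalso; have := AB x y Ax By; apply/negP; rewrite -ltNge.
rewrite (le_lt_trans _ de)// -lee_fin (le_trans _ (Fd k))//.
exact: enorm_le_ediam.
Qed.

Lemma hausdorffU_separated A B (e : R) : (0 < e)%R ->
  (forall x y, A x -> B y -> e <= enorm (x - y))%R ->
  H A + H B <= H (A `|` B).
Proof.
move=> e0 AB.
have [->|Hoo] := eqVneq (H (A `|` B)) +oo; first by rewrite leey.
have HUf : H (A `|` B) \is a fin_num.
  by rewrite ge0_fin_numE ?hausdorff_ge0// ltey.
have HBf : H B \is a fin_num.
  by rewrite ge0_fin_numE ?hausdorff_ge0// (le_lt_trans (hausdorffS (@subsetUr _ A B))) ?ltey.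
rewrite -leeBrDr//; apply: hausdorff_le => d1 d10.
have c1f : hausdorff_content s d1 A \is a fin_num.
  rewrite ge0_fin_numE ?hausdorff_content_ge0//.
  apply: (le_lt_trans (hausdorff_content_le_hausdorff _ _ d10)).
  by rewrite (le_lt_trans (hausdorffS (@subsetUl _ A B))) ?ltey.
rewrite leeBrDr// -leeBrDl//; apply: hausdorff_le => d2 d20.
rewrite leeBrDl//.
(* Contents grow as the scale decreases, so both given scales may be replaced by one below the
   separation. *)
pose d := Num.min (e / 2)%R (Num.min d1 d2).
have d0 : (0 < d)%R by rewrite !lt_min divr_gt0// d10.
have mono C d' : (d <= d')%R -> hausdorff_content s d' C <= hausdorff_content s d C.
  move=> dd; apply: ereal_inf_le_tmp => _ [F [Fd CF] <-]; exists F => //; split => // k.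
  by rewrite (le_trans (Fd k))// lee_fin.
apply: (@le_trans _ _ (hausdorff_content s d A + hausdorff_content s d B)).
  by apply: leeD; apply: mono; rewrite !ge_min lexx !orbT.
apply: (@le_trans _ _ (hausdorff_content s d (A `|` B))); last first.
  exact: hausdorff_content_le_hausdorff.
apply: (hausdorff_contentU_separated (e := e)) => //.
rewrite d0/= (@le_lt_trans _ _ (e / 2)%R)//; first by rewrite ge_min lexx.
by rewrite ltr_pdivrMr// ltr_pMr// ltr1n.
Qed.

Section positive_part.
Variable phi : M -> R.
Hypothesis phi1 : forall x y, (`|phi x - phi y| <= enorm (x - y))%R.

Let tau (k : nat) : R := (k.+1%:R^-1)%R.

Let tau_lt k l : (k < l)%N -> (tau l < tau k)%R.
Proof. by move=> kl; rewrite ltf_pV2 ?posrE// ltr_nat. Qed.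

Let separated A B (a b : R) : (a < b)%R -> (forall x, A x -> b <= phi x)%R ->
  (forall x, B x -> phi x <= a)%R -> H A + H B <= H (A `|` B).
Proof.
move=> ab Ab Ba; apply: (@hausdorffU_separated _ _ (b - a)%R).
  by rewrite subr_gt0.
move=> x y Ax By; apply: (le_trans _ (phi1 x y)).
by rewrite (le_trans _ (ler_norm _))// lerB// ?Ab ?Ba.
Qed.

Let shell X k := X `&` [set x | tau k.+1 < phi x <= tau k]%R.

(** Two shells whose indices have the same parity are separated by the shell between them, so their
    measures add up without exceeding that of [X]. *)
Let shell_sum X p K :
  \sum_(0 <= k < K.+1) H (shell X (k.*2 + p)) <=
  H (X `&` [set x | tau (K.*2 + p).+1 < phi x]%R).
Proof.
elim: K => [|K ih].
  rewrite big_nat1; apply: hausdorffS => x [Xx /andP[x1 x2]]; split=> //.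
rewrite big_nat_recr//=; apply: (le_trans (leeD ih (lexx _))).
apply: (le_trans (separated (a := tau (K.+1.*2 + p)) (b := tau (K.*2 + p).+1) _ _ _)).
- by apply: tau_lt; rewrite doubleS !addSn.
- by move=> x [_ /ltW].
- by move=> x [_ /andP[]].
apply: hausdorffS => x [|] [Xx /= x1]; split=> //=; last by case/andP: x1.
by apply: lt_trans x1; apply: tau_lt; rewrite doubleS !addSn ltnS.
Qed.

(** Caratheodory's argument for metric outer measures. The part of [X] where phi exceeds a positive
    threshold is at positive distance from the part where phi <= 0, so the measures of these two
    add. What is left lies in shells with convergent sums of measures, hence has arbitrarily small
    measure. *)
Lemma lipschitz_gt0_caratheodory : (hausdorff s).-caratheodory [set x | 0 < phi x]%R.
Proof.
suff main X : H (X `&` [set x | 0 < phi x]%R) +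
    H (X `&` ~` [set x | 0 < phi x]%R) <= H X.
  by apply: le_caratheodory_measurable; exact: main.
have [->|Hoo] := eqVneq (H X) +oo; first by rewrite leey.
have HX : H X < +oo by rewrite ltey.
have sumoo p : \sum_(0 <= k <oo) H (shell X (k.*2 + p)) < +oo.
  apply: le_lt_trans HX; apply: lime_le.
    by apply: is_cvg_nneseries => k _ _; exact: hausdorff_ge0.
  apply: nearW => -[|K]; first by rewrite big_geq// hausdorff_ge0.
  by apply: (le_trans (shell_sum X p K)); apply: hausdorffS => x [].
have tail p : \sum_(K <= k <oo) H (shell X (k.*2 + p)) @[K --> \oo] --> 0.
  by apply: nneseries_tail_cvg => // k _; exact: hausdorff_ge0.
apply/lee_addgt0Pr => e e0.
have [K Ke] : exists K, forall p, (p < 2)%N ->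
    \sum_(K <= k <oo) H (shell X (k.*2 + p)) <= (e / 2)%:E.
  have nearp p : \forall K \near \oo,
      \sum_(K <= k <oo) H (shell X (k.*2 + p)) <= (e / 2)%:E.
    have /fine_cvgP[tf /cvgrPdist_le/(_ (e / 2)%R)] := tail p.
    rewrite divr_gt0// => /(_ isT) te; near=> K.
    have fK : \sum_(K <= k <oo) H (shell X (k.*2 + p)) \is a fin_num.
      by near: K.
    rewrite -(fineK fK) lee_fin (le_trans (ler_norm _))// -normrN -sub0r.
    by near: K.
  have [K _ HK] := filterI (nearp 0%N) (nearp 1%N).
  have [k0 k1] := HK K (leqnn K).
  exists K => p; rewrite ltnS leq_eqVlt ltnS leqn0 => /orP[] /eqP ->.
    exact: k1.
  exact: k0.
pose A := X `&` [set x | tau K.*2 < phi x]%R.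
have sub : X `&` [set x | 0 < phi x]%R `<=` A `|`
    ((\bigcup_k shell X ((k + K).*2 + 0)) `|` (\bigcup_k shell X ((k + K).*2 + 1))).
  move=> x [Xx /= x0]; have [x1|x1] := ltP (tau K.*2) (phi x); [by left|right].
  (* From 1 / (j + 1) < phi x <= 1 / j the point lies in the shell of index j - 1, as tau_k = 1 / (k
     + 1). *)
  pose j := truncn ((phi x)^-1).
  have xi0 : (0 <= (phi x)^-1)%R by rewrite invr_ge0 ltW.
  have /andP[j1 j2] := truncn_itv xi0; rewrite -/j in j1 j2.
  have j0 : (0 < j)%N.
    rewrite /j truncn_gt0 invf_ge1// (le_trans x1)// /tau invf_le1// ler1n//.
  have sh : shell X j.-1 x.
    split=> //=; rewrite /tau prednK//; apply/andP; split.
      by rewrite -[ltRHS]invrK ltf_pV2 ?posrE ?invr_gt0.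
    by rewrite -[leLHS]invrK lef_pV2 ?posrE ?invr_gt0// ltr0n.
  have Kj : (K.*2 <= j.-1)%N.
    have : (tau K.*2 >= phi x)%R by [].
    rewrite /tau -[leLHS]invrK lef_pV2 ?posrE ?invr_gt0// => /le_lt_trans/(_ j2).
    by rewrite ltr_nat ltnS => h; rewrite -ltnS prednK.
  have jE : (j.-1 = ((j.-1)./2 - K + K).*2 + odd j.-1)%N.
    rewrite subnK; first by rewrite addnC odd_double_half.
    by rewrite geq_half_double.
  rewrite jE in sh; case: (odd j.-1) sh => sh; [right|left].
    by exists (j.-1./2 - K)%N.
  by exists (j.-1./2 - K)%N.
have tails p : (p < 2)%N -> H (\bigcup_k shell X ((k + K).*2 + p)) <= (e / 2)%:E.
  move=> p2; apply: (le_trans (@hausdorff_sigma_subadditive R n m s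
    (fun k => shell X ((k + K).*2 + p)))).
  apply: le_trans (Ke p p2).
  rewrite (@nneseries_addn _ (fun k => H (shell X (k.*2 + p)))) => [|k].
    exact: lexx.
  exact: hausdorff_ge0.
have : H (X `&` [set x | 0 < phi x]%R) <= H A + e%:E.
  apply: (le_trans (hausdorffS sub)).
  apply: (le_trans (outer_measureU2 (hausdorff s : set M -> \bar R) _ _)).
  apply: leeD => //.
  apply: (le_trans (outer_measureU2 (hausdorff s : set M -> \bar R) _ _)).
  by rewrite (splitr e) EFinD; apply: leeD; exact: tails.
move=> /leeD/(_ (lexx (H (X `&` ~` [set x | 0 < phi x]%R)))).
move=> /le_trans; apply; rewrite addeAC; apply: leeD => //.
apply: (le_trans (separated (a := 0%R) (b := tau K.*2) _ _ _)).
- by rewrite invr_gt0.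
- by move=> x [_ /ltW].
- by move=> x [_ /= /negP]; rewrite -leNgt.
by apply: hausdorffS => x [] [].
Unshelve. all: by end_near. Qed.

End positive_part.

Lemma coord_halfspace_caratheodory i j (c : R) :
  (hausdorff s).-caratheodory [set x : M | c < x i j]%R.
Proof.
have := @lipschitz_gt0_caratheodory (fun x => x i j - c)%R.
rewrite (_ : [set x : M | _] = [set x : M | c < x i j]%R); last first.
  by apply/seteqP; split=> x /=; rewrite subr_gt0.
apply=> x y; rewrite opprB addrA subrK.
by have := enorm_coord (x - y) i j; rewrite !mxE.
Qed.

End hausdorff_metric.

Notation borelMx R n m := (g_sigma_algebraType (@open 'M[R]_(n, m))).
Notation hausdorffMx R n m s :=
  (caratheodory_type (hausdorff s : set 'M[R]_(n, m) -> \bar R)).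

Section measurable_matrices.
Context {R : realType} {n m : nat}.
Local Notation M := 'M[R]_(n, m).

Lemma mx_rat_approx (x : M) (e : R) : 0 < e ->
  exists q : 'M[rat]_(n, m), forall i j, `|x i j - ratr (q i j)| < e.
Proof.
move=> e0; have /choice[q qP] : forall ij : 'I_n * 'I_m, exists q : rat,
    `|x ij.1 ij.2 - ratr q| < e.
  move=> [i j] /=; have [|q] := @rat_in_itvoo R (x i j - e) (x i j + e); first by lra.
  by rewrite in_itv/= => /andP[h1 h2]; exists q; rewrite ltr_norml; lra.
by exists (\matrix_(i, j) q (i, j)) => i j; rewrite mxE; exact: (qP (i, j)).
Qed.

(** Every open set is a countable union of boxes with rational centres and radii 1 / (k + 1). Boxes
    not inside [U] are replaced by the empty set, so that the union runs over a whole countable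
    type. *)
Lemma measurable_mx_fun d (T : measurableType d) (D : set T) (f : T -> M) :
  (forall i j, measurable_fun D (fun t => f t i j)) ->
  measurable_fun D (f : T -> borelMx R n m).
Proof.
move=> mf mD; apply: (@measurability _ _ T (borelMx R n m) D f (@open M)) => //.
move=> _ [U oU <-].
pose box (q : 'M[rat]_(n, m) * nat) :=
  [set y : M | forall i j, `|y i j - ratr (q.1 i j)| < q.2.+1%:R^-1].
pose V (q : 'M[rat]_(n, m) * nat) := if `[< box q `<=` U >] then box q else set0.
have UV : U = \bigcup_q V q.
  apply/seteqP; split=> [y Uy|y [q _]]; last first.
    by rewrite /V; case: asboolP => // bU /bU.
  have /nbhs_enormP[e e0 eU] : nbhs y U by apply: open_nbhs_nbhs.
  pose k := truncn (2 * (n * m)%:R / e).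
  have k0 : 0 < k.+1%:R :> R by [].
  have ke : (n * m)%:R * (2 / k.+1%:R) < e.
    rewrite mulrA ltr_pdivrMr// mulrC [ltRHS]mulrC -ltr_pdivrMr//.
    exact: truncnS_gt.
  have [q qP] := @mx_rat_approx y k.+1%:R^-1 (ltac:(by rewrite invr_gt0)).
  exists (q, k) => //; rewrite /V; case: asboolP => [_|[]] //= z zq; apply: eU.
  apply: (le_lt_trans _ ke); apply: enorm_le_bound => [|i j].
    by rewrite divr_ge0.
  rewrite !mxE; have := zq i j; have := qP i j => /=.
  rewrite !ltr_norml ler_norml (_ : 2 / k.+1%:R = k.+1%:R^-1 + k.+1%:R^-1).
    by move: (ratr _) (_^-1) => u v; lra.
  by ring.
rewrite UV preimage_bigcup setI_bigcupr.
apply: countable_bigcupT_measurable; first exact: countableP.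
move=> q; rewrite /V; case: asboolP => _; last by rewrite preimage_set0 setI0.
have -> : D `&` f @^-1` box q = D `&` \bigcap_(ij in [set: 'I_n * 'I_m])
    (D `&` (fun t => f t ij.1 ij.2) @^-1`
     `]ratr (q.1 ij.1 ij.2) - q.2.+1%:R^-1, ratr (q.1 ij.1 ij.2) + q.2.+1%:R^-1[%classic).
  apply/seteqP; split=> [t [Dt ft]|t [Dt ft]]; split=> //=.
    move=> [i j] _ /=; split=> //; rewrite in_itv/=.
    by have := ft i j; rewrite ltr_norml; move: (ratr _) (_^-1) => u v; lra.
  move=> i j; have [_ /=] := ft (i, j) I.
  by rewrite in_itv/= ltr_norml; move: (ratr _) (_^-1) => u v; lra.
apply: measurableI => //; apply: fin_bigcap_measurable => // ij _.
exact: mf.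
Qed.

Lemma measurable_coord i j : measurable_fun setT (fun x : borelMx R n m => (x : M) i j).
Proof.
move=> _; apply: (measurability _ (RGenOInfty.measurableE R)) => //.
move=> /= _ [_ [x ->] <-]; rewrite setTI; apply: sub_sigma_algebra.
by apply: open_comp => [y _|]; [exact: coord_continuous|exact: interval_open].
Qed.

Lemma continuous_mx_measurable (f : M -> R) : continuous f ->
  measurable_fun setT (f : borelMx R n m -> R).
Proof.
move=> cf _; apply: (measurability _ (RGenOInfty.measurableE R)) => //.
move=> /= _ [_ [x ->] <-]; rewrite setTI; apply: sub_sigma_algebra.
by apply: open_comp => [y _|]; [exact: cf|exact: interval_open].
Qed.

Lemma open_mx_measurable (A : set M) : open A -> measurable (A : set (borelMx R n m)).
Proof. by move=> oA; exact: sub_sigma_algebra. Qed.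

Lemma closed_mx_measurable (A : set M) : closed A -> measurable (A : set (borelMx R n m)).
Proof.
move=> cA; rewrite -[A]setCK; apply: measurableC; apply: open_mx_measurable.
exact: closed_openC.
Qed.

(** Borel sets are Caratheodory measurable; in the form of a measurable identity this composes
    directly with Borel functions. *)
Lemma measurable_hausdorffMx s :
  measurable_fun setT (id : hausdorffMx R n m s -> borelMx R n m).
Proof.
apply: measurable_mx_fun => i j _.
apply: (measurability _ (RGenOInfty.measurableE R)) => //.
move=> /= _ [_ [x ->] <-]; rewrite setTI.
rewrite (_ : _ @^-1` _ = [set y : M | x < y i j]); last first.
  by apply/seteqP; split=> y /=; rewrite in_itv/= andbT.
exact: coord_halfspace_caratheodory.
Qed.

Lemma borel_hausdorff_measurable s (A : set M) :
  measurable (A : set (borelMx R n m)) ->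
  measurable (A : set (hausdorffMx R n m s)).
Proof.
by move=> mA; have := @measurable_hausdorffMx s measurableT _ mA; rewrite setTI.
Qed.

Lemma measurable_mx_comp d (T : measurableType d) (D : set T) (f : T -> M)
    d' (T' : measurableType d') (g : M -> T') :
  (forall i j, measurable_fun D (fun t => f t i j)) ->
  measurable_fun setT (g : borelMx R n m -> T') ->
  measurable_fun D (g \o f).
Proof.
by move=> mf mg; apply: measurableT_comp mg (measurable_mx_fun mf).
Qed.

End measurable_matrices.

(** Valid for infinite values too: a positive factor keeps them infinite, and [fine] sends them to
    0. *)
Lemma fine_scale (R : realType) (r : R) (x : \bar R) : 0 < r ->
  fine (r%:E * x)%E = r * fine x.
Proof.
move=> r0; case: x => [x||]//=; rewrite ?mulr0.
  by rewrite gt0_muley ?lte_fin.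
by rewrite gt0_muleNy ?lte_fin.
Qed.

Section hausdorff_change_of_variables.
Context {R : realType} {n m : nat} (s : nat).
Local Notation M := 'M[R]_(n, m).
Local Notation mu := (@hausdorff_measure R n m s).
Variables (L : R) (f g : M -> M).
Hypotheses (L0 : 0 < L) (fg : cancel f g) (gf : cancel g f)
  (fL : forall x y, enorm (f x - f y) = L * enorm (x - y)).

Let invL x y : enorm (g x - g y) = L^-1 * enorm (x - y).
Proof. by rewrite -{2}(gf x) -{2}(gf y) fL mulKf// gt_eqF. Qed.

Let hausdorff_preimage (A : set M) :
  hausdorff s (f @^-1` A) = ((L^-1 ^+ s)%:E * hausdorff s A)%E.
Proof.
have -> : f @^-1` A = g @` A.
  apply/seteqP; split=> [x /= Ax|_ [x Ax <-]]; last by rewrite /= gf.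
  by exists (f x).
by apply: (@hausdorff_similarity _ _ _ _ _ g f); rewrite ?invr_gt0.
Qed.

(** The Caratheodory test of the preimage on [X] is the test of the set on the image of [X], up to
    the factor L^-s. *)
Lemma similarity_measurable :
  measurable_fun setT (f : hausdorffMx R n m s -> hausdorffMx R n m s).
Proof.
move=> _ A mA; rewrite setTI.
have cA : (hausdorff s : set M -> \bar R).-caratheodory A := mA.
suff : (hausdorff s : set M -> \bar R).-caratheodory (f @^-1` A) by [].
move=> X; have E (Y : set M) : hausdorff s Y = ((L^-1 ^+ s)%:E * hausdorff s (f @` Y))%E.
  rewrite -hausdorff_preimage; congr hausdorff.
  apply/seteqP; split=> [y Yy|y [x Yx /(can_inj fg) <-]//]; first by exists y.
have imI (B : set M) : f @` X `&` B = f @` (X `&` f @^-1` B).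
  apply/seteqP; split=> [_ [[x Xx <-] Bx]|_ [x [Xx Bx] <-]]; first by exists x.
  by split=> //; exists x.
rewrite (E X) (E (X `&` _)) (E (X `&` ~` _)) (cA (f @` X)) !imI muleDr//.
by apply: ge0_adde_def; rewrite inE; exact: hausdorff_ge0.
Qed.

Lemma hausdorff_integral_similarity (D : set M) (phi : M -> R) :
  measurable (D : set (hausdorffMx R n m s)) ->
  measurable_fun (D : set (hausdorffMx R n m s)) phi ->
  (forall x, D x -> 0 <= phi x) ->
  hausdorff_integral s D phi =
  L ^+ s * hausdorff_integral s (f @^-1` D) (phi \o f).
Proof.
move=> mD mphi phi0; rewrite /hausdorff_integral /Rintegral.
have Ls : 0 <= L ^+ s by rewrite exprn_ge0// ltW.
pose mL := mscale (NngNum Ls) mu.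
have mf := similarity_measurable.
pose fH : hausdorffMx R n m s -> hausdorffMx R n m s := f.
(* The measure equals L^s times its pushforward under [f], since taking preimages multiplies
   measures by L^-s. *)
transitivity (fine (\int[pushforward mL fH]_(x in D) (phi x)%:E)).
  congr fine; apply: eq_measure_integral => A mA _.
  change (hausdorff s A = ((L ^+ s)%:E * hausdorff s (f @^-1` A))%E).
  rewrite hausdorff_preimage.
  by rewrite muleA -EFinM -exprMn divff ?gt_eqF// expr1n mul1e.
have mphiE : measurable_fun (D : set (hausdorffMx R n m s)) (EFin \o phi).
  exact/measurable_EFinP.
have phiE0 : {in D, forall x, (0 <= (EFin \o phi) x)%E}.
  by move=> x /set_mem Dx; rewrite lee_fin phi0.
have mfD : measurable (f @^-1` D : set (hausdorffMx R n m s)).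
  by rewrite -[X in measurable X]setTI; exact: mf.
have mphif : measurable_fun (f @^-1` D : set (hausdorffMx R n m s)) (EFin \o (phi \o f)).
  apply/measurable_EFinP; apply: (measurable_comp mD) mphi _.
    by move=> _ [x Dx <-].
  by apply: measurable_funTS.
have phif0 x : (f @^-1` D) x -> (0 <= (EFin \o (phi \o f)) x)%E.
  by move=> Dx; rewrite lee_fin phi0.
rewrite (ge0_integral_pushforward (phi := fH) mf mL mD mphiE phiE0).
rewrite (ge0_integral_mscale mu mfD (NngNum Ls) mphif phif0).
by rewrite fine_scale// exprn_gt0.
Qed.

End hausdorff_change_of_variables.

(** * Lipschitz functions of one variable *)

Section lipschitz_real.
Context {R : realType}.
Local Notation mu := (@lebesgue_measure R).

Lemma lebesgue_stieltjes_measure_itvoc (f : cumulative R R) (a b : R) :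
  a <= b -> lebesgue_stieltjes_measure f `]a, b]%classic = (f b - f a)%:E.
Proof.
move=> ab; rewrite /lebesgue_stieltjes_measure /measure_extension.
rewrite measurable_mu_extE/=; last exact: is_ocitv.
by rewrite wlength_itv_bnd.
Qed.

(** The Stieltjes measures of G and of x - G add up to Lebesgue measure, so the first is absolutely
    continuous. Its Radon-Nikodym density is [h], which Lebesgue differentiation identifies with the
    derivative almost everywhere. *)
Lemma nondecreasing_FTC (G : R -> R) (a b : R) : a < b ->
  {homo G : x y / x <= y} -> {homo (fun x => x - G x) : x y / x <= y} ->
  exists h : R -> R, [/\ mu.-integrable setT (EFin \o h), forall x, 0 <= h x,
    forall x, a <= x <= b -> G x - G a = \int[mu]_(t in `]a, x]) h t &
    {ae mu, forall x, a < x < b -> derivable G x 1 /\ derive1 G x = h x}].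
Proof.
move=> ab Gnd Hnd.
have G1 x y : x <= y -> 0 <= G y - G x <= y - x.
  by move=> xy; have := Gnd _ _ xy; have := Hnd _ _ xy; lra.
have Gdist x y : `|G x - G y| <= `|x - y|.
  have [xy|/ltW xy] := leP x y; have /andP[h1 h2] := G1 _ _ xy.
    by rewrite distrC ger0_norm// distrC ger0_norm// subr_ge0.
  by rewrite ger0_norm// ger0_norm// subr_ge0.
have Gc : continuous G.
  move=> x; apply/(@cvgrPdist_lt R R^o _ (nbhs x) (nbhs_filter x)) => e e0.
  near=> y; apply: (le_lt_trans (Gdist _ _)).
  near: y; apply/nbhs_ballP; exists e => //=.
have Hc : continuous (fun x => x - G x).
  by move=> x; apply: (@cvgB _ R^o); [exact: cvg_id|exact: Gc].
pose Gm := isCumulative.Build R _ R G Gnd (right_continuousW Gc).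
pose Gcum : cumulative R R := HB.pack G Gm.
pose Hm := isCumulative.Build R _ R (fun x => x - G x) Hnd (right_continuousW Hc).
pose Hcum : cumulative R R := HB.pack (fun x => x - G x) Hm.
pose nu := lebesgue_stieltjes_measure Gcum.
pose nu' := lebesgue_stieltjes_measure Hcum.
have nuE x y : x <= y -> nu `]x, y]%classic = (G y - G x)%:E.
  exact: lebesgue_stieltjes_measure_itvoc.
have nu'E x y : x <= y -> nu' `]x, y]%classic = ((y - G y) - (x - G x))%:E.
  exact: lebesgue_stieltjes_measure_itvoc.
have nuD (A : set (measurableTypeR R)) : measurable A -> mu A = (nu A + nu' A)%E.
  move=> mA; rewrite -measure_addE.
  apply: lebesgue_measure_unique => // _ [[x y] _ <-]; change (`](x, y).1, (x, y).2]%classic) with (`]x, y]%classic).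
  have [xy|yx] := leP x y.
    transitivity ((G y - G x)%:E + ((y - G y) - (x - G x))%:E)%E; last first.
      rewrite -(nuE _ _ xy) -(nu'E _ _ xy).
      exact/esym/(measure_addE nu nu').
    rewrite lebesgue_measure_itv/= lte_fin; case: ltP => [xy'|yx].
      by rewrite -EFinB -EFinD; congr EFin; ring.
    by rewrite (_ : y = x) ?subrr ?adde0//; apply/eqP; rewrite eq_le xy yx.
  by rewrite set_itv_ge ?measure0// -leNgt bnd_simp ltW.
have mE : measurable (`]a, b]%classic : set (measurableTypeR R)).
  exact: measurable_itv.
have nuoo : (nu `]a, b]%classic < +oo)%E by rewrite nuE ?ltW// ltry.
(* Restriction to ]a, b] makes the Stieltjes measure finite and its density integrable. *)
pose nuab := mfrestr mE nuoo.
have nuac : nuab `<< mu.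
  apply/null_content_dominatesP => A mA muA0.
  have /eqP : (nu A + nu' A = 0)%E by rewrite -nuD//; exact: muA0.
  rewrite padde_eq0 ?measure_ge0// => /andP[/eqP nuA _].
  apply/eqP; rewrite -measure_le0 -nuA.
  change (nu (A `&` `]a, b]%classic) <= nu A)%E.
  by apply: measureIl.
have [f [f0 ff fi fE]] := radon_nikodym_sigma_finite nuac.
have hE x : (fine (f x))%:E = f x by rewrite fineK.
have hf : EFin \o (fine \o f) = f by apply/funext => x /=.
exists (fine \o f); rewrite hf.
have GE x : a <= x <= b -> G x - G a = \int[mu]_(t in `]a, x]) (fine \o f) t.
  move=> /andP[ax xb]; rewrite /Rintegral.
  under eq_integral do rewrite /= hE.
  rewrite -fE; last exact: measurable_itv.
  change (G x - G a = fine (nu (`]a, x]%classic `&` `]a, b]%classic))).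
  rewrite setIidl ?nuE// => t /=; rewrite !in_itv/= => /andP[-> tx].
  exact: le_trans xb.
split=> //; first by move=> x; rewrite fine_ge0.
have locf : locally_integrable setT (fine \o f).
  by apply: open_integrable_locally => //; [exact: openT|rewrite hf].
have intf y : mu.-integrable [set` Interval (BRight a) (BRight y)] (EFin \o (fine \o f)).
  by rewrite hf; apply: integrableS fi => //; exact: measurable_itv.
have := FTC1 intf locf.
apply: filterS; first exact: (ae_filter_ringOfSetsType mu).
move=> x xd /andP[ax xb].
have [|xd1 xd2] := xd; first by exact: ax.
pose Gi := fun x => \int[mu]_(t in `]a, x]) (fine \o f) t.
have nearx : \forall y \near x, Gi y = G y - G a.
  have : \forall y \near x, y \in `]a, b[ by apply: near_in_itvoo; rewrite in_itv/= ax xb.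
  by apply: filterS => y; rewrite in_itv/= => /andP[ay yb]; rewrite /Gi GE// !ltW.
have : is_derive x 1 (fun y => G y - G a) (fine (f x)).
  apply: (near_eq_is_derive nearx).
  by apply: (DeriveDef xd1); rewrite -derive1E.
move=> Gd.
have : is_derive x 1 ((fun y => G y - G a) + cst (G a)) (fine (f x) + 0).
  exact: is_deriveD.
rewrite addr0 (_ : _ + _ = G); last by apply/funext => y /=; rewrite /= fctE subrK.
by case=> dG dGE; split=> //; rewrite derive1E.
Unshelve. all: by end_near. Qed.

Section lipschitz.
Variables (g : R -> R) (L : R).
Hypotheses (L0 : 0 < L) (gL : forall x y, `|g x - g y| <= L * `|x - y|).

(** Since g / L is 1-Lipschitz, both G and x - G are nondecreasing: this affine change brings any
    Lipschitz function within reach of [nondecreasing_FTC]. *)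
Let G x := (x + g x / L) / 2.

Let gE : g = (fun x => L * (2 * G x - x)).
Proof. by apply/funext => x; rewrite /G; field; rewrite gt_eqF. Qed.

Let gle x y : x <= y -> - (y - x) <= g y / L - g x / L <= y - x.
Proof.
move=> xy; rewrite -mulrBl -ler_norml normrM (gtr0_norm (_ : 0 < L^-1)) ?invr_gt0//.
rewrite ler_pdivrMr// mulrC (le_trans (gL _ _))// ler_pM2l//.
by rewrite ger0_norm// subr_ge0.
Qed.

Let Gnd : {homo G : x y / x <= y}.
Proof. by move=> x y xy; have := gle xy; rewrite /G; lra. Qed.

Let Hnd : {homo (fun x => x - G x) : x y / x <= y}.
Proof. by move=> x y xy; have := gle xy; rewrite /G; lra. Qed.

Let is_derive_g x : derivable G x 1 ->
  derivable g x 1 /\ derive1 g x = L * (2 * derive1 G x - 1).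
Proof.
move=> Gx; have dG : is_derive x 1 G ('D_1 G x) by exact: derivableP.
have : is_derive x 1 (L \*: (2 \*: G - id)) (L *: (2 *: 'D_1 G x - 1)).
  by apply: is_deriveZ; apply: is_deriveB.
rewrite (_ : _ \*: _ = g); last by rewrite [in RHS]gE.
by case=> h1 h2; split=> //; rewrite !derive1E h2.
Qed.

Lemma lipschitz_ae_derivable : {ae mu, forall x, derivable g x 1}.
Proof.
have ae_k (k : nat) : {ae mu, forall x, - k.+1%:R < x < k.+1%:R -> derivable g x 1}.
  have kk : - k.+1%:R < k.+1%:R :> R by rewrite gtrN.
  have [h [_ _ _]] := nondecreasing_FTC kk Gnd Hnd.
  apply: filterS; first exact: (ae_filter_ringOfSetsType mu).
  by move=> x xk /xk[/is_derive_g[]].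
apply: (@filterS _ _ (ae_filter_ringOfSetsType mu) _ _ _ (ae_foralln ae_k)).
move=> x xk; apply: (xk (truncn `|x|)).
by rewrite -ltr_norml truncnS_gt.
Qed.

(** In terms of G, g' <= 0 reads G' <= 1/2; integrating the density gives G b - G a <= (b - a) / 2,
    which is g b <= g a. *)
Lemma lipschitz_derive_le0 (a b : R) : a < b ->
  {ae mu, forall x, derivable g x 1 -> derive1 g x <= 0} -> g b <= g a.
Proof.
move=> ab gle0.
(* The interval is extended beyond [b], because the density is identified with the derivative only
   in the open interval. *)
have ab1 : a < b + 1 by rewrite (lt_trans ab)// ltrDl.
have [h [hi h0 hE hae]] := nondecreasing_FTC ab1 Gnd Hnd.
have mab : measurable (`]a, b]%classic : set (measurableTypeR R)).
  exact: measurable_itv.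
suff : G b - G a <= (b - a) / 2.
  rewrite /G => H; have : (g b - g a) / L <= 0 by rewrite mulrBl; lra.
  by rewrite pmulr_lle0 ?invr_gt0// subr_le0.
rewrite (hE b); last by rewrite ltW//= lerDl.
have hab : mu.-integrable `]a, b] (EFin \o h) by exact: integrableS hi.
rewrite -lee_fin /Rintegral fineK; last exact: integrable_fin_num.
have -> : ((b - a) / 2)%:E = (\int[mu]_(x in `]a, b]) (cst (2^-1)%:E) x)%E.
  rewrite integral_cst//= lebesgue_measure_itv/= lte_fin ab.
  by rewrite -EFinB -EFinM mulrC.
apply: ae_ge0_le_integral => //.
- by move=> x _; rewrite lee_fin.
- by case/integrableP : hab.
- by move=> x _; rewrite lee_fin invr_ge0.
- apply: filterS2 hae gle0; first exact: (ae_filter_ringOfSetsType mu).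
  move=> x xd gx /=; rewrite in_itv/= => /andP[ax xb].
  have [|dG <-] := xd; first by rewrite ax (le_lt_trans xb)// ltrDl.
  have [dg dgE] := is_derive_g dG.
  have := gx dg; rewrite dgE pmulr_rle0// lee_fin => H.
  by have : 2 * derive1 G x <= 1 by [lra]; rewrite mulrC -ler_pdivlMr// div1r.
Qed.

End lipschitz.

End lipschitz_real.

(** * Null sets and lines *)

Section hausdorff_top.
Context {R : realType} {n m : nat}.
Local Notation M := 'M[R]_(n, m).
Local Notation N := (n * m)%N.
Local Notation T := (hausdorffMx R n m N).
Local Notation lambda := (@lebesgue_measure R).
Local Open Scope ereal_scope.

Lemma hausdorff_top_sigma_finite :
  sigma_finite setT (@hausdorff_measure R n m N).
Proof.
exists (fun k => [set y : M | forall i j, (`|y i j| <= k%:R)%R]).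
  apply/esym/seteqP; split=> // y _; exists (truncn `|y|).+1 => // i j.
  by rewrite (le_trans (coord_le_mx_norm _ _ _))// ltW// truncnS_gt.
move=> k; split.
  apply: borel_hausdorff_measurable; apply: closed_mx_measurable.
  rewrite (_ : [set y | _] = \bigcap_(ij in [set: 'I_n * 'I_m])
     ((fun y : M => y ij.1 ij.2) @^-1` `[- k%:R, k%:R]%classic)%R).
    apply: closed_bigI => ij _; apply: closed_comp => [y _|].
      exact: coord_continuous.
    exact: itv_closed.
  apply/seteqP; split=> [y yk ij _|y yk i j] /=.
    by rewrite in_itv/= -ler_norml.
  by have := yk (i, j) I; rewrite /= in_itv/= -ler_norml.
pose I := [set: 'I_n * 'I_m]%SET.
have cI : #|I| = N by rewrite cardsT card_prod !card_ord.
have := @hausdorff_face_lty R n m I 0; rewrite cI.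
set A := [set y | _ ] => Aoo.
(* The box lies in the unit box dilated by k + 1; the factor k would vanish for k = 0. *)
have k0 : (0 < k%:R + 1 :> R)%R by rewrite ltr_wpDl.
rewrite /hausdorff_measure; apply: (@le_lt_trans _ _
  (hausdorff N [set ((k%:R + 1) *: y)%R | y in A])).
  apply: hausdorffS => y yk; exists ((k%:R + 1)^-1 *: y)%R; last first.
    by rewrite scalerA mulfV ?gt_eqF// scale1r.
  split=> i j; last by rewrite !inE.
  move=> _; rewrite mxE normrM gtr0_norm ?invr_gt0// mulrC ler_pdivrMr// mul1r.
  by rewrite (le_trans (yk i j))// lerDl.
apply: (@le_lt_trans _ _ (((k%:R + 1) ^+ N)%:E * hausdorff N A)).
  apply: hausdorff_image => // x y _ _.
  by rewrite -scalerBr enormZ gtr0_norm.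
by rewrite lte_mul_pinfty// lee_fin exprn_ge0// ltW.
Qed.

Lemma hausdorffT_gt0 : (0 < N)%N -> 0 < hausdorff N [set: M].
Proof.
by move=> N0; apply: (lt_le_trans (hausdorff_cube_gt0 N0)); exact: hausdorffS.
Qed.

Lemma hausdorff_translate s (v : M) (E : set M) :
  hausdorff s [set x | E (x + v)%R] = hausdorff s E.
Proof.
have -> : [set x | E (x + v)%R] = (fun x => (x - v)%R) @` E.
  apply/seteqP; split=> [x /= Ex|_ [x Ex <-] /=]; last by rewrite subrK.
  by exists (x + v)%R; rewrite ?addrK.
rewrite (@hausdorff_similarity _ _ _ _ 1%R _ (fun x => (x + v)%R)) ?expr1n ?mul1e//.
- by move=> x; rewrite subrK.
- by move=> x; rewrite addrK.
- by move=> x y; rewrite mul1r opprB addrA subrK.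
Qed.

Let lines (v : M) (E : set M) : set (T * measurableTypeR R) :=
  [set xt | E (xt.1 + xt.2 *: v)%R].

Let lines_measurable v (E : set M) :
  measurable (E : set (borelMx R n m)) -> measurable (lines v E).
Proof.
move=> mE; pose f (xt : T * measurableTypeR R) : M := (xt.1 + xt.2 *: v)%R.
have mf : measurable_fun setT (f : _ -> borelMx R n m).
  apply: measurable_mx_fun => i j.
  rewrite (_ : (fun _ => _) = (fun xt : T * measurableTypeR R => (xt.1 : M) i j + xt.2 * v i j)%R); last first.
    by apply/funext => xt; rewrite /f !mxE.
  apply: measurable_funD.
    apply: (measurableT_comp (measurable_coord i j)).
    apply: (measurableT_comp (@measurable_hausdorffMx R n m N)).
    exact: measurable_fst.
  by apply: measurable_funM; [exact: measurable_snd|exact: measurable_cst].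
by have := mf measurableT _ mE; rewrite setTI.
Qed.

(* Tonelli for (x, t) |-> x + t v: translation invariance is used instead of
   a product decomposition of the top-dimensional Hausdorff measure. *)
Let line_tonelli v (E : set M) : measurable (E : set (borelMx R n m)) ->
  \int[@hausdorff_measure R n m N]_x lambda [set t | E (x + t *: v)%R] =
  \int[lambda]_t hausdorff N E.
Proof.
move=> mE; have mL := lines_measurable v mE.
pose Hs := Measure_isSigmaFinite.Build _ _ _ (@hausdorff_measure R n m N)
  hausdorff_top_sigma_finite.
pose mu : {sigma_finite_measure set T -> \bar R} :=
  HB.pack (@hausdorff_measure R n m N) Hs.
have := @indic_fubini_tonelli _ _ T (measurableTypeR R) R mu lambda _ mL.
rewrite (indic_fubini_tonelli_FE lambda mL) (indic_fubini_tonelli_GE mu mL).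
have E1 x : xsection (lines v E) x = [set t | E (x + t *: v)%R].
  by apply/seteqP; split=> t /=; rewrite xsectionP.
have E2 t : hausdorff N (ysection (lines v E) t) = hausdorff N E.
  rewrite -[RHS](hausdorff_translate _ (t *: v)%R); congr hausdorff.
  by apply/seteqP; split=> x /=; rewrite ysectionP.
move=> H; transitivity (\int[mu]_x lambda (xsection (lines v E) x)).
  by apply: eq_integral => x _; rewrite E1.
rewrite [LHS]H; apply: eq_integral => t _ /=; exact: E2.
Qed.

(** By Tonelli the measure of [E] times the infinite length of a line is 0. *)
Lemma null_lines v (E : set M) : measurable (E : set (borelMx R n m)) ->
  (forall x, lambda [set t | E (x + t *: v)%R] = 0) -> hausdorff N E = 0.
Proof.
move=> mE E0; have := line_tonelli v mE.
rewrite integral0_eq => [|x _]; last exact: E0.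
rewrite integral_cst//=.
move=> /esym/eqP; rewrite mule_eq0 => /orP[/eqP//|].
suff : lambda setT != 0 by move=> /negbTE ->.
have <- : `]-oo, +oo[%classic = [set: R] by rewrite set_itvNyy.
by rewrite lebesgue_measure_itv/=.
Qed.

(** The lengths of the sections integrate to 0, so they vanish for almost every x; as the whole
    space is not null, such an x exists. *)
Lemma null_exists_line v (E : set M) : (0 < N)%N -> measurable (E : set (borelMx R n m)) ->
  hausdorff N E = 0 -> exists x, lambda [set t | E (x + t *: v)%R] = 0.
Proof.
move=> N0 mE E0; apply: contrapT => /forallNP no.
have := line_tonelli v mE; rewrite E0 integral0.
set g := (fun x => lambda _) => g0.
have mg : measurable_fun setT (g : T -> \bar R).
  rewrite (_ : g = lambda \o xsection (lines v E)).
    by apply: measurable_fun_xsection; exact: lines_measurable.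
  by apply/funext => x /=; congr lambda; apply/seteqP; split=> t /=; rewrite xsectionP.
have [+ _] := @ae_eq_integral_abs _ T R (@hausdorff_measure R n m N) setT measurableT g mg.
case=> [|A [_ A0 gA]].
  by under eq_integral do rewrite gee0_abs//.
have := hausdorffT_gt0 N0; rewrite lt_neqAle => /andP[/eqP + _]; apply.
apply/esym/eqP; rewrite eq_le hausdorff_ge0 andbT -A0; apply: hausdorffS.
by move=> x _; apply: gA => /(_ I); exact: no.
Qed.

End hausdorff_top.

(** * Rademacher's theorem *)

Section porous.
Context {R : realType}.
Local Notation lambda := (@lebesgue_measure R).

(* A porous set has no density point. *)
Lemma porous_null (S : set R) (c : R) : measurable S -> 0 < c <= 1 ->
  (forall t, S t -> forall d, 0 < d -> exists r u, [/\ 0 < r < d,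
     ball u (c * r) `<=` ball t r & ball u (c * r) `&` S = set0]) ->
  lambda S = 0%E.
Proof.
move=> mS /andP[c0 c1] porous.
have [A [mA A0 SA]] := lebesgue_density mS.
suff SA' : S `<=` A.
  have A0' : lambda A = 0%E := A0.
  have SleA : (lambda S <= lambda A)%E by apply: le_measure; [exact: mem_set|exact: mem_set|].
  by apply/eqP; rewrite eq_le measure_ge0 andbT (le_trans SleA)// A0'.
move=> t St; apply: SA => /= dens.
(* A hole of relative size c bounds the density of [S] in the ball by 1 - c, against the density 1
   of almost every point. *)
have : \forall r \near 0^'+, ((1 - c)%:E <
    lambda (S `&` ball t r) * (lambda (ball t r))^-1)%E.
  apply: (dens [set y | ((1 - c)%:E < y)%E]); rewrite indicE mem_set//=.
  apply: open_nbhs_nbhs; split; first exact: open_ereal_gt_ereal.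
  by rewrite /= lte_fin gtrBl.
case=> d /= d0 dP.
have [r [u [/andP[r0 rd] ut uS]]] := porous t St d d0.
have := dP r; rewrite /ball_ /= sub0r normrN gtr0_norm// => /(_ rd r0).
apply/negP; rewrite -leNgt.
have mtr := lebesgue_measure_ball t (ltW r0).
have mur := lebesgue_measure_ball u (ltW (mulr_gt0 c0 r0)).
rewrite [lambda (ball t r)]mtr inver mulrn_eq0/= gt_eqF//.
rewrite lee_pdivrMr ?mulrn_wgt0// -EFinM.
have mB : measurable (ball t r) by exact: measurable_ball.
have mB' : measurable (ball u (c * r)) by exact: measurable_ball.
have : (lambda (S `&` ball t r) + lambda (ball u (c * r)%R) <= lambda (ball t r))%E.
  rewrite -measureU//; last 2 first.
  - exact: measurableI.
  - rewrite (_ : _ `&` _ = (ball u (c * r) `&` S) `&` ball t r).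
      by rewrite uS set0I.
    by apply/seteqP; split=> z /=; tauto.
  apply: le_measure; last by move=> z [[]|/ut].
    by apply/mem_set/measurableU => //; exact: measurableI.
  exact: mem_set.
rewrite [lambda (ball t r)]mtr [lambda (ball u _)]mur => H.
rewrite -(@leeD2rE _ ((c * r) *+ 2)%:E)// (le_trans H)// -EFinD lee_fin.
by rewrite le_eqVlt; apply/orP; left; apply/eqP; ring.
Qed.

Lemma derivable_approx (g : R -> R) t : derivable g t 1 ->
  forall e, 0 < e -> exists2 d, 0 < d & forall s, `|s| < d ->
    `|g (t + s) - g t - s * derive1 g t| <= e * `|s|.
Proof.
move=> dg e e0.
have : (fun h => h^-1 *: (g (h *: 1 + t) - g t)) @ 0^' --> derive1 g t.
  by rewrite derive1E; exact: dg.
move=> /cvgrPdist_le/(_ e e0)[d /= d0 dP].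
exists d => // s sd.
have [->|s0] := eqVneq s 0.
  by rewrite addr0 subrr mul0r subr0 normr0 mulr0.
have := dP s; rewrite /ball_ /= sub0r normrN => /(_ sd s0).
rewrite [s%:A]mulr1 (addrC s).
have -> : g (t + s) - g t - s * derive1 g t =
   - s * (derive1 g t - s^-1 *: (g (t + s) - g t)).
  by rewrite /GRing.scale/=; field.
by rewrite normrM normrN mulrC ler_pM2r// normr_gt0.
Qed.

End porous.

Section hausdorff_null.
Context {R : realType} {n m : nat} (s : nat).
Local Notation M := 'M[R]_(n, m).
Local Open Scope ereal_scope.

Lemma hausdorff0S (A B : set M) : A `<=` B -> hausdorff s B = 0 -> hausdorff s A = 0.
Proof.
by move=> AB B0; apply/eqP; rewrite eq_le hausdorff_ge0 andbT -B0 hausdorffS.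
Qed.

Lemma hausdorff0_bigcup (T : countType) (F : T -> set M) :
  (forall i, hausdorff s (F i) = 0) -> hausdorff s (\bigcup_i F i) = 0.
Proof.
move=> F0; pose G (k : nat) := if @choice.unpickle T k is Some i then F i else set0.
apply: (@hausdorff0S _ (\bigcup_k G k)).
  by move=> x [i _ Fx]; exists (choice.pickle i) => //; rewrite /G choice.pickleK.
apply/eqP; rewrite eq_le hausdorff_ge0 andbT.
apply: (le_trans (@hausdorff_sigma_subadditive R n m s G)).
rewrite eseries0// => k _ _; rewrite /G; case: choice.unpickle => [i|]; [exact: F0|exact: hausdorff0].
Qed.

Lemma hausdorff0U (A B : set M) : hausdorff s A = 0 -> hausdorff s B = 0 ->
  hausdorff s (A `|` B) = 0.
Proof.
move=> A0 B0; apply: (@hausdorff0S _ (\bigcup_(b : bool) if b then A else B)).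
  by move=> x [Ax|Bx]; [exists true|exists false].
by apply: hausdorff0_bigcup => -[].
Qed.

End hausdorff_null.

Lemma enorm_lipschitz_continuous {R : realType} {n m : nat}
    (f : 'M[R]_(n, m) -> R) (L : R) : 0 < L ->
  (forall x y, `|f x - f y| <= L * enorm (x - y)) -> continuous f.
Proof.
move=> L0 fL x; apply/(@cvgrPdist_lt R R^o _ (nbhs x) (nbhs_filter x)) => e e0.
apply/nbhs_enormP; exists (e / L); first by rewrite divr_gt0.
move=> y yx; apply: (le_lt_trans (fL _ _)).
by rewrite enormBC mulrC -ltr_pdivlMr.
Qed.

Section rademacher.
Context {R : realType} {n : nat}.
Local Notation M := 'cV[R]_n.
Variables (G : M -> R) (L : R).
Hypotheses (L0 : 0 < L) (GL : forall x y, `|G x - G y| <= L * enorm (x - y)).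
Local Notation lambda := (@lebesgue_measure R).

Definition approx_diff (V : set M) (e : R) (A : M) (d : R) : set M :=
  [set x | forall h, V h -> enorm h < d ->
    `|G (x + h) - G x - mdot A h| <= e * enorm h].

(** Tolerances and scales are restricted to 1 / (k + 1), and the covectors are rational and depend
    on the tolerance: all outer quantifiers are then countable, which makes the set Borel. *)
Definition diff_along (V : set M) : set M :=
  [set x | forall k : nat, exists j : nat, exists A : 'cV[rat]_n,
     approx_diff V k.+1%:R^-1 (map_mx ratr A) j.+1%:R^-1 x].

Lemma approx_diff_closed V e A d : closed (approx_diff V e A d).
Proof.
rewrite (_ : approx_diff V e A d = \bigcap_(h in [set h | V h /\ enorm h < d])
   ((fun x => `|G (x + h) - G x - mdot A h|) @^-1` [set y | y <= e * enorm h])).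
  apply: closed_bigI => h _; apply: closed_comp => [x _|]; last exact: closed_le.
  apply: (@enorm_lipschitz_continuous _ _ _ _ (L + L)); first by rewrite addr_gt0.
  move=> {}x y; apply: (le_trans (ler_dist_dist _ _)).
  rewrite (_ : _ - _ - _ = (G (x + h) - G (y + h)) - (G x - G y)); last by ring.
  rewrite (le_trans (ler_normB _ _))// mulrDl lerD//.
  by have := GL (x + h) (y + h); rewrite opprD addrACA subrr addr0.
apply/seteqP; split=> [x xd h [Vh hd]|x xd h Vh hd]; first exact: xd.
exact: (xd h).
Qed.

Lemma diff_along_measurable V : measurable (diff_along V : set (borelMx R n 1)).
Proof.
rewrite (_ : diff_along V = \bigcap_k \bigcup_j \bigcup_(A : 'cV[rat]_n)
  approx_diff V k.+1%:R^-1 (map_mx ratr A) j.+1%:R^-1).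
  apply: bigcapT_measurable => k; apply: bigcupT_measurable => j.
  apply: countable_bigcupT_measurable; first exact: countableP.
  by move=> A; apply: closed_mx_measurable; exact: approx_diff_closed.
apply/seteqP; split=> [x xd k _|x xd k].
  by have [j [A ?]] := xd k; exists j => //; exists A.
by have [j _ [A _ ?]] := xd k I; exists j, A.
Qed.

Lemma approx_diffS V e A d d' x : d' <= d -> approx_diff V e A d x ->
  approx_diff V e A d' x.
Proof. by move=> dd xd h Vh hd; apply: xd => //; exact: lt_le_trans dd. Qed.

Lemma diff_alongP V x :
  (forall e, 0 < e -> exists d A, 0 < d /\ approx_diff V e A d x) ->
  diff_along V x.
Proof.
(* One half of the tolerance pays for the remainder, the other for replacing [A] by a rational
   covector. *)
move=> xd k; pose e : R := k.+1%:R^-1 / 2.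
have e0 : 0 < e by rewrite divr_gt0// invr_gt0.
have [d [A [d0 dA]]] := xd e e0.
have [B AB] : exists B : 'cV[rat]_n, enorm (A - map_mx ratr B) <= e.
  have e0' : 0 < e / ((n * 1)%:R + 1) by rewrite divr_gt0// ltr_wpDl.
  have [B AB] := mx_rat_approx A e0'; exists B.
  apply: (le_trans (@enorm_le_bound _ _ _ _ (e / ((n * 1)%:R + 1)) (ltW e0') _)).
    by move=> i j; rewrite !mxE ltW.
  by rewrite mulrCA ger_pMr// ler_pdivrMr ?ltr_wpDl// mul1r lerDl.
exists (truncn d^-1), B => h Vh hd.
have hd' : enorm h < d.
  by rewrite (lt_le_trans hd)// -[leRHS]invrK lef_pV2 ?posrE ?invr_gt0// ltW// truncnS_gt.
have -> : G (x + h) - G x - mdot (map_mx ratr B) h =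
    (G (x + h) - G x - mdot A h) + mdot (A - map_mx ratr B) h.
  by rewrite mdotDl mdotNl; ring.
apply: (le_trans (ler_normD _ _)).
have -> : k.+1%:R^-1 = e + e :> R by rewrite /e -splitr.
rewrite mulrDl lerD//; first exact: dA.
by rewrite (le_trans (normr_mdot_le _ _))// ler_wpM2r// enorm_ge0.
Qed.

End rademacher.

Section lines.
Context {R : realType} {n m : nat}.
Local Notation lambda := (@lebesgue_measure R).

Lemma line_measurable (x v : 'M[R]_(n, m)) (E : set 'M[R]_(n, m)) :
  measurable (E : set (borelMx R n m)) ->
  measurable ([set t | E (x + t *: v)] : set (measurableTypeR R)).
Proof.
move=> mE.
have mf : measurable_fun setT
    ((fun t : measurableTypeR R => x + t *: v) : _ -> borelMx R n m).
  apply: measurable_mx_fun => i j.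
  rewrite (_ : (fun _ => _) = (fun t : measurableTypeR R => x i j + t * v i j)).
    by apply: measurable_funD => //; apply: measurable_funM.
  by apply/funext => t; rewrite !mxE.
by have := mf measurableT _ mE; rewrite setTI.
Qed.

Lemma ae_null (P : R -> Prop) (S : set (measurableTypeR R)) : measurable S ->
  {ae lambda, forall t, P t} -> (forall t, S t -> ~ P t) -> lambda S = 0%E.
Proof.
move=> mS [A [mA A0 PA]] SP.
have A0' : lambda A = 0%E := A0.
have SleA : (lambda S <= lambda A)%E.
  by apply: le_measure; [exact: mem_set|exact: mem_set|move=> t /SP; exact: PA].
by apply/eqP; rewrite eq_le measure_ge0 andbT (le_trans SleA)// A0'.
Qed.

Lemma null_ae (P : R -> Prop) (S : set (measurableTypeR R)) : measurable S ->
  lambda S = 0%E -> (forall t, ~ S t -> P t) -> {ae lambda, forall t, P t}.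
Proof.
move=> mS S0 SP; exists S; split => // t /= nP; apply: contrapT => /SP; exact: nP.
Qed.

End lines.

Lemma mdot_delta {R : realType} {n m : nat} (A : 'M[R]_(n, m)) i j :
  mdot A (delta_mx i j) = A i j.
Proof.
rewrite mdotE (bigD1 i)//= (bigD1 j)//= !mxE !eqxx mulr1 !big1 ?addr0//.
  move=> k ki; rewrite big1// => l _.
  by rewrite mxE (negbTE ki) mulr0.
by move=> l lj; rewrite mxE (negbTE lj) andbF mulr0.
Qed.

Lemma enorm_delta {R : realType} {n m : nat} i j :
  enorm (delta_mx i j : 'M[R]_(n, m)) = 1.
Proof. by rewrite /enorm mdot_delta mxE !eqxx sqrtr1. Qed.

Section rademacher.
Context {R : realType} {n : nat}.
Local Notation M := 'cV[R]_n.
Variables (G : M -> R) (L : R).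
Hypotheses (L0 : 0 < L) (GL : forall x y, `|G x - G y| <= L * enorm (x - y)).
Local Notation lambda := (@lebesgue_measure R).
Local Notation N := (n * 1)%N.

Definition coord_space (I : {set 'I_n}) : set M :=
  [set h | forall l, l \notin I -> h l 0 = 0].

Lemma line_lipschitz (x v : M) (t t' : R) :
  `|G (x + t *: v) - G (x + t' *: v)| <= L * (enorm v + 1) * `|t - t'|.
Proof.
apply: (le_trans (GL _ _)); rewrite opprD addrACA subrr add0r -scalerBl enormZ.
by rewrite -mulrA ler_pM2l// mulrC ler_wpM2r// lerDl.
Qed.

Let Lv (v : M) : 0 < L * (enorm v + 1).
Proof. by rewrite mulr_gt0// ltr_wpDl// enorm_ge0. Qed.

(** On each line in direction i the function is Lipschitz in one variable, hence differentiable
    almost everywhere, and [null_lines] applies. *)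
Lemma null_diff_along_coord i :
  hausdorff N (~` diff_along G (coord_space [set i])) = 0%E.
Proof.
have mD := measurableC (diff_along_measurable L0 GL (coord_space [set i])).
apply: (null_lines (v := delta_mx i 0)) => // x.
have [v ev] : {v : M | v = delta_mx i 0} by exists (delta_mx i 0).
rewrite -ev; pose g t := G (x + t *: v).
apply: (ae_null _ (lipschitz_ae_derivable (Lv v) (line_lipschitz x v))).
  exact: line_measurable.
move=> t + dg; apply; apply: diff_alongP => e e0.
have [d d0 dP] := derivable_approx dg e0.
exists d, (derive1 (fun t => G (x + t *: v)) t *: v); split=> // h Vh hd.
have hE : h = h i 0 *: v.
  apply/colP => l; rewrite ev !mxE eqxx andbT.
  by have [->|li] := eqVneq l i; rewrite ?mulr1// mulr0 Vh// !inE.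
have hh : enorm h = `|h i 0| by rewrite hE enormZ ev enorm_delta mulr1 -ev -hE.
have -> : mdot (derive1 (fun t => G (x + t *: v)) t *: v) h =
    h i 0 * derive1 (fun t => G (x + t *: v)) t.
  by rewrite mdotZl ev mdotC mdot_delta mulrC.
have := dP (h i 0); rewrite -hh => /(_ hd).
by rewrite scalerDl addrA -hE.
Qed.

(** Points with good approximations along I and along e_i separately, but where the glued covector
    [C] fails along both together at every scale. The factor 8 leaves room for the triangle
    inequalities of [bad_hole]. *)
Let bad (I : {set 'I_n}) (i : 'I_n) (k j : nat) (A B : 'cV[rat]_n) : set M :=
  let C : 'cV[rat]_n := \col_l (if l == i then B i 0 else A l 0) in
  (approx_diff G (coord_space I) (8 * k.+1)%:R^-1 (map_mx ratr A) j.+1%:R^-1 `&`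
   approx_diff G (coord_space [set i]) (8 * k.+1)%:R^-1 (map_mx ratr B) j.+1%:R^-1) `&`
  ~` (\bigcup_l approx_diff G (coord_space (i |: I)) k.+1%:R^-1 (map_mx ratr C) l.+1%:R^-1).

Let bad_measurable I i k j A B : measurable (bad I i k j A B : set (borelMx R n 1)).
Proof.
apply: measurableI; first by apply: measurableI; apply: closed_mx_measurable;
  exact: (approx_diff_closed L0 GL).
apply: measurableC; apply: bigcupT_measurable => l; apply: closed_mx_measurable.
exact: (approx_diff_closed L0 GL).
Qed.

(** The contrapositive is what matters. If [h] witnesses the failure at x, then no x + s e_i with s
    close to h_i is good for the same A: going to x + s e_i with B, then along the rest of h with A,
    would give the excluded estimate. Failure opens a hole of size proportional to |h|. *)
Let bad_hole (I : {set 'I_n}) (i : 'I_n) (k j : nat) (A B : 'cV[rat]_n) (x h : M) (s : R) : i \notin I ->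
  (approx_diff G (coord_space I) (8 * k.+1)%:R^-1 (map_mx ratr A) j.+1%:R^-1 `&`
   approx_diff G (coord_space [set i]) (8 * k.+1)%:R^-1 (map_mx ratr B) j.+1%:R^-1) x ->
  approx_diff G (coord_space I) (8 * k.+1)%:R^-1 (map_mx ratr A) j.+1%:R^-1 (x + s *: delta_mx i 0) ->
  coord_space (i |: I) h ->
  enorm h + enorm h < j.+1%:R^-1 ->
  `|s - h i 0| <= (2 * k.+1%:R)^-1 / (L + `|ratr (B i 0) : R| + 1) * enorm h ->
  `|G (x + h) - G x - mdot (map_mx ratr (\col_l (if l == i then B i 0 else A l 0))) h| <=
    k.+1%:R^-1 * enorm h.
Proof.
move=> iI [xA xB] yA Vh hj sh.
have [d dE] : {d : M | d = delta_mx i 0} by exists (delta_mx i 0).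
rewrite -dE in yA.
have d1 : enorm d = 1 by rewrite dE enorm_delta.
pose v := h - h i 0 *: d.
pose b : R := ratr (B i 0).
have k0 : 0 < k.+1%:R :> R by [].
have Lb0 : 0 < L + `|b| + 1 by rewrite ltr_wpDl// addr_ge0// ltW.
have sh' : `|s - h i 0| * (L + `|b| + 1) <= (2 * k.+1%:R)^-1 * enorm h.
  by move: sh; rewrite mulrAC ler_pdivlMr.
have k2 : (2 * k.+1%:R)^-1 <= 1 :> R.
  by rewrite invf_le1 ?mulr_gt0// -natrM ler1n.
have h0 := enorm_ge0 h.
have hi := enorm_coord h i 0.
have sh1 : `|s| <= enorm h + enorm h.
  have : `|s| <= `|s - h i 0| + `|h i 0| by rewrite -{1}(subrK (h i 0) s) ler_normD.
  move=> /le_trans; apply; apply: lerD => //.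
  apply: (@le_trans _ _ (`|s - h i 0| * (L + `|b| + 1))).
    by rewrite ler_peMr// lerDr addr_ge0// ltW.
  by apply: (le_trans sh'); exact: ler_piMl.
have vh : enorm v <= enorm h + enorm h.
  by rewrite (le_trans (enormB _ _))// lerD// enormZ d1 mulr1.
have Vv : coord_space I v.
  move=> l lI; rewrite /v dE !mxE eqxx andbT.
  have [->|li] := eqVneq l i; first by rewrite mulr1 subrr.
  by rewrite mulr0 subr0 Vh// !inE negb_or li.
have Vd : coord_space [set i] (s *: d).
  move=> l; rewrite !inE => li; rewrite dE !mxE (negbTE li) /= mulr0.
  by [].
have hA := yA v Vv (le_lt_trans vh hj).
have hB : `|G (x + s *: d) - G x - mdot (map_mx ratr B) (s *: d)| <=
    (8 * k.+1)%:R^-1 * enorm (s *: d).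
  by apply: xB => //; rewrite enormZ d1 mulr1 (le_lt_trans sh1).
have hG : `|G (x + h) - G (x + s *: d + v)| <= L * `|s - h i 0|.
  apply: (le_trans (GL _ _)).
  rewrite (_ : _ - _ = (h i 0 - s) *: d); last first.
    by rewrite /v; apply/colP => l; rewrite !mxE; ring.
  by rewrite enormZ d1 mulr1 distrC.
pose C : M := map_mx ratr (\col_l (if l == i then B i 0 else A l 0)).
have CE : mdot C h = mdot (map_mx ratr A) v + h i 0 * b.
  rewrite -{1}(subrK (h i 0 *: d) h) -/v mdotDr mdotZr.
  have -> : mdot C d = b by rewrite dE mdot_delta /C !mxE eqxx.
  congr (_ + _).
  rewrite !mdotE; apply: eq_bigr => l _; apply: eq_bigr => l' _.
  rewrite /v dE ord1 !mxE eqxx andbT.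
  by have [->|//] := eqVneq l i; rewrite mulr1 subrr !mulr0.
have Bd : mdot (map_mx ratr B) (s *: d) = s * b.
  by rewrite mdotZr dE mdot_delta mxE.
rewrite -/C CE.
(* Four errors: the replacement of h_i by s, the A-step along v, the B-step along s e_i, and the
   linear term (s - h_i) b. The two steps cost at most |h| / (4 (k + 1)) each, the other two |h| /
   (2 (k + 1)) together. *)
rewrite (_ : _ - _ = (G (x + h) - G (x + s *: d + v)) +
  (G (x + s *: d + v) - G (x + s *: d) - mdot (map_mx ratr A) v) +
  (G (x + s *: d) - G x - mdot (map_mx ratr B) (s *: d)) + (s - h i 0) * b); last first.
  by rewrite Bd; ring.
apply: (le_trans (ler_normD _ _)).
have -> : k.+1%:R^-1 * enorm h = ((8 * k.+1)%:R^-1 * (enorm h + enorm h) +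
   (8 * k.+1)%:R^-1 * (enorm h + enorm h)) + (2 * k.+1%:R)^-1 * enorm h.
  by rewrite natrM; field; rewrite gt_eqF.
have e8 : 0 <= (8 * k.+1)%:R^-1 :> R by rewrite invr_ge0.
have hA' := le_trans hA (ler_wpM2l e8 vh).
have hB' : `|G (x + s *: d) - G x - mdot (map_mx ratr B) (s *: d)| <=
    (8 * k.+1)%:R^-1 * (enorm h + enorm h).
  by apply: (le_trans hB); rewrite enormZ d1 mulr1 ler_wpM2l.
have hC : L * `|s - h i 0| + `|s - h i 0| * `|b| <= (2 * k.+1%:R)^-1 * enorm h.
  by apply: le_trans sh'; have := normr_ge0 (s - h i 0); move: (`|s - _|) (`|b|) => u w; lra.
rewrite normrM.
have := ler_normD (G (x + h) - G (x + s *: d + v) +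
  (G (x + s *: d + v) - G (x + s *: d) - mdot (map_mx ratr A) v))
  (G (x + s *: d) - G x - mdot (map_mx ratr B) (s *: d)).
have := ler_normD (G (x + h) - G (x + s *: d + v))
  (G (x + s *: d + v) - G (x + s *: d) - mdot (map_mx ratr A) v).
move: hA' hB' hC hG.
move: (L * `|_|) (`|_| * `|_|) => X Y.
move: ((8 * _)%:R^-1 * _) ((2 * _)^-1 * _) => P P'.
by do 5! move: (`|_|) => ?; lra.
Qed.

Let null_bad (I : {set 'I_n}) (i : 'I_n) k j A B : i \notin I ->
  hausdorff N (bad I i k j A B) = 0%E.
Proof.
move=> iI; apply: (null_lines (v := delta_mx i 0)) => [|x].
  exact: bad_measurable.
pose b : R := ratr (B i 0).
pose c : R := (2 * k.+1%:R)^-1 / (L + `|b| + 1).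
have k0 : 0 < k.+1%:R :> R by [].
have Lb1 : 1 <= L + `|b| + 1 by rewrite lerDr addr_ge0// ltW.
have Lb0 : 0 < L + `|b| + 1 by apply: lt_le_trans Lb1.
have c0 : 0 < c by rewrite divr_gt0// invr_gt0 mulr_gt0.
have c1 : c <= 1.
  rewrite /c ler_pdivrMr// mul1r (le_trans _ Lb1)// invf_le1 ?mulr_gt0//.
  by rewrite -natrM ler1n.
(* The hole has radius c |h| inside a ball of radius 2 |h|, whence c / 2. *)
apply: (@porous_null _ _ (c / 2)).
- exact: line_measurable (bad_measurable _ _ _ _ _ _).
- by rewrite divr_gt0//=; lra.
move=> t [yAB yno] e e0.
pose e' := minr e j.+1%:R^-1.
have e'0 : 0 < e' by rewrite lt_min e0/= invr_gt0 ltr0Sn.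
pose l := truncn (2 / e').
have : ~ approx_diff G (coord_space (i |: I)) k.+1%:R^-1
   (map_mx ratr (\col_l (if l == i then B i 0 else A l 0))) l.+1%:R^-1 (x + t *: delta_mx i 0).
  by move=> ?; apply: yno; exists l.
move=> /existsNP[h] /not_implyP[Vh] /not_implyP[hl] /negP; rewrite -ltNge => hbad.
have h0 : 0 < enorm h.
  rewrite enorm_gt0; apply: contraTneq hbad => ->.
  by rewrite addr0 subrr mdot0r subr0 normr0 enorm0 mulr0 ltxx.
have hh : enorm h + enorm h < e'.
  have : enorm h < e' / 2.
    rewrite (lt_trans hl)// -[ltRHS]invrK ltf_pV2 ?posrE ?invr_gt0 ?divr_gt0//.
    by rewrite invf_div truncnS_gt.
  by lra.
have hi := enorm_coord h i 0.
exists (enorm h + enorm h), (t + h i 0); split.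
- by rewrite addr_gt0//= (lt_le_trans hh)// ge_min lexx.
- move=> w; rewrite /ball/= => wt.
  rewrite (_ : t - w = (t + h i 0 - w) - h i 0); last by ring.
  rewrite (le_lt_trans (ler_normB _ _))// ltr_leD// (lt_le_trans wt)//.
  have : c * enorm h <= enorm h by rewrite ler_piMl// ltW.
  by lra.
apply/seteqP; split=> // w [/= wt [[yA _] _]].
have : `|G (x + t *: delta_mx i 0 + h) - G (x + t *: delta_mx i 0) -
   mdot (map_mx ratr (\col_l (if l == i then B i 0 else A l 0))) h| <= k.+1%:R^-1 * enorm h.
  apply: (@bad_hole I i k j A B _ h (w - t)) => //.
  - by rewrite -addrA -scalerDl (addrC t) subrK.
  - by rewrite (lt_le_trans hh)// ge_min lexx orbT.
  rewrite -/b -/c; move: wt; rewrite /ball /=.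
  have -> : w - t - h i 0 = - (t + h i 0 - w) by ring.
  rewrite normrN.
  by move=> /ltW; rewrite (_ : c / 2 * _ = c * enorm h)//; field.
by rewrite leNgt hbad.
Qed.

(** The new exceptional points are covered by countably many [bad] sets, indexed by tolerance,
    common scale and two rational covectors. *)
Lemma null_diff_alongU (I : {set 'I_n}) (i : 'I_n) : i \notin I ->
  hausdorff N (~` diff_along G (coord_space I)) = 0%E ->
  hausdorff N (~` diff_along G (coord_space (i |: I))) = 0%E.
Proof.
move=> iI I0.
have U0 : hausdorff N (\bigcup_(q : (nat * nat) * ('cV[rat]_n * 'cV[rat]_n))
    bad I i q.1.1 q.1.2 q.2.1 q.2.2) = 0%E.
  by apply: hausdorff0_bigcup => q; exact: null_bad.
have := hausdorff0U (hausdorff0U I0 (null_diff_along_coord i)) U0.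
apply: hausdorff0S => x xU.
have [xI|xI] := pselect (diff_along G (coord_space I) x); last by left; left.
have [xi|xi] := pselect (diff_along G (coord_space [set i]) x); last by left; right.
right; move/existsNP : xU => [k xk].
(* The index is 8 (k + 1) - 1 because the tolerance is the inverse of the index plus 1. *)
have [jA [A xA]] := xI (8 * k.+1).-1.
have [jB [B xB]] := xi (8 * k.+1).-1.
rewrite prednK ?muln_gt0// in xA; rewrite prednK ?muln_gt0// in xB.
exists ((k, maxn jA jB), (A, B)) => //; split.
  split; [apply: approx_diffS xA|apply: approx_diffS xB];
    by rewrite lef_pV2 ?posrE// ler_nat ltnS ?leq_maxl ?leq_maxr.
by move=> /= [l _ xl]; apply: xk; exists l, (\col_l (if l == i then B i 0 else A l 0)).
Qed.

(** Induction on the set of coordinates; along the empty set only h = 0 is tested. *)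
Lemma rademacher : hausdorff N (~` diff_along G setT) = 0%E.
Proof.
have -> : [set: M] = coord_space [set: 'I_n]%SET.
  by apply/seteqP; split=> // x _ l; rewrite !inE.
have [m] := ubnP #|[set: 'I_n]%SET|; elim: m [set: 'I_n]%SET => // m ih I Im.
have [->|[i iI]] := set_0Vmem I.
  rewrite (_ : ~` _ = set0) ?hausdorff0//; apply/seteqP; split=> // x; apply.
  apply: diff_alongP => e e0; exists 1, 0; split=> // h Vh _.
  have -> : h = 0 by apply/colP => l; rewrite Vh ?inE// mxE.
  by rewrite addr0 subrr mdot0r subr0 normr0 enorm0 mulr0.
rewrite -(finset.setD1K iI); apply: null_diff_alongU; first by rewrite !inE eqxx.
by apply: ih; move: Im; rewrite (cardsD1 i) iI.
Qed.

(** Positivity of the lower right Dini derivative in the direction [a]. Unlike the sign of a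
    gradient it makes sense at every point, and its outer quantifiers are countable. *)
Definition increasing_at (a : M) : set M :=
  [set x | exists k j : nat, forall t : R, 0 < t < j.+1%:R^-1 ->
     t / k.+1%:R <= G (x + t *: a) - G x].

Lemma increasing_at_measurable a : measurable (increasing_at a : set (borelMx R n 1)).
Proof.
rewrite (_ : increasing_at a = \bigcup_k \bigcup_j
   \bigcap_(t in [set t : R | 0 < t < j.+1%:R^-1])
    ((fun x => G (x + t *: a) - G x) @^-1` [set y | t / k.+1%:R <= y])); last first.
  apply/seteqP; split=> [x [k [j xP]]|x [k _ [j _ xP]]].
    by exists k => //; exists j.
  by exists k, j.
apply: bigcupT_measurable => k; apply: bigcupT_measurable => j.
apply: closed_mx_measurable; apply: closed_bigI => t _.
apply: closed_comp => [x _|]; last exact: closed_ge.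
apply: (@enorm_lipschitz_continuous _ _ _ _ (L + L)); first by rewrite addr_gt0.
move=> {}x y; rewrite (_ : _ - _ - _ =
  (G (x + t *: a) - G (y + t *: a)) - (G x - G y)); last by ring.
rewrite (le_trans (ler_normB _ _))// mulrDl lerD//.
by have := GL (x + t *: a) (y + t *: a); rewrite opprD addrACA subrr addr0.
Qed.

(** By Rademacher's theorem the whole increasing set is null, so some line in direction [a] meets it
    in a null set; on this line the derivative is nonpositive almost everywhere. *)
Lemma null_increasing_at_line a : (0 < n)%N ->
  hausdorff N (increasing_at a `&` diff_along G setT) = 0%E ->
  exists x, forall T, 0 < T -> G (x + T *: a) <= G x.
Proof.
move=> n0 P0.
have {}P0 : hausdorff N (increasing_at a) = 0%E.
  have := hausdorff0U P0 rademacher; apply: hausdorff0S => x xa.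
  by have [xd|xd] := pselect (diff_along G setT x); [left|right].
have [x x0] := null_exists_line a (ltac:(by rewrite muln1)) (increasing_at_measurable a) P0.
exists x => T T0.
have -> : G x = G (x + 0 *: a) by rewrite scale0r addr0.
apply: (lipschitz_derive_le0 (g := fun t => G (x + t *: a)) (Lv a)) => //.
  exact: line_lipschitz.
apply: null_ae x0 _; first exact: line_measurable (increasing_at_measurable a).
move=> t nt dg; rewrite leNgt; apply/negP => g0; apply: nt.
(* A derivative g' > 0 at t forces the rate g' / 2 just to the right of t, which puts the point in
   the increasing set. *)
have [d d0 dP] := derivable_approx dg (divr_gt0 g0 (ltr0Sn R 1)).
exists (truncn (derive1 (fun t => G (x + t *: a)) t / 2)^-1), (truncn d^-1).
move=> s /andP[s0 sd].
have sd' : `|s| < d.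
  rewrite gtr0_norm// (lt_le_trans sd)// -[leRHS]invrK lef_pV2 ?posrE ?invr_gt0//.
  exact/ltW/truncnS_gt.
have -> : x + t *: a + s *: a = x + (t + s) *: a by rewrite scalerDl addrA.
have := dP s sd'; rewrite (gtr0_norm s0).
move: g0; set g' := derive1 _ _ => g0.
have : s / (truncn (g' / 2)^-1).+1%:R <= s * (g' / 2).
  rewrite ler_pM2l// -[leRHS]invrK lef_pV2 ?posrE ?invr_gt0 ?divr_gt0//.
  exact/ltW/truncnS_gt.
rewrite ler_norml => h1 /andP[h2 _]; apply: (le_trans h1).
by move: h2; rewrite -/g'; move: (G _) (G _) => u v; lra.
Qed.

End rademacher.

(** * Gradients *)

Section gradient.
Context {R : realType} {n : nat}.
Local Notation M := 'cV[R]_n.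
Implicit Types (f : M -> R) (z A : M).

Definition gradient_at f z A :=
  forall e, 0 < e -> exists2 d, 0 < d & approx_diff f setT e A d z.

Definition gradient f z : M := \col_i 'd f z (delta_mx i 0).

Lemma gradient_at_differentiable f z A : gradient_at f z A ->
  differentiable f z /\ gradient f z = A.
Proof.
move=> fA; pose df : {linear M -> R} := mxtrace \o mulmx A^T.
have dfE h : df h = mdot A h by [].
have dfc : continuous df.
  apply: (@enorm_lipschitz_continuous _ _ _ _ (enorm A + 1)).
    by rewrite ltr_wpDl// enorm_ge0.
  move=> x y; rewrite !dfE -mdotNr -mdotDr.
  by rewrite (le_trans (normr_mdot_le _ _))// ler_wpM2r ?enorm_ge0// lerDl.
have fo : (f : M -> R^o) \o shift z = cst (f z : R^o) + (df : M -> R^o) +o_ (0 : M) id.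
  apply/eqaddoP => e e0.
  have e1 : 0 < e / ((n * 1)%:R + 1) by rewrite divr_gt0// ltr_wpDl.
  have [d d0 dP] := fA _ e1.
  apply/nbhs_enormP; exists d => // h; rewrite subr0 => hd.
  change (`|f (h + z) - (f z + mdot A h)| <= e * `|h|).
  rewrite (addrC h) opprD addrA (le_trans (dP h I hd))//.
  rewrite -mulrA ler_pM2l// ler_pdivrMl ?ltr_wpDl//.
  by rewrite (le_trans (enorm_le_mx_norm _))// ler_wpM2r// lerDl.
have dE := @diff_unique R M R^o f df z dfc fo.
split; first by apply/diff_locallyP; rewrite dE.
by apply/colP => i; rewrite mxE dE dfE mdot_delta.
Qed.

Lemma diff_mdot_gradient f z h : differentiable f z -> 'd f z h = mdot (gradient f z) h.
Proof.
move=> _; rewrite {1}(matrix_sum_delta h) linear_sum mdotE; apply: eq_bigr => i _.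
rewrite linear_sum; apply: eq_bigr => j _; rewrite linearZ ord1 mxE mulrC.
by [].
Qed.

Lemma differentiable_gradient_at f z : differentiable f z ->
  gradient_at f z (gradient f z).
Proof.
move=> df e e0; have /diff_locallyP[_ /eqaddoP/(_ e e0)] := df.
move=> /nbhs_enormP[d d0 dP]; exists d => // h _ hd.
have := dP h; rewrite subr0 => /(_ hd) fh.
rewrite -diff_mdot_gradient//.
have : `|f (h + z) - (f z + 'd f z h)| <= e * `|h| by exact: fh.
rewrite (addrC h) opprD addrA => /le_trans; apply.
by rewrite ler_pM2l// mx_norm_le_enorm.
Qed.

Lemma gradient_at_diff_along f z A : gradient_at f z A -> diff_along f setT z.
Proof.
by move=> fA; apply: diff_alongP => e /fA[d d0 dP]; exists d, A.
Qed.

(** The rational covectors for the tolerances 1 / (k + 1) are compared on common small multiples of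
    the coordinate vectors; they form a Cauchy sequence with explicit rate, whose limit is the
    gradient. *)
Lemma diff_along_gradient_at f z : diff_along f setT z -> exists A, gradient_at f z A.
Proof.
move=> fz; have /choice[j jP] := fz.
have {jP}/choice[A AP] := jP.
have comp k l i : `|(ratr (A k i 0) : R) - ratr (A l i 0)| <= k.+1%:R^-1 + l.+1%:R^-1.
  pose t : R := minr (j k).+1%:R^-1 (j l).+1%:R^-1 / 2.
  have t0' : 0 < minr (j k).+1%:R^-1 (j l).+1%:R^-1 :> R by rewrite lt_min !invr_gt0 !ltr0Sn.
  have t0 : 0 < t by rewrite divr_gt0.
  have tm : t < minr (j k).+1%:R^-1 (j l).+1%:R^-1.
    by rewrite /t ltr_pdivrMr// ltr_pMr// ltr1n.
  pose h : M := t *: delta_mx i 0.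
  have hE : enorm h = t by rewrite enormZ enorm_delta mulr1 gtr0_norm.
  have := AP k h I; rewrite hE => /(_ (lt_le_trans tm _)); rewrite ge_min lexx => /(_ isT).
  have := AP l h I; rewrite hE => /(_ (lt_le_trans tm _)); rewrite ge_min lexx orbT => /(_ isT).
  rewrite !mdotZr !mdot_delta !mxE.
  move: (ratr (A k i 0)) (ratr (A l i 0)) (f (z + h) - f z) => a b c h1 h2.
  rewrite -(ler_pM2l t0) -{1}(gtr0_norm t0) -normrM.
  rewrite (_ : t * (a - b) = (c - t * b) - (c - t * a)); last by ring.
  rewrite (le_trans (ler_normB _ _))// mulrDr [leRHS]addrC.
  by rewrite lerD// [leRHS]mulrC.
(* The limit is the supremum of the left ends of the intervals of centre A_k and radius 1 / (k + 1),
   which meet pairwise. *)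
pose S i := [set (ratr (A k i 0) : R) - k.+1%:R^-1 | k in [set: nat]].
have Sub i l : ubound (S i) (ratr (A l i 0) + l.+1%:R^-1).
  move=> _ [k _ <-]; have := comp k l i; rewrite ler_norml => /andP[_].
  by move: (ratr _) (ratr _) (_^-1) (_^-1) => a b c d; lra.
have supS i k : `|sup (S i) - ratr (A k i 0)| <= k.+1%:R^-1.
  have Sk : S i (ratr (A k i 0) - k.+1%:R^-1) by exists k.
  have h1 : ratr (A k i 0) - k.+1%:R^-1 <= sup (S i).
    apply: ub_le_sup => //; exists (ratr (A 0%N i 0) + 1%:R^-1); exact: Sub.
  have h2 : sup (S i) <= ratr (A k i 0) + k.+1%:R^-1.
    by apply: ge_sup; [exists (ratr (A k i 0) - k.+1%:R^-1)|exact: Sub].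
  by rewrite ler_norml; move: h1 h2; move: (ratr _) (_^-1) (sup _) => a b c; lra.
exists (\col_i sup (S i)) => e e0.
pose k := truncn (((n * 1)%:R + 1) / e).
have k0 : 0 < k.+1%:R :> R by [].
have ke : ((n * 1)%:R + 1) * k.+1%:R^-1 <= e.
  rewrite ler_pdivrMr// mulrC -ler_pdivrMr//; exact/ltW/truncnS_gt.
exists (j k).+1%:R^-1; first by rewrite invr_gt0.
move=> h _ hd; have := AP k h I hd.
have Ak : enorm (\col_i sup (S i) - map_mx ratr (A k)) <= (n * 1)%:R * k.+1%:R^-1.
  by apply: enorm_le_bound => [|i l]; rewrite ?invr_ge0// ord1 !mxE.
move=> h1; have -> : f (z + h) - f z - mdot (\col_i sup (S i)) h =
  (f (z + h) - f z - mdot (map_mx ratr (A k)) h) - mdot (\col_i sup (S i) - map_mx ratr (A k)) h.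
  by rewrite mdotDl mdotNl; ring.
apply: (le_trans (ler_normB _ _)).
apply: (@le_trans _ _ (((n * 1)%:R + 1) * k.+1%:R^-1 * enorm h)); last first.
  by rewrite ler_wpM2r// enorm_ge0.
rewrite mulrDl mul1r mulrDl addrC lerD//.
by rewrite (le_trans (normr_mdot_le _ _))// ler_wpM2r// enorm_ge0.
Qed.

Lemma diff_along_differentiable f z : diff_along f setT z <-> differentiable f z.
Proof.
split=> [/diff_along_gradient_at[A /gradient_at_differentiable[]]//|].
by move=> /differentiable_gradient_at; exact: gradient_at_diff_along.
Qed.

(** Passes between the radial function, in terms of which the regular boundary is defined, and the
    gauge. *)
Lemma differentiable_inv f z : f z != 0 ->
  differentiable (fun x => (f x)^-1) z <-> differentiable f z.
Proof.
move=> f0; split=> df; last exact: differentiableV.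
have -> : f = (fun x => ((f x)^-1)^-1) by apply/funext => x; rewrite invrK.
by apply: differentiableV; rewrite ?invr_eq0.
Qed.

Lemma gradient_derive f z h : differentiable f z ->
  (fun t => t^-1 * (f (z + t *: h) - f z)) @ (0 : R)^' --> mdot (gradient f z) h.
Proof.
move=> df; apply/cvgrPdist_le => e e0.
have eh : 0 < e / (enorm h + 1) by rewrite divr_gt0// ltr_wpDl// enorm_ge0.
have [d d0 dP] := differentiable_gradient_at df eh.
exists (d / (enorm h + 1)) => /=; first by rewrite divr_gt0// ltr_wpDl// enorm_ge0.
move=> t; rewrite /ball_ /= sub0r normrN ltr_pdivlMr ?ltr_wpDl ?enorm_ge0// => td t0.
have h1 : enorm h <= enorm h + 1 by rewrite lerDl.
have := dP (t *: h) I; rewrite enormZ => /(_ (le_lt_trans (ler_wpM2l (normr_ge0 t) h1) td)).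
rewrite mdotZr => H.
have -> : mdot (gradient f z) h - t^-1 * (f (z + t *: h) - f z) =
  - t^-1 * (f (z + t *: h) - f z - t * mdot (gradient f z) h) by field.
rewrite normrM normrN normfV ler_pdivrMl ?normr_gt0// (le_trans H)//.
rewrite mulrCA ler_wpM2l// mulrAC ler_pdivrMr ?ltr_wpDl ?enorm_ge0//.
by rewrite ler_wpM2l// ltW.
Qed.

End gradient.

(** * The unit sphere *)

Section sphere.
Context {R : realType} {n m : nat}.
Local Notation M := 'M[R]_(n, m).
Local Notation N := (n * m)%N.

Lemma hausdorff_fin_bigcup_lty s (T : finType) (F : T -> set M) :
  (forall i, hausdorff s (F i) < +oo)%E -> (hausdorff s (\bigcup_i F i) < +oo)%E.
Proof.
move=> Foo.
suff H (r : seq T) : (hausdorff s (\big[setU/set0]_(i <- r) F i) < +oo)%E.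
  apply: le_lt_trans (H (enum T)); apply: hausdorffS => x [i _ Fx].
  by rewrite -bigcup_seq; exists i => //=; rewrite mem_enum.
elim: r => [|i r ih]; first by rewrite big_nil hausdorff0 ltry.
rewrite big_cons.
apply: (le_lt_trans (outer_measureU2 (hausdorff s : set M -> \bar R) _ _)).
by apply: lte_add_pinfty; [exact: Foo|exact: ih].
Qed.

(** Meant for the faces of the cube, whose points have norm at least 1; the factor 2 comes from
    moving the vector and then correcting its length. *)
Lemma normalize_lipschitz (x y : M) : 1 <= enorm x -> 1 <= enorm y ->
  enorm ((enorm x)^-1 *: x - (enorm y)^-1 *: y) <= 2 * enorm (x - y).
Proof.
move=> x1 y1.
have x0 : 0 < enorm x by exact: lt_le_trans x1.
have y0 : 0 < enorm y by exact: lt_le_trans y1.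
rewrite (_ : _ - _ = (enorm x)^-1 *: ((x - y) + (1 - enorm x / enorm y) *: y)); last first.
  by apply/matrixP => i j; rewrite !mxE; field; rewrite !gt_eqF.
rewrite enormZ gtr0_norm ?invr_gt0// ler_pdivrMl//.
apply: (@le_trans _ _ (2 * enorm (x - y))); last by rewrite ler_peMl// mulr_ge0// enorm_ge0.
apply: (le_trans (enormD _ _)); rewrite enormZ.
have -> : `|1 - enorm x / enorm y| * enorm y = `|enorm y - enorm x|.
  rewrite -{2}(gtr0_norm y0) -normrM; congr `|_|; field; rewrite gt_eqF//.
have := enorm_dist y x; rewrite (enormBC y); lra.
Qed.

(** The sphere is covered by the radial projections of the 2nm faces of the cube [-1, 1]^N, each of
    finite (N-1)-measure. *)
Lemma hausdorff_sphere_lty : (0 < N)%N ->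
  (hausdorff N.-1 (esphere R n m) < +oo)%E.
Proof.
move=> N0.
pose F (k : ('I_n * 'I_m) * bool) := [set y : M |
  (forall i j, (i, j) \in [set~ k.1]%SET -> `|y i j| <= 1) /\
  (forall i j, (i, j) \notin [set~ k.1]%SET -> y i j = (const_mx ((-1) ^+ k.2) : M) i j)].
have cI (k : 'I_n * 'I_m) : #|[set~ k]%SET| = N.-1.
  by rewrite cardsC1 card_prod !card_ord.
have F1 k y : F k y -> 1 <= enorm y.
  case: k => -[i j] b [_ /(_ i j)]; rewrite !inE eqxx => /(_ isT) yij.
  by rewrite (le_trans _ (enorm_coord y i j))// yij mxE normrX normrN1 expr1n.
pose r (y : M) := (enorm y)^-1 *: y.
have Fr k : (hausdorff N.-1 (r @` F k) < +oo)%E.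
  apply: (@le_lt_trans _ _ ((2 ^+ N.-1)%:E * hausdorff N.-1 (F k))%E).
    by apply: hausdorff_image => // x y Fx Fy; apply: normalize_lipschitz; [exact: F1 Fx|exact: F1 Fy].
  rewrite lte_mul_pinfty// ?lee_fin ?exprn_ge0//.
  have H := @hausdorff_face_lty R n m [set~ k.1]%SET (const_mx ((-1) ^+ k.2)).
  by rewrite cI in H; exact: H.
apply: le_lt_trans (hausdorff_fin_bigcup_lty Fr); apply: hausdorffS => x x1.
have x0 : x != 0 by rewrite -enorm_gt0 x1.
have nx0 : `|x| != 0 by rewrite normr_eq0.
have [[i j] xij] := mx_norm_neq0 nx0.
have {xij}xij : `|x| = `|x i j| by exact: xij.
have xp : 0 < `|x i j| by rewrite -xij normr_gt0.
(* The face is that of an entry of largest absolute value, with its sign. *)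
exists ((i, j), x i j < 0) => //; exists (`|x i j|^-1 *: x); last first.
  rewrite /r enormZ normfV normr_id x1 mulr1 invrK scalerA divff ?scale1r//.
  by rewrite gt_eqF.
split=> k l; last first.
  rewrite !inE negbK => /eqP[-> ->]; rewrite !mxE /=.
  have [xn|xn] := ltP (x i j) 0.
    by rewrite ltr0_norm// expr1 mulrC invrN mulrN divff// lt_eqF.
  by rewrite ger0_norm// expr0 mulVf// -normr_eq0 gt_eqF.
move=> _; rewrite mxE normrM normfV normr_id ler_pdivrMl// mulr1 -xij.
exact: coord_le_mx_norm.
Qed.

Lemma hausdorff_singleton s (x : M) : (0 < s)%N -> hausdorff s [set x] = 0%E.
Proof.
move=> s0; apply/eqP; rewrite eq_le hausdorff_ge0 andbT; apply: hausdorff_le => d d0.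
have e0 : (ediam [set x] <= 0%:E)%E.
  by apply: ediam_le => _ _ -> ->; rewrite subrr enorm0.
apply: (le_trans (hausdorff_content_le_gauge _ d0 _)).
  by rewrite (le_trans e0)// lee_fin ltW.
apply: (le_trans (hausdorff_gauge_le_pow s (lexx 0) e0)).
by rewrite mul0r expr0n gtn_eqF//= mulr0.
Qed.

(** Substitute for polar coordinates, for null sets only: apart from the origin, [E] lies in
    countably many truncated cones over [Z]. *)
Lemma hausdorff0_radial (Z E : set M) (a : R) : (1 < N)%N ->
  (forall z, Z z -> enorm z <= a) ->
  (forall x : M, E x -> x != 0 -> exists2 t : R, 0 < t & Z (t *: x)) ->
  hausdorff N.-1 Z = 0%E -> hausdorff N E = 0%E.
Proof.
move=> N1 Za ZE Z0.
have N0 : (0 < N)%N by exact: ltn_trans N1.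
have N10 : (0 < N.-1)%N by rewrite -ltnS prednK.
pose C (k : nat) := [set tz.1 *: tz.2 | tz in `[0, k.+1%:R] `*` Z].
have C0 k : hausdorff N (C k) = 0%E.
  by rewrite -[X in hausdorff X](prednK N0); apply: (hausdorff0_cone N10 _ Z0 Za).
apply: hausdorff0S (hausdorff0U (hausdorff_singleton 0 N0) (hausdorff0_bigcup C0)).
move=> x Ex; have [->|x0] := eqVneq x 0; [by left|right].
have [t t0 Zt] := ZE x Ex x0.
exists (truncn t^-1) => //; exists (t^-1, t *: x); last first.
  by rewrite scalerA mulVf ?scale1r// gt_eqF.
split=> //=; rewrite in_itv/= invr_ge0 ltW//=.
exact/ltW/truncnS_gt.
Qed.

(** Otherwise the whole space, as the cone over the sphere, would be null. *)
Lemma hausdorff_sphere_gt0 : (1 < N)%N -> (0 < hausdorff N.-1 (esphere R n m))%E.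
Proof.
move=> N1; rewrite lt_neqAle hausdorff_ge0 andbT eq_sym; apply/eqP => S0.
have := @hausdorffT_gt0 R n m (ltnW N1).
rewrite (@hausdorff0_radial (esphere R n m) setT 1) ?ltxx// => [z ->//|x _ x0].
exists (enorm x)^-1; first by rewrite invr_gt0 enorm_gt0.
by rewrite /esphere/= enormZ gtr0_norm ?invr_gt0 ?enorm_gt0// mulVf// enorm_eq0.
Qed.

Lemma esphere_closed : closed (esphere R n m).
Proof.
rewrite (_ : esphere R n m = (@enorm R n m) @^-1` [set 1]).
  by apply: closed_comp => [x _|]; [exact: enorm_continuous|exact: closed_eq].
by [].
Qed.

Lemma esphere_compact : compact (esphere R n m).
Proof.
by apply: (@mx_closed_bounded_compact _ _ _ _ 1) => [|x ->//]; exact: esphere_closed.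
Qed.

End sphere.

(** * Star bodies *)

Lemma compact_enorm_bounded {R : realType} {n m : nat} (A : set 'M[R]_(n, m)) :
  compact A -> exists2 B, 0 < B & forall x, A x -> enorm x <= B.
Proof.
move=> /compact_bounded[B [_ BA]].
exists ((n * m)%:R * `|B + 1| + 1); first by rewrite ltr_wpDl// mulr_ge0.
move=> x Ax; apply: (le_trans (enorm_le_mx_norm x)).
rewrite (@le_trans _ _ ((n * m)%:R * `|B + 1|)) ?lerDl// ler_wpM2l//.
apply: (@le_trans _ _ (B + 1)); last exact: ler_norm.
by apply: BA => //; rewrite ltrDl.
Qed.

Section star_body.
Context {R : realType} {n : nat}.
Local Notation M := 'cV[R]_n.
Variable K : set M.
Hypotheses (n0 : (0 < n)%N) (hK : lipschitz_star_body K).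

(** The Minkowski functional of K. At the origin [radial K] takes the default value 0, and so does
    its inverse, so that homogeneity holds everywhere. *)
Definition gauge (x : M) : R := (radial K x)^-1.

Let unit_vector : exists e : M, esphere R n 1 e.
Proof. by exists (delta_mx (Ordinal n0) 0); exact: enorm_delta. Qed.

Lemma star_body_compact : compact K. Proof. by case: hK. Qed.

Lemma star_body_star (z : M) (t : R) : K z -> 0 <= t <= 1 -> K (t *: z).
Proof. by case: hK => _ H _ _ _; exact: H. Qed.

Lemma star_body_closed : closed K.
Proof. by apply: compact_closed; [exact: norm_hausdorff|exact: star_body_compact]. Qed.

Lemma star_body0 : K 0.
Proof.
have [e e1] := unit_vector.
suff [z Kz] : K !=set0 by rewrite -(scale0r z); apply: star_body_star; rewrite // lexx ler01.
apply: contrapT => K0; case: hK => _ _ /(_ e e1) + _ _.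
rewrite /radial (_ : mkset _ = set0) ?sup0 ?ltxx//.
by apply/seteqP; split=> // l [_ Kl]; apply: K0; exists (l *: e).
Qed.

Lemma star_body_bounded : exists2 B, 0 < B & forall x, K x -> enorm x <= B.
Proof.
exact: compact_enorm_bounded star_body_compact.
Qed.

Lemma radial_has_sup (x : M) : x != 0 -> has_sup [set l : R | 0 <= l /\ K (l *: x)].
Proof.
move=> x0; split.
  by exists 0; split; rewrite ?scale0r//; exact: star_body0.
have [B B0 KB] := star_body_bounded.
exists (B / enorm x) => l [l0 Kl]; rewrite ler_pdivlMr ?enorm_gt0//.
by have := KB _ Kl; rewrite enormZ ger0_norm.
Qed.

Lemma radial0 : radial K 0 = 0.
Proof.
rewrite /radial sup_out// => -[_ [b bub]].
have : `|b| + 1 <= b.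
  by apply: bub; split; [rewrite addr_ge0|rewrite scaler0; exact: star_body0].
by have := ler_norm b; lra.
Qed.

Lemma star_body_radial (x : M) : x != 0 -> K (radial K x *: x).
Proof.
move=> x0; have hs := radial_has_sup x0.
apply: contrapT => nK.
have : nbhs (radial K x *: x) (~` K).
  by apply: open_nbhs_nbhs; split=> //; exact: closed_openC star_body_closed.
move=> /nbhs_enormP[e e0 eK].
have ex : 0 < e / enorm x by rewrite divr_gt0// enorm_gt0.
have [l [l0 Kl] lr] := sup_adherent ex hs.
apply: (eK (l *: x)) => //.
rewrite -scalerBl enormZ -ltr_pdivlMr ?enorm_gt0// distrC ger0_norm ?subr_ge0.
  by rewrite ltrBlDr -ltrBlDl.
by apply: ub_le_sup => //; case: hs.
Qed.

Lemma radial_ge0 (x : M) : 0 <= radial K x.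
Proof.
have [->|x0] := eqVneq x 0; first by rewrite radial0.
apply: ub_le_sup; first by case: (radial_has_sup x0).
by split; rewrite ?scale0r//; exact: star_body0.
Qed.

Lemma radialZ (c : R) (x : M) : 0 < c -> radial K (c *: x) = c^-1 * radial K x.
Proof.
move=> c0; have [->|x0] := eqVneq x 0; first by rewrite scaler0 radial0 mulr0.
have cx0 : c *: x != 0 by rewrite scaler_eq0 negb_or gt_eqF.
apply/eqP; rewrite eq_le; apply/andP; split.
  rewrite mulrC ler_pdivlMr//; apply: ub_le_sup; first by case: (radial_has_sup x0).
  split; first by rewrite mulr_ge0 ?radial_ge0// ltW.
  by rewrite -scalerA; exact: star_body_radial.
apply: ub_le_sup; first by case: (radial_has_sup cx0).
split; first by rewrite mulr_ge0 ?radial_ge0// invr_ge0 ltW.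
rewrite scalerA mulrAC mulVf ?gt_eqF// mul1r; exact: star_body_radial.
Qed.

Lemma radial_gt0 (x : M) : x != 0 -> 0 < radial K x.
Proof.
move=> x0; have ex : 0 < enorm x by rewrite enorm_gt0.
have -> : x = enorm x *: ((enorm x)^-1 *: x).
  by rewrite scalerA divff ?scale1r// gt_eqF.
rewrite radialZ// mulr_gt0 ?invr_gt0//.
by case: hK => _ _ H _ _; apply: H; rewrite /esphere/= enormZ gtr0_norm ?invr_gt0// mulVf// gt_eqF.
Qed.

Lemma gauge0 : gauge 0 = 0. Proof. by rewrite /gauge radial0 invr0. Qed.

Lemma gauge_gt0 (x : M) : x != 0 -> 0 < gauge x.
Proof. by move=> x0; rewrite invr_gt0 radial_gt0. Qed.

Lemma gauge_ge0 (x : M) : 0 <= gauge x.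
Proof. by rewrite invr_ge0 radial_ge0. Qed.

Lemma gaugeZ (c : R) (x : M) : 0 <= c -> gauge (c *: x) = c * gauge x.
Proof.
rewrite le_eqVlt => /predU1P[<-|c0]; first by rewrite scale0r gauge0 mul0r.
by rewrite /gauge radialZ// invfM invrK.
Qed.

Lemma gauge_le1 (x : M) : K x <-> gauge x <= 1.
Proof.
have [->|x0] := eqVneq x 0; first by rewrite gauge0 ler01; split=> // _; exact: star_body0.
rewrite invf_le1 ?radial_gt0//; split=> [Kx|r1].
  apply: ub_le_sup; first by case: (radial_has_sup x0).
  by split; rewrite ?scale1r.
have -> : x = (radial K x)^-1 *: (radial K x *: x).
  by rewrite scalerA mulVf ?scale1r// gt_eqF// radial_gt0.
apply: star_body_star; first exact: star_body_radial.
by rewrite invr_ge0 radial_ge0/= invf_le1// radial_gt0.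
Qed.

Lemma gauge_lower : exists2 c, 0 < c & forall x, c * enorm x <= gauge x.
Proof.
have [B B0 KB] := star_body_bounded.
exists B^-1; first by rewrite invr_gt0.
move=> x; have [->|x0] := eqVneq x 0; first by rewrite enorm0 mulr0 gauge0.
rewrite ler_pdivrMl//; have := KB _ (star_body_radial x0).
rewrite enormZ ger0_norm ?radial_ge0// /gauge.
by rewrite -ler_pdivlMl ?radial_gt0// mulrC.
Qed.

Lemma gauge_sphere_upper : exists2 C, 0 < C & forall x, esphere R n 1 x -> gauge x <= C.
Proof.
have S0 : esphere R n 1 !=set0 by have [e] := unit_vector; exists e.
have [_ _ r0 rc _] := hK.
have [c cS cmin] := compact_EVT_min S0 esphere_compact rc.
have c0 := r0 c (set_mem cS).
exists (radial K c)^-1; first by rewrite invr_gt0.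
move=> x x1; have rx := r0 x x1.
by rewrite lef_pV2 ?posrE//; exact/cmin/mem_set.
Qed.

(** On the sphere the gauge is the reciprocal of a Lipschitz function bounded below. Homogeneity
    extends the bound, as |x| times the distance of the normalized vectors is at most 2 |x - y|; the
    origin is treated apart. *)
Lemma gauge_lipschitz : exists2 L, 0 < L & forall x y, `|gauge x - gauge y| <= L * enorm (x - y).
Proof.
have [C C0 SC] := gauge_sphere_upper.
have [_ _ r0 _ [L0 rL]] := hK.
pose L := `|L0|; have Lge0 : 0 <= L by exact: normr_ge0.
have SL x y : esphere R n 1 x -> esphere R n 1 y -> `|gauge x - gauge y| <= L * C ^+ 2 * enorm (x - y).
  move=> x1 y1; have rx := r0 x x1; have ry := r0 y y1.
  have -> : gauge x - gauge y = (radial K y - radial K x) * (gauge x * gauge y).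
    by rewrite /gauge; field; rewrite !gt_eqF.
  rewrite normrM distrC (ger0_norm (mulr_ge0 (gauge_ge0 _) (gauge_ge0 _))) mulrAC.
  apply: ler_pM => //; first by rewrite mulr_ge0// gauge_ge0.
    by rewrite (le_trans (rL x y x1 y1))// ler_wpM2r ?enorm_ge0// ler_norm.
  by rewrite expr2; apply: ler_pM; rewrite ?gauge_ge0// SC.
have main x y : x != 0 -> y != 0 -> `|gauge x - gauge y| <= (L * C ^+ 2 * 2 + C) * enorm (x - y).
  move=> x0 y0.
  have ex : 0 < enorm x by rewrite enorm_gt0.
  have ey : 0 < enorm y by rewrite enorm_gt0.
  pose x' := (enorm x)^-1 *: x; pose y' := (enorm y)^-1 *: y.
  have x'1 : esphere R n 1 x' by rewrite /esphere/= enormZ gtr0_norm ?invr_gt0// mulVf// gt_eqF.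
  have y'1 : esphere R n 1 y' by rewrite /esphere/= enormZ gtr0_norm ?invr_gt0// mulVf// gt_eqF.
  have xE : gauge x = enorm x * gauge x'.
    by rewrite -gaugeZ ?ltW// scalerA divff ?scale1r// gt_eqF.
  have yE : gauge y = enorm y * gauge y'.
    by rewrite -gaugeZ ?ltW// scalerA divff ?scale1r// gt_eqF.
  have -> : gauge x - gauge y = enorm x * (gauge x' - gauge y') + gauge y' * (enorm x - enorm y).
    by rewrite xE yE; ring.
  apply: (le_trans (ler_normD _ _)); rewrite !normrM (gtr0_norm ex) (ger0_norm (gauge_ge0 _)) mulrDl.
  apply: lerD; last first.
    by apply: ler_pM => //; rewrite ?gauge_ge0 ?SC// enorm_dist.
  apply: (@le_trans _ _ (enorm x * (L * C ^+ 2 * enorm (x' - y')))).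
    by rewrite ler_pM2l// SL.
  rewrite mulrCA -!mulrA; apply: ler_wpM2l => //; rewrite !ler_pM2l//.
  rewrite -{1}(gtr0_norm ex) -enormZ.
  rewrite (_ : enorm x *: (x' - y') = (x - y) + (1 - enorm x / enorm y) *: y); last first.
    by apply/matrixP => i j; rewrite !mxE; field; rewrite !gt_eqF.
  apply: (le_trans (enormD _ _)); rewrite enormZ.
  have -> : `|1 - enorm x / enorm y| * enorm y = `|enorm y - enorm x|.
    by rewrite -{2}(gtr0_norm ey) -normrM; congr `|_|; field; rewrite gt_eqF.
  by have := enorm_dist y x; rewrite (enormBC y); lra.
exists (L * C ^+ 2 * 2 + C + C).
  by rewrite !ltr_wpDl// ?mulr_ge0 ?addr_ge0 ?mulr_ge0 ?sqr_ge0 ?(ltW C0).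
have C2 x : gauge x <= C * enorm x.
  have [->|x0] := eqVneq x 0; first by rewrite gauge0 enorm0 mulr0.
  have ex : 0 < enorm x by rewrite enorm_gt0.
  rewrite -ler_pdivrMr// mulrC -gaugeZ ?invr_ge0 ?(ltW ex)//; apply: SC.
  by rewrite /esphere/= enormZ gtr0_norm ?invr_gt0// mulVf// gt_eqF.
have LC : 0 <= L * C ^+ 2 * 2 by rewrite mulr_ge0// mulr_ge0// exprn_ge0// ltW.
move=> x y; have [->|x0] := eqVneq x 0.
  rewrite gauge0 !sub0r normrN enormN ger0_norm ?gauge_ge0// (le_trans (C2 y))//.
  by rewrite ler_wpM2r ?enorm_ge0// lerDr addr_ge0// ltW.
have [->|y0] := eqVneq y 0.
  rewrite gauge0 !subr0 ger0_norm ?gauge_ge0// (le_trans (C2 x))//.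
  by rewrite ler_wpM2r ?enorm_ge0// lerDr addr_ge0// ltW.
by rewrite (le_trans (main x y x0 y0))// ler_wpM2r ?enorm_ge0// lerDl ltW.
Qed.

Lemma gauge_continuous : continuous gauge.
Proof. by have [L L0 GL] := gauge_lipschitz; exact: enorm_lipschitz_continuous GL. Qed.

Lemma star_body_boundary : closure K `\` interior K = [set x | gauge x = 1].
Proof.
have -> : closure K = K by apply/esym/closure_id; exact: star_body_closed.
apply/seteqP; split=> [x [Kx nKx]|x /= x1].
  apply/eqP; rewrite eq_le; have /gauge_le1 -> /= := Kx.
  rewrite leNgt; apply/negP => x1; apply: nKx.
  have : nbhs x [set y | gauge y < 1].
    apply: open_nbhs_nbhs; split=> //.
    apply: (@open_comp _ _ gauge [set t | t < 1]) => [y _|]; last exact: open_lt.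
    exact: gauge_continuous.
  by apply: filterS => y /ltW /gauge_le1.
split; first by apply/gauge_le1; rewrite x1.
move=> /nbhs_enormP[e e0 eK].
have x0 : x != 0 by apply: contra_eq_neq x1 => ->; rewrite gauge0 eq_sym oner_neq0.
have ex : 0 < enorm x by rewrite enorm_gt0.
(* Dilation by 1 + t moves [x] by e / 2 only, but raises its gauge above 1. *)
pose t := e / enorm x / 2.
have t0 : 0 < t by rewrite !divr_gt0.
have /gauge_le1 : K ((1 + t) *: x).
  apply: eK; rewrite scalerDl scale1r addrC addKr enormZ gtr0_norm//.
  by rewrite /t mulrAC divfK ?gt_eqF// ltr_pdivrMr// ltr_pMr// ltr1n.
rewrite gaugeZ; last by rewrite addr_ge0// ltW.
by rewrite x1 mulr1 gerDl leNgt t0.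
Qed.

End star_body.

(** * The regular boundary and its normals *)

Section regular_boundary.
Context {R : realType} {n : nat}.
Local Notation M := 'cV[R]_n.
Variable K : set M.
Hypotheses (n1 : (1 < n)%N) (hK : lipschitz_star_body K).
Let n0 : (0 < n)%N := ltnW n1.
Local Notation G := (gauge K).
Local Notation D := (regular_boundary K).

Let gauge1_neq0 z : G z = 1 -> z != 0.
Proof. by move=> z1; apply: contra_eq_neq z1 => ->; rewrite (gauge0 n0 hK) eq_sym oner_neq0. Qed.

Lemma regular_boundaryE : D = [set z | G z = 1] `&` diff_along G setT.
Proof.
rewrite /regular_boundary; apply/seteqP; split=> z [].
  rewrite (star_body_boundary n0 hK) => zG dr; split=> //.
  apply/diff_along_differentiable/differentiable_inv => //.
  by rewrite gt_eqF// (radial_gt0 n0 hK)//; exact: gauge1_neq0.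
move=> zG /diff_along_differentiable dr; split.
  by rewrite (star_body_boundary n0 hK).
apply/differentiable_inv => //.
by rewrite gt_eqF// (radial_gt0 n0 hK)//; exact: gauge1_neq0.
Qed.

Lemma regular_boundary_gauge z : D z -> G z = 1.
Proof. by rewrite regular_boundaryE => -[]. Qed.

Lemma regular_boundary_differentiable z : D z -> differentiable G z.
Proof. by rewrite regular_boundaryE => -[_ /diff_along_differentiable]. Qed.

Lemma regular_boundary_borel : measurable (D : set (borelMx R n 1)).
Proof.
have [L L0 GL] := gauge_lipschitz n0 hK.
rewrite regular_boundaryE; apply: measurableI; last exact: diff_along_measurable L0 GL _.
apply: closed_mx_measurable.
apply: (@closed_comp _ _ G [set 1]) => [z _|]; last exact: closed_eq.
exact: gauge_continuous n0 hK z.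
Qed.

Lemma regular_boundary_measurable s : measurable (D : set (hausdorffMx R n 1 s)).
Proof. by apply: borel_hausdorff_measurable; exact: regular_boundary_borel. Qed.

(** The boundary is the image of the sphere under x |-> radial K x *: x, where [radial K] is
    Lipschitz and at most c^-1. *)
Lemma regular_boundary_lty : (hausdorff n.-1 D < +oo)%E.
Proof.
have [c c0 cG] := gauge_lower n0 hK.
have [_ _ _ _ [L0 rL]] := hK.
pose f (x : M) : M := radial K x *: x.
have sub : D `<=` f @` esphere R n 1.
  move=> z Dz; have z1 := regular_boundary_gauge Dz.
  have ez : 0 < enorm z by rewrite enorm_gt0 gauge1_neq0.
  exists ((enorm z)^-1 *: z).
    by rewrite /esphere/= enormZ gtr0_norm ?invr_gt0// mulVf// gt_eqF.
  rewrite /f (radialZ n0 hK) ?invr_gt0// invrK scalerA mulrAC divff ?gt_eqF// mul1r.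
  by rewrite -(invrK (radial K z)) [(radial K z)^-1]z1 invr1 scale1r.
apply: (le_lt_trans (hausdorffS _ sub)).
have L1 : 0 < c^-1 + `|L0| by rewrite ltr_pwDl ?invr_gt0.
apply: (le_lt_trans (hausdorff_image _ L1 _)); last first.
  apply: lte_mul_pinfty => //; first by rewrite lee_fin exprn_ge0// ltW.
  by have := @hausdorff_sphere_lty R n 1; rewrite muln1 => /(_ n0).
move=> x y x1 y1; rewrite /f.
rewrite (_ : _ - _ = radial K x *: (x - y) + (radial K x - radial K y) *: y); last first.
  by rewrite scalerBr scalerBl addrA subrK.
rewrite (le_trans (enormD _ _))// !enormZ [enorm y]y1 mulr1 mulrDl lerD//.
  rewrite ler_wpM2r ?enorm_ge0// ger0_norm ?(radial_ge0 n0 hK)//.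
  rewrite -[radial K x]invrK lef_pV2 ?posrE ?(gauge_gt0 n0 hK)//.
    by have := cG x; rewrite [enorm x]x1 mulr1.
  by rewrite -enorm_gt0 [enorm x]x1.
by rewrite (le_trans (rL _ _ x1 y1))// ler_wpM2r ?enorm_ge0// ler_norm.
Qed.

Let gauge_scale t x h : 0 < t -> G (t *: x + h) - G (t *: x) = t * (G (x + t^-1 *: h) - G x).
Proof.
move=> t0; rewrite mulrBr -!(gaugeZ n0 hK) ?(ltW t0)// scalerDr scalerA divff ?scale1r//.
by rewrite gt_eqF.
Qed.

Lemma increasing_at_gaugeZ a t x : 0 < t -> increasing_at G a x -> increasing_at G a (t *: x).
Proof.
move=> t0 [k [j xP]]; exists k, (truncn (t / j.+1%:R)^-1) => s /andP[s0 st].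
rewrite gauge_scale// scalerA.
have st' : s < t / j.+1%:R.
  rewrite (lt_trans st)// -[ltRHS]invrK ltf_pV2 ?posrE ?invr_gt0 ?divr_gt0//.
  exact: truncnS_gt.
have /xP : 0 < t^-1 * s < j.+1%:R^-1.
  by rewrite mulr_gt0 ?invr_gt0//= ltr_pdivrMl.
by rewrite -mulrA ler_pdivrMl.
Qed.

Lemma diff_along_gaugeZ t x : 0 < t -> diff_along G setT x -> diff_along G setT (t *: x).
Proof.
move=> t0 /diff_along_gradient_at[A xA]; apply: (@gradient_at_diff_along _ _ _ _ A) => e e0.
have [d d0 dP] := xA e e0; exists (t * d); first by rewrite mulr_gt0.
move=> h _ hd; rewrite gauge_scale//.
have := dP (t^-1 *: h) I; rewrite enormZ gtr0_norm ?invr_gt0// ltr_pdivrMl// => /(_ hd).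
rewrite mdotZr mulrCA ler_pdivlMl// -(gtr0_norm t0) -normrM (gtr0_norm t0).
by rewrite mulrBr mulVKf ?gt_eqF.
Qed.

(* Otherwise almost every ray issued from the origin would consist of points
   where the gauge does not increase in the direction [a]; by Rademacher's
   theorem the gauge would then be bounded on a half-line directed by [a]. *)
Lemma regular_boundary_increasing a : a != 0 ->
  hausdorff n.-1 (D `&` increasing_at G a) <> 0%E.
Proof.
move=> a0 H0.
have [L L0 GL] := gauge_lipschitz n0 hK.
have [c c0 cG] := gauge_lower n0 hK.
have E0 : hausdorff (n * 1) (increasing_at G a `&` diff_along G setT) = 0%E.
  apply: (@hausdorff0_radial R n 1 (D `&` increasing_at G a) _ c^-1).
  - by rewrite muln1.
  - move=> z [/regular_boundary_gauge z1 _].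
    by rewrite -(ler_pM2l c0) divff ?gt_eqF// -z1.
  - move=> x [xa xd] x0; have Gx := gauge_gt0 n0 hK x0.
    exists (G x)^-1; first by rewrite invr_gt0.
    split; last by apply: increasing_at_gaugeZ => //; rewrite invr_gt0.
    rewrite regular_boundaryE; split; last by apply: diff_along_gaugeZ => //; rewrite invr_gt0.
    have iG : 0 <= (G x)^-1 by rewrite invr_ge0 ltW.
    by rewrite /= (gaugeZ n0 hK _ iG) mulVf// gt_eqF.
  - by rewrite muln1.
have [x xT] := null_increasing_at_line L0 GL n0 E0.
have ea : 0 < enorm a by rewrite enorm_gt0.
(* Large enough that |x + T a| >= T |a| - |x| > G x / c, so that linear growth beats G (x + T a) <=
   G x. *)
pose T := (G x / c + enorm x + 1) / enorm a.
have Gx := gauge_ge0 n0 hK x.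
have T0 : 0 < T.
  by rewrite divr_gt0// ltr_wpDl// addr_ge0 ?enorm_ge0// divr_ge0// ltW.
have := xT T T0; apply/negP; rewrite -ltNge; apply: (lt_le_trans _ (cG _)).
rewrite mulrC -ltr_pdivrMr//.
have := enormB (x + T *: a) x; rewrite [x + _ - x]addrC addKr enormZ gtr0_norm// {1}/T divfK ?gt_eqF//.
by set u := enorm (x + _); move: (G x / c) (enorm x) => b d; lra.
Qed.

(** Euler's identity for a function homogeneous of degree 1, at level 1. *)
Lemma mdot_gauge_gradient z : D z -> mdot z (gradient G z) = 1.
Proof.
move=> Dz; have z1 := regular_boundary_gauge Dz.
have := @gradient_derive R n G z z (regular_boundary_differentiable Dz).
rewrite mdotC => cv; apply: (norm_cvg_unique cv).
apply: cvg_near_cst.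
have : \forall t \near (0 : R)^', `|t| < 1.
  by apply: dnbhs0_lt.
have : \forall t \near (0 : R)^', t != 0 by exact: nbhs_dnbhs_neq.
apply: filterS2 => t t0 t1.
have -> : z + t *: z = (1 + t) *: z by rewrite scalerDl scale1r.
have t2 : 0 <= 1 + t by move: t1; rewrite ltr_norml -lerBlDl sub0r => /andP[/ltW].
by rewrite (gaugeZ n0 hK z t2) z1 mulr1 addrC addKr mulVf.
Qed.

(** The Lipschitz constant bounds the gradient above; Euler's identity and the boundedness of K
    bound it below. *)
Lemma gauge_gradient_bounds : exists2 c, 0 < c & forall z, D z ->
  c <= enorm (gradient G z) <= c^-1.
Proof.
have [L L0 GL] := gauge_lipschitz n0 hK.
have [c c0 cG] := gauge_lower n0 hK.
exists (minr c L^-1); first by rewrite lt_min c0 invr_gt0.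
move=> z Dz; have z1 := regular_boundary_gauge Dz.
have zA := mdot_gauge_gradient Dz; set A := gradient G z in zA *.
have ez : enorm z <= c^-1 by rewrite -[leRHS]mulr1 -z1 ler_pdivlMl.
have eA : c <= enorm A.
  rewrite -[leLHS]mulr1 -zA (le_trans (ler_wpM2l (ltW c0) (mdot_le _ _)))//.
  rewrite mulrA ler_piMl ?enorm_ge0// -(divff (lt0r_neq0 c0)) ler_pM2l//.
have A0 : 0 < enorm A by exact: lt_le_trans eA.
apply/andP; split; first by rewrite ge_min eA.
apply: (@le_trans _ _ L); last first.
  by rewrite -[leLHS]invrK lef_pV2 ?posrE ?invr_gt0// ?ge_min ?lexx ?orbT// lt_min c0 invr_gt0.
have cv := @gradient_derive R n G z A (regular_boundary_differentiable Dz).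
rewrite -(ler_pM2r A0) -expr2 sqr_enorm.
have nL : \forall t \near (0 : R)^', t^-1 * (G (z + t *: A) - G z) <= L * enorm A.
  have : \forall t \near (0 : R)^', t != 0 by exact: nbhs_dnbhs_neq.
  apply: filterS => t t0; rewrite (le_trans (ler_norm _))// normrM normfV.
  rewrite ler_pdivrMl ?normr_gt0// (le_trans (GL _ _))// (addrC z) addrK enormZ.
  by rewrite mulrCA.
exact: (cvgr_to_le cv nL).
Qed.

(** [radial K] is the reciprocal of the gauge, whose value is 1 here, so the two gradients are
    opposite. *)
Lemma outer_normalE z : D z ->
  outer_normal K z = (enorm (gradient G z))^-1 *: gradient G z.
Proof.
move=> Dz; have z1 := regular_boundary_gauge Dz.
have dG := regular_boundary_differentiable Dz.
suff E : radial_gradient K z = - gradient G z by rewrite /outer_normal E enormN scaleNr scalerN opprK.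
apply/colP => i; rewrite !mxE.
have -> : radial K = (fun x => (G x)^-1) by apply/funext => x; rewrite invrK.
have Gz0 : G z != 0 by rewrite z1 oner_neq0.
rewrite (diffV dG Gz0).
by rewrite z1 expr1n invr1 /= scaleN1r.
Qed.

Lemma enorm_outer_normal z : D z -> enorm (outer_normal K z) = 1.
Proof.
have [c c0 cA] := gauge_gradient_bounds => Dz; have /andP[A0 _] := cA _ Dz.
have {}A0 := lt_le_trans c0 A0.
by rewrite outer_normalE// enormZ gtr0_norm ?invr_gt0// mulVf// gt_eqF.
Qed.

(** By Euler's identity z . nu = 1 / |grad G|. *)
Lemma mdot_outer_normal_bounds : exists2 c, 0 < c & forall z, D z ->
  c <= mdot z (outer_normal K z) <= c^-1.
Proof.
have [c c0 cA] := gauge_gradient_bounds; exists c => // z Dz.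
have /andP[A1 A2] := cA _ Dz; have A0 := lt_le_trans c0 A1.
rewrite outer_normalE// mdotZr mdot_gauge_gradient// mulr1.
by rewrite -[c in c <= _]invrK !lef_pV2 ?posrE ?invr_gt0// A2.
Qed.

Lemma increasing_at_outer_normal a z : D z -> increasing_at G a z ->
  0 < mdot (outer_normal K z) a.
Proof.
have [c c0 cA] := gauge_gradient_bounds => Dz [k [j za]]; have /andP[A0 _] := cA _ Dz.
have {}A0 := lt_le_trans c0 A0.
rewrite outer_normalE// mdotZl mulr_gt0 ?invr_gt0//.
apply: (@lt_le_trans _ _ k.+1%:R^-1); first by rewrite invr_gt0.
have cv := @gradient_derive R n G z a (regular_boundary_differentiable Dz).
apply: (cvgr_to_ge (cvg_dnbhs_at_right cv)).
near=> t; have t0 : 0 < t by near: t; exact: nbhs_right_gt.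
rewrite ler_pdivlMl//; apply: za; rewrite t0/=.
by near: t; apply: nbhs_right_lt; rewrite invr_gt0.
Unshelve. all: by end_near. Qed.

(** The gradient is the pointwise limit of difference quotients with steps 1 / (q + 1), each
    continuous in z. *)
Lemma outer_normal_measurable s i j :
  measurable_fun (D : set (hausdorffMx R n 1 s)) (fun z => outer_normal K z i j).
Proof.
have mid : measurable_fun setT (id : hausdorffMx R n 1 s -> borelMx R n 1).
  exact: measurable_hausdorffMx.
have mA k l : measurable_fun (D : set (hausdorffMx R n 1 s)) (fun z => gradient G z k l).
  pose u (z : M) (t : R) : R := t^-1 * (G (z + t *: delta_mx k 0) - G z).
  apply: (@measurable_fun_cvg _ (hausdorffMx R n 1 s) R D (fun q z => u z q.+1%:R^-1)) => [q|z Dz].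
    have mG (c : R) : measurable_fun setT ((fun z => G (z + c *: delta_mx k 0)) : borelMx R n 1 -> R).
      have [L L0 GL] := gauge_lipschitz n0 hK.
      apply: continuous_mx_measurable; apply: (@enorm_lipschitz_continuous _ _ _ _ L) => // x y.
      by have := GL (x + c *: delta_mx k 0) (y + c *: delta_mx k 0); rewrite opprD addrACA subrr addr0.
    apply: (@measurable_funM _ (hausdorffMx R n 1 s) R D (cst (q.+1%:R^-1)^-1)
      (fun z => G (z + q.+1%:R^-1 *: delta_mx k 0) - G z)); first exact: measurable_cst.
    apply: measurable_funB.
      by apply: measurable_funTS; apply: measurableT_comp (mG _) mid.
    have := mG 0; rewrite (_ : (fun z => _) = G); last by apply/funext => z; rewrite scale0r addr0.
    by move=> mG0; apply: measurable_funTS; apply: measurableT_comp mG0 mid.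
  have := @gradient_derive R n G z (delta_mx k 0) (regular_boundary_differentiable Dz).
  rewrite mdot_delta ord1 => /cvg_dnbhs_at_right/cvg_at_rightP; apply; split=> [q|].
    by rewrite invr_gt0.
  exact: cvg_harmonic.
have mN : measurable_fun (D : set (hausdorffMx R n 1 s)) (fun z => enorm (gradient G z)).
  apply: (@measurable_mx_comp R n 1 _ (hausdorffMx R n 1 s) D (gradient G) _ R (@enorm R n 1)) => //.
  by apply: continuous_mx_measurable; exact: enorm_continuous.
have mf : measurable_fun (D : set (hausdorffMx R n 1 s))
    (fun z => enorm (gradient G z) `^ (-1) * gradient G z i j).
  apply: (@measurable_funM _ (hausdorffMx R n 1 s) R D) (mA i j).
  exact: (measurableT_comp (measurable_powR _) mN).
apply: eq_measurable_fun mf => z /set_mem Dz.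
by rewrite outer_normalE// [RHS]mxE powR_inv1 ?enorm_ge0.
Qed.

End regular_boundary.

(** * Support functions and balls *)

Section support_function.
Context {R : realType} {m : nat}.
Local Notation V := 'rV[R]_m.
Variable Q : set V.
Hypothesis hQ : convex_body_o Q.
Local Notation h := (supp_fun Q).

Lemma supp_fun_has_sup (w : V) : has_sup [set mdot w y | y in Q].
Proof.
have [cQ _ _ Q0] := hQ; have [B B0 QB] := compact_enorm_bounded cQ.
split; first by exists (mdot w 0), 0.
exists (enorm w * B) => _ [y Qy <-].
by rewrite (le_trans (mdot_le _ _))// ler_wpM2l ?enorm_ge0// QB.
Qed.

Lemma mdot_le_supp_fun (w y : V) : Q y -> mdot w y <= h w.
Proof. by move=> Qy; apply: ub_le_sup; [case: (supp_fun_has_sup w)|exists y]. Qed.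

Lemma supp_fun_ge0 (w : V) : 0 <= h w.
Proof. by have [_ _ _ Q0] := hQ; rewrite -(mdot0r w) mdot_le_supp_fun. Qed.

Lemma supp_fun_lipschitz : exists2 B, 0 < B &
  forall w w' : V, `|h w - h w'| <= B * enorm (w - w').
Proof.
have [cQ _ _ Q0] := hQ; have [B B0 QB] := compact_enorm_bounded cQ.
exists B => // w w'.
have half (u u' : V) : h u <= h u' + B * enorm (u - u').
  apply: ge_sup; first by case: (supp_fun_has_sup u).
  move=> _ [y Qy <-]; rewrite -(subrK u' u) mdotDl addrC subrK lerD//.
    exact: mdot_le_supp_fun.
  by rewrite (le_trans (mdot_le _ _))// mulrC ler_wpM2r ?enorm_ge0// QB.
rewrite ler_norml; have := half w w'; have := half w' w; rewrite (enormBC w').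
by move: (B * _) (h w) (h w') => a b c; lra.
Qed.

Lemma supp_fun_continuous : continuous h.
Proof. by have [B B0 hB] := supp_fun_lipschitz; exact: enorm_lipschitz_continuous hB. Qed.

(** A ball around an interior point y0 lies in Q; the estimate is centred at y0 since the origin may
    lie on the boundary of Q. *)
Lemma supp_fun_lower : exists2 c, 0 < c &
  exists y0 : V, forall w, mdot w y0 + c * enorm w <= h w.
Proof.
have [_ _ [y0 /nbhs_enormP[e e0 eQ]] _] := hQ.
exists (e / 2); first by rewrite divr_gt0.
exists y0 => w; have [->|w0] := eqVneq w 0.
  by rewrite mdot0l enorm0 mulr0 addr0 supp_fun_ge0.
have ew : 0 < enorm w by rewrite enorm_gt0.
have -> : mdot w y0 + e / 2 * enorm w = mdot w (y0 + (e / 2 / enorm w) *: w).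
  by rewrite mdotDr mdotZr -sqr_enorm; field; rewrite gt_eqF.
apply: mdot_le_supp_fun; apply: eQ.
rewrite addrC addKr enormZ gtr0_norm ?divr_gt0// divfK ?gt_eqF//.
by rewrite ltr_pdivrMr// ltr_pMr// ltr1n.
Qed.

End support_function.

Section ball.
Context {R : realType} {n : nat}.
Local Notation M := 'cV[R]_n.
Hypothesis n1 : (1 < n)%N.
Let n0 : (0 < n)%N := ltnW n1.

Definition oball (r : R) : set M := [set r *: x | x in eball R n 1].

Lemma oballE r : 0 < r -> oball r = [set x | enorm x <= r].
Proof.
move=> r0; apply/seteqP; split=> [_ [x x1 <-]|x /= xr].
  by rewrite /= enormZ gtr0_norm// ger_pMr.
exists (r^-1 *: x); last by rewrite scalerA divff ?scale1r// gt_eqF.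
by rewrite /eball/= enormZ gtr0_norm ?invr_gt0// ler_pdivrMl// mulr1.
Qed.

Lemma eball_oball : eball R n 1 = oball 1.
Proof. by rewrite oballE. Qed.

(** Also true at z = 0, where both the supremum and the quotient take the default value 0. *)
Lemma radial_oball r (z : M) : 0 < r -> radial (oball r) z = r / enorm z.
Proof.
move=> r0; rewrite /radial oballE//; have [->|z0] := eqVneq z 0.
  rewrite enorm0 invr0 mulr0 sup_out// => -[_ [b bub]].
  have : `|b| + 1 <= b.
    by apply: bub; split; rewrite ?addr_ge0//= scaler0 enorm0 ltW.
  by have := ler_norm b; lra.
have ez : 0 < enorm z by rewrite enorm_gt0.
rewrite (_ : mkset _ = `[0, r / enorm z]%classic) ?sup_itv//.
  by rewrite bnd_simp divr_ge0// ltW.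
apply/seteqP; split=> l /=; rewrite in_itv/= enormZ.
  by move=> [l0]; rewrite l0 ler_pdivlMr// ger0_norm.
by move=> /andP[l0]; rewrite ler_pdivlMr// ger0_norm.
Qed.

Lemma oball_star_body r : 0 < r -> lipschitz_star_body (oball r).
Proof.
move=> r0; have S1 (z : M) : esphere R n 1 z -> radial (oball r) z = r.
  by move=> z1; rewrite radial_oball// [enorm z]z1 divr1.
split.
- rewrite oballE//; apply: (@mx_closed_bounded_compact _ _ _ _ r) => //.
  apply: (@closed_comp _ _ (@enorm R n 1) [set x | x <= r]) => [x _|].
    exact: enorm_continuous.
  exact: closed_le.
- move=> z t; rewrite oballE//= => zr /andP[t0 t1].
  by rewrite enormZ ger0_norm// (le_trans _ zr)// ler_piMl// enorm_ge0.
- by move=> z z1; rewrite S1.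
- apply: (@subspace_eq_continuous _ _ _ (cst r)).
    by move=> z /set_mem z1; rewrite /from_subspace S1.
  exact: cst_continuous.
- by exists 0 => x y x1 y1; rewrite !S1// subrr normr0 mul0r.
Qed.

Lemma enorm_gradient_at (z : M) : z != 0 -> gradient_at (@enorm R n 1) z ((enorm z)^-1 *: z).
Proof.
move=> z0 e e0; have ez : 0 < enorm z by rewrite enorm_gt0.
exists (e * enorm z); first by rewrite mulr_gt0.
move=> h _ hd; rewrite mdotZl.
have eh := enorm_ge0 h.
have d1 : `|enorm (z + h) - enorm z| <= enorm h.
  by have := enorm_dist (z + h) z; rewrite [z + h - z]addrC addKr.
(* Expanding |z + h|^2 shows that the remainder lies between 0 and |h|^2 / (2 |z|), whence the scale
   e |z|. *)
have -> : enorm (z + h) - enorm z - (enorm z)^-1 * mdot z h =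
    (enorm h ^+ 2 - (enorm (z + h) - enorm z) ^+ 2) / (2 * enorm z).
  have : enorm (z + h) ^+ 2 = enorm z ^+ 2 + 2 * mdot z h + enorm h ^+ 2.
    by rewrite !sqr_enorm !mdotDl !mdotDr (mdotC h z); ring.
  move: (enorm (z + h)) (mdot z h) (enorm h) => b c d E.
  have -> : d ^+ 2 = b ^+ 2 - enorm z ^+ 2 - 2 * c by rewrite E; ring.
  by field; rewrite gt_eqF.
have d2 : (enorm (z + h) - enorm z) ^+ 2 <= enorm h ^+ 2.
  by rewrite -real_normK ?num_real// ler_sqr ?nnegrE.
rewrite ger0_norm; last by rewrite divr_ge0 ?subr_ge0// mulr_ge0// ltW.
rewrite ler_pdivrMr ?mulr_gt0//.
apply: (@le_trans _ _ (enorm h ^+ 2)); first by rewrite gerBl sqr_ge0.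
rewrite expr2 mulrAC ler_wpM2r// mulrCA.
by move: (ltW hd); have := mulr_gt0 e0 ez; move: (enorm h) (e * enorm z) => a b; lra.
Qed.

Lemma gauge_oball r : 0 < r -> gauge (oball r) = fun z : M => r^-1 * enorm z.
Proof. by move=> r0; apply/funext => z; rewrite /gauge radial_oball// invf_div mulrC. Qed.

Lemma regular_boundary_oball r : 0 < r -> regular_boundary (oball r) = [set z | enorm z = r].
Proof.
move=> r0; rewrite (regular_boundaryE n1 (oball_star_body r0)) gauge_oball//.
have E (z : M) : (r^-1 * enorm z = 1) <-> (enorm z = r).
  split=> [/(congr1 (fun x => r * x))|->]; last by rewrite mulVf// gt_eqF.
  by rewrite mulr1 mulVKf// gt_eqF.
apply/seteqP; split=> [z [/E]//|z zr]; split; first exact/E.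
have z0 : z != 0 by rewrite -enorm_gt0 zr.
apply: (@gradient_at_diff_along _ _ _ _ (r^-1 *: ((enorm z)^-1 *: z))) => e e0.
have [d d0 dP] := enorm_gradient_at z0 (mulr_gt0 r0 e0); exists d => // h _ hd.
rewrite mdotZl -!mulrBr normrM gtr0_norm ?invr_gt0// ler_pdivrMl// mulrA.
exact: dP.
Qed.

Lemma outer_normal_oball r (z : M) : 0 < r -> enorm z = r ->
  outer_normal (oball r) z = r^-1 *: z.
Proof.
move=> r0 zr; have z0 : z != 0 by rewrite -enorm_gt0 zr.
have Dz : regular_boundary (oball r) z by rewrite regular_boundary_oball.
rewrite (outer_normalE n1 (oball_star_body r0) Dz).
have -> : gradient (gauge (oball r)) z = r^-1 *: ((enorm z)^-1 *: z).
  apply: (gradient_at_differentiable _).2 => e e0; rewrite gauge_oball//.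
  have [d d0 dP] := enorm_gradient_at z0 (mulr_gt0 r0 e0); exists d => // h _ hd.
  rewrite mdotZl -!mulrBr normrM gtr0_norm ?invr_gt0// ler_pdivrMl// mulrA.
  exact: dP.
rewrite !enormZ !scalerA zr gtr0_norm ?invr_gt0//; congr (_ *: _).
by field; rewrite gt_eqF.
Qed.

Lemma mdot_outer_normal_oball r (z : M) : 0 < r -> enorm z = r ->
  mdot z (outer_normal (oball r) z) = r.
Proof.
move=> r0 zr; rewrite outer_normal_oball// mdotZr -sqr_enorm zr.
by rewrite expr2 mulKf// gt_eqF.
Qed.

End ball.

(** * Integrals over the regular boundary *)

Section bounded_integrands.
Context {R : realType} {n m : nat} (s : nat).
Local Notation M := 'M[R]_(n, m).
Local Notation mu := (@hausdorff_measure R n m s).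
Variable D : set M.
Hypotheses (mD : measurable (D : set (hausdorffMx R n m s)))
  (Doo : (hausdorff s D < +oo)%E).
Implicit Types f g : M -> R.

(** On a set of finite measure these functions are integrable and stable under sums and products, so
    real integrals can be manipulated without meeting the default value. *)
Definition bounded_measurable f :=
  measurable_fun (D : set (hausdorffMx R n m s)) f /\
  exists B, forall x, D x -> `|f x| <= B.

Lemma bounded_measurable_integrable f : bounded_measurable f ->
  mu.-integrable D (EFin \o f).
Proof.
move=> [mf [B fB]]; apply: measurable_bounded_integrable => //.
exists B; split; first exact: num_real.
by move=> C BC x Dx; exact: le_trans (fB x Dx) (ltW BC).
Qed.

Lemma bounded_measurable_cst (c : R) : bounded_measurable (fun=> c).
Proof. by split; [exact: measurable_cst|exists `|c|]. Qed.

Lemma bounded_measurableD f g : bounded_measurable f -> bounded_measurable g ->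
  bounded_measurable (fun x => f x + g x).
Proof.
move=> [mf [B fB]] [mg [C gC]]; split; first exact: measurable_funD.
by exists (B + C) => x Dx; rewrite (le_trans (ler_normD _ _))// lerD ?fB ?gC.
Qed.

Lemma bounded_measurableM f g : bounded_measurable f -> bounded_measurable g ->
  bounded_measurable (fun x => f x * g x).
Proof.
move=> [mf [B fB]] [mg [C gC]]; split; first exact: measurable_funM.
by exists (B * C) => x Dx; rewrite normrM ler_pM ?fB ?gC.
Qed.

Lemma hausdorff_integralD f g : bounded_measurable f -> bounded_measurable g ->
  hausdorff_integral s D (fun x => f x + g x) =
  hausdorff_integral s D f + hausdorff_integral s D g.
Proof. by move=> bf bg; apply: RintegralD => //; exact: bounded_measurable_integrable. Qed.

Lemma hausdorff_integralZ f c : bounded_measurable f ->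
  hausdorff_integral s D (fun x => c * f x) = c * hausdorff_integral s D f.
Proof. by move=> bf; apply: RintegralZl => //; exact: bounded_measurable_integrable. Qed.

Lemma le_hausdorff_integral f g : bounded_measurable f -> bounded_measurable g ->
  (forall x, D x -> f x <= g x) ->
  hausdorff_integral s D f <= hausdorff_integral s D g.
Proof. by move=> bf bg fg; apply: le_Rintegral => //; exact: bounded_measurable_integrable. Qed.

Lemma eq_hausdorff_integral f g : (forall x, D x -> f x = g x) ->
  hausdorff_integral s D f = hausdorff_integral s D g.
Proof. by move=> fg; apply: eq_Rintegral => x /set_mem; exact: fg. Qed.

Lemma hausdorff_integral_gt0 f (E : set M) : bounded_measurable f ->
  (forall x, D x -> 0 <= f x) -> E `<=` D -> hausdorff s E <> 0%E ->
  (forall x, E x -> 0 < f x) -> 0 < hausdorff_integral s D f.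
Proof.
move=> bf f0 ED E0 fE; have intf := bounded_measurable_integrable bf.
have i0 : 0 <= hausdorff_integral s D f.
  by apply: Rintegral_ge0 => x Dx; exact: f0.
rewrite lt_neqAle i0 andbT; apply/eqP => /esym fi0; apply: E0.
have : (\int[mu]_(x in D) `|(EFin \o f) x| = 0)%E.
  rewrite (@eq_integral _ (hausdorffMx R n m s) _ mu D (EFin \o f)); last first.
    by move=> x /set_mem Dx /=; rewrite ger0_norm ?f0.
  rewrite -[LHS]fineK ?integrable_fin_num//; congr EFin; exact: fi0.
move=> /ae_eq_integral_abs[]//; first exact/measurable_EFinP/bf.1.
move=> N [mN N0 sub]; apply: (@hausdorff0S R n m s _ N) => // x Ex.
apply: sub => /(_ (ED _ Ex)) [/eqP]; rewrite gt_eqF//; exact: fE.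
Qed.

End bounded_integrands.

Section normal_integral.
Context {R : realType} {n : nat}.
Local Notation M := 'cV[R]_n.
Variables (K : set M) (p : R).
Hypotheses (n1 : (1 < n)%N) (hK : lipschitz_star_body K) (p1 : 1 <= p).
Local Notation D := (regular_boundary K).
Local Notation nu := (outer_normal K).
Implicit Types psi : M -> R.

(** Integral of [psi] against the L_p surface area measure of K on the unit sphere; both S_p(K) and
    the projection function have this form. *)
Definition normal_integral psi : R := hausdorff_integral n.-1 D
  (fun z => psi (nu z) * mdot z (nu z) `^ (1 - p)).

Definition normal_weight (z : M) : R := mdot z (nu z) `^ (1 - p).

Let mD := regular_boundary_measurable n1 hK n.-1.
Let Doo := regular_boundary_lty n1 hK.

Lemma normal_weight_gt0 z : D z -> 0 < normal_weight z.
Proof.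
have [c c0 cb] := mdot_outer_normal_bounds n1 hK.
by move=> /cb/andP[cz _]; rewrite powR_gt0// (lt_le_trans c0).
Qed.

Lemma normal_weight_bounded_measurable : bounded_measurable n.-1 D normal_weight.
Proof.
split.
  apply: (measurableT_comp (measurable_powR _)).
  rewrite (_ : (fun _ => _) = fun z : M => \sum_i \sum_j z i j * nu z i j); last first.
    by apply/funext => z; exact: mdotE.
  apply: measurable_sum => i; apply: measurable_sum => j.
  apply: measurable_funM; last exact: outer_normal_measurable.
  have mid := @measurable_hausdorffMx R n 1 n.-1.
  by apply: measurable_funTS; apply: measurableT_comp (measurable_coord i j) mid.
have [c c0 cb] := mdot_outer_normal_bounds n1 hK.
(* The exponent 1 - p is nonpositive, so the lower bound of z . nu gives the upper bound of the
   weight. *)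
exists (c `^ (p - 1))^-1 => z Dz; have /andP[cz _] := cb _ Dz.
rewrite ger0_norm ?powR_ge0// /normal_weight -opprB powRN.
rewrite lef_pV2 ?posrE ?powR_gt0//; last exact: lt_le_trans cz.
rewrite ge0_ler_powR ?nnegrE ?subr_ge0//; first exact: ltW.
by rewrite (le_trans _ cz)// ltW.
Qed.

Definition sphere_bounded psi := measurable_fun setT (psi : borelMx R n 1 -> R) /\
  exists B, forall v, enorm v = 1 -> `|psi v| <= B.

Lemma sphere_bounded_normal psi : sphere_bounded psi ->
  bounded_measurable n.-1 D (fun z => psi (nu z)).
Proof.
move=> [mpsi [B psiB]]; split.
  apply: (@measurable_mx_comp R n 1 _ (hausdorffMx R n 1 n.-1) D nu _ R psi); last exact: mpsi.
  by move=> i j; exact: outer_normal_measurable.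
by exists B => z Dz; apply: psiB; exact: enorm_outer_normal.
Qed.

Lemma normal_integrand_bounded_measurable psi : sphere_bounded psi ->
  bounded_measurable n.-1 D (fun z => psi (nu z) * mdot z (nu z) `^ (1 - p)).
Proof.
move=> bpsi; apply: bounded_measurableM; first exact: sphere_bounded_normal.
exact: normal_weight_bounded_measurable.
Qed.

(** The boundary points where the gauge increases in the direction [a] are not null, and their
    normals satisfy v . a > 0; positivity of psi on that open hemisphere is therefore enough. *)
Lemma normal_integral_gt0 psi (a : M) : a != 0 -> sphere_bounded psi ->
  (forall v, enorm v = 1 -> 0 <= psi v) ->
  (forall v, enorm v = 1 -> 0 < mdot v a -> 0 < psi v) ->
  0 < normal_integral psi.
Proof.
move=> a0 bpsi psi0 psia; apply: (hausdorff_integral_gt0 mD Doo _ _ _ (regular_boundary_increasing n1 hK a0)).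
- exact: normal_integrand_bounded_measurable.
- by move=> z Dz; rewrite mulr_ge0 ?powR_ge0// psi0//; exact: enorm_outer_normal.
- exact: subIsetl.
- move=> z [Dz za]; apply: mulr_gt0; last exact: normal_weight_gt0.
  apply: psia; first exact: enorm_outer_normal.
  exact: increasing_at_outer_normal.
Qed.

Lemma sphere_bounded_cst c : sphere_bounded (fun=> c).
Proof. by split; [exact: measurable_cst|exists `|c|]. Qed.

Lemma Lp_surface_areaE : Lp_surface_area p K = normal_integral (fun=> 1).
Proof. by apply: eq_hausdorff_integral => z _; rewrite mul1r. Qed.

Lemma Lp_surface_area_gt0 : 0 < Lp_surface_area p K.
Proof.
rewrite Lp_surface_areaE.
apply: (@normal_integral_gt0 _ (delta_mx (Ordinal (ltnW n1)) 0)) => //; last exact: sphere_bounded_cst.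
by rewrite -enorm_gt0 enorm_delta.
Qed.

Lemma normal_integral_dist psi psi' (e : R) : sphere_bounded psi -> sphere_bounded psi' ->
  (forall v, enorm v = 1 -> `|psi v - psi' v| <= e) ->
  `|normal_integral psi - normal_integral psi'| <= e * Lp_surface_area p K.
Proof.
have half phi phi' : sphere_bounded phi -> sphere_bounded phi' ->
    (forall v, enorm v = 1 -> `|phi v - phi' v| <= e) ->
    normal_integral phi <= normal_integral phi' + e * Lp_surface_area p K.
  move=> bphi bphi' phie.
  rewrite /normal_integral /Lp_surface_area -(hausdorff_integralZ mD Doo); last first.
    exact: normal_weight_bounded_measurable.
  have b1 : bounded_measurable n.-1 D (fun z => e * mdot z (nu z) `^ (1 - p)).
    apply: bounded_measurableM; first exact: bounded_measurable_cst.
    exact: normal_weight_bounded_measurable.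
  have b2 := normal_integrand_bounded_measurable bphi'.
  have b0 := normal_integrand_bounded_measurable bphi.
  rewrite -(hausdorff_integralD mD Doo b2 b1).
  apply: (le_hausdorff_integral mD Doo b0 (bounded_measurableD b2 b1)).
  move=> z Dz; rewrite -mulrDl ler_wpM2r ?powR_ge0//.
  have := phie _ (enorm_outer_normal n1 hK Dz); rewrite ler_norml => /andP[_].
  by rewrite lerBlDl.
move=> bpsi bpsi' psie; rewrite ler_norml.
have h1 := half _ _ bpsi bpsi' psie.
have h2 := half _ _ bpsi' bpsi (fun v v1 => eq_ind _ (fun x => is_true (x <= e)) (psie v v1) _ (distrC _ _)).
move: h1 h2.
by move: (e * _) (normal_integral _) (normal_integral _) => a b c; lra.
Qed.

End normal_integral.

(** * Inequalities for real powers *)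

Section power_inequalities.
Context {R : realType}.
Implicit Types x s t p q M : R.

(** Write x^p = x exp((p - 1) ln x) and use exp y >= 1 + y and ln x >= 1 - 1 / x; the resulting
    bound is exactly affine in x. *)
Lemma powR_bernoulli p x : 1 <= p -> 0 <= x -> 1 + p * (x - 1) <= x `^ p.
Proof.
move=> p1; rewrite le_eqVlt => /predU1P[<-|x0].
  by rewrite powR0 ?gt_eqF ?(lt_le_trans ltr01)//; lra.
have lnx : 1 - x^-1 <= ln x.
  have := @le_ln1Dx R (x^-1 - 1); rewrite subrKC lnV//.
  have xV : 0 < x^-1 by rewrite invr_gt0.
  by move=> /(_ ltac:(lra)); lra.
have -> : x `^ p = x * x `^ (p - 1) by rewrite mulr_powRB1 ?ltW// (lt_le_trans ltr01).
apply: (@le_trans _ _ (x * (1 + (p - 1) * (1 - x^-1)))).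
  suff -> : x * (1 + (p - 1) * (1 - x^-1)) = 1 + p * (x - 1) by [].
  by field; rewrite gt_eqF.
rewrite ler_pM2l// /powR gt_eqF// (le_trans _ (expR_ge1Dx _))// lerD2l.
by rewrite ler_wpM2l// subr_ge0.
Qed.

(** Mean value estimate, obtained from Bernoulli's inequality at s / t. *)
Lemma powR_dist p M s t : 1 <= p -> 0 <= s <= M -> 0 <= t <= M ->
  `|s `^ p - t `^ p| <= p * M `^ (p - 1) * `|s - t|.
Proof.
move=> p1; wlog st : s t / s <= t.
  move=> H sM tM; case: (leP s t) => [/H|/ltW/H]; first exact.
  by rewrite distrC (distrC t); exact.
move=> /andP[s0 sM] /andP[t0 tM]; have p0 : 0 < p by rewrite (lt_le_trans ltr01).
rewrite distrC (distrC s) !ger0_norm ?subr_ge0//; last first.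
  by rewrite ge0_ler_powR ?nnegrE// ltW.
have [t00|] := eqVneq t 0.
  have -> : s = 0 by apply/eqP; rewrite eq_le s0 -t00 st.
  by rewrite t00 !subrr mulr0.
rewrite neq_lt ltNge t0/= => {}t0.
apply: (@le_trans _ _ (p * t `^ (p - 1) * (t - s))); last first.
  rewrite ler_wpM2r ?subr_ge0// ler_wpM2l ?(ltW p0)// ge0_ler_powR ?nnegrE ?subr_ge0 ?(ltW t0)//.
  exact: le_trans (ltW t0) tM.
have st0 : 0 <= s / t by rewrite divr_ge0// ltW.
have := powR_bernoulli p1 st0.
rewrite -(ler_pM2l (powR_gt0 p t0)) -powRM ?(ltW t0)//.
rewrite mulrCA divff ?gt_eqF// mulr1 -(mulr_powRB1 (ltW t0) p0).
suff -> : t * t `^ (p - 1) * (1 + p * (s / t - 1)) = t * t `^ (p - 1) - p * t `^ (p - 1) * (t - s).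
  by lra.
by field; rewrite gt_eqF.
Qed.

(** After division by s^q this is Bernoulli's inequality for a nonpositive exponent: exp y >= 1 + y,
    and ln x <= x - 1 reversed by q <= 0. *)
Lemma powR_tangent q s t : q <= 0 -> 0 < s -> 0 < t ->
  s `^ q + q * s `^ (q - 1) * (t - s) <= t `^ q.
Proof.
move=> q0 s0 t0; have ts : 0 < t / s by rewrite divr_gt0.
have -> : t `^ q = s `^ q * (t / s) `^ q.
  by rewrite -powRM ?ltW// mulrCA divff ?mulr1// gt_eqF.
have -> : s `^ (q - 1) = s `^ q / s.
  rewrite powRB; first by rewrite powRr1 ?ltW.
  by rewrite (gt_eqF s0) implybT.
suff H : 1 + q * (t / s - 1) <= (t / s) `^ q.
  apply: le_trans (ler_wpM2l (powR_ge0 s q) H).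
  suff -> : s `^ q * (1 + q * (t / s - 1)) = s `^ q + q * (s `^ q / s) * (t - s) by [].
  by field; rewrite gt_eqF.
rewrite /powR gt_eqF// (le_trans _ (expR_ge1Dx _))// lerD2l.
rewrite ler_wnM2l//; have := @le_ln1Dx R (t / s - 1); rewrite subrKC; apply.
by lra.
Qed.

End power_inequalities.

(** * The projection function *)

Section projection_function.
Context {R : realType} {n m : nat}.
Local Notation M := 'cV[R]_n.
Local Notation U := 'M[R]_(n, m).
Variables (K : set M) (p : R) (Q : set 'rV[R]_m).
Hypotheses (n1 : (1 < n)%N) (m0 : (0 < m)%N) (hK : lipschitz_star_body K)
  (p1 : 1 <= p) (hQ : convex_body_o Q).
Implicit Types (v : M) (u : U).

Lemma trmx_mulE v u i j : (v^T *m u) i j = mdot v (col j u).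
Proof.
rewrite mdotE mxE; apply: eq_bigr => k _.
by rewrite big_ord_recl big_ord0 addr0 !mxE !ord1.
Qed.

Lemma mdot_trmx_mul v u (y : 'rV[R]_m) : mdot (v^T *m u) y = mdot v (u *m y^T).
Proof. by rewrite /mdot -[LHS]mxtrace_tr trmx_mul trmxK mxtrace_mulC -mulmxA. Qed.

Lemma enorm_mulmx_trmx : exists2 C : R, 0 < C &
  forall v u, enorm (v^T *m u) <= C * enorm v * enorm u.
Proof.
exists ((1 * m)%:R * (n * 1)%:R); first by rewrite mul1n muln1 mulr_gt0 ?ltr0n ?(ltnW n1).
move=> v u; apply: (le_trans (@enorm_le_bound _ _ _ _ ((n * 1)%:R * enorm v * enorm u) _ _)).
- by rewrite !mulr_ge0 ?enorm_ge0.
- move=> i j; rewrite trmx_mulE (le_trans (normr_mdot_le _ _))// -mulrA mulrCA ler_wpM2l ?enorm_ge0//.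
  by apply: enorm_le_bound => [|k l]; rewrite ?enorm_ge0// mxE enorm_coord.
- by rewrite !mulrA.
Qed.

Definition proj_density u v : R := supp_fun Q (v^T *m u) `^ p.

(** This is F_K, the p-th power of the support function of the projection body: without the root it
    is linear in the surface area measure. *)
Definition proj_integral u : R := normal_integral K p (proj_density u).

Lemma supp_proj_bodyE u : supp_proj_body p Q K u = proj_integral u `^ p^-1.
Proof. by []. Qed.

Lemma proj_density_ge0 u v : 0 <= proj_density u v.
Proof. exact: powR_ge0. Qed.

Lemma supp_fun_mulmx_le : exists2 C : R, 0 < C &
  (forall v u u', enorm v = 1 ->
    `|supp_fun Q (v^T *m u) - supp_fun Q (v^T *m u')| <= C * enorm (u - u')) /\
  (forall v v' u, `|supp_fun Q (v^T *m u) - supp_fun Q (v'^T *m u)| <= C * enorm u * enorm (v - v')).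
Proof.
have [C C0 hC] := enorm_mulmx_trmx; have [B B0 hB] := supp_fun_lipschitz hQ.
exists (B * C); first exact: mulr_gt0.
split=> [v u u' v1|v v' u]; apply: (le_trans (hB _ _)); rewrite -!mulrA ler_pM2l//.
  by rewrite -mulmxBr (le_trans (hC _ _))// v1 mulr1.
by rewrite -mulmxBl -linearB/= (le_trans (hC _ _))// mulrAC mulrA.
Qed.

Lemma supp_fun0 : supp_fun Q 0 = 0.
Proof.
apply/eqP; rewrite eq_le supp_fun_ge0// andbT.
apply: ge_sup; first by case: (supp_fun_has_sup hQ 0).
by move=> _ [y _ <-]; rewrite mdot0l.
Qed.

Lemma supp_fun_mulmx_bound : exists2 C : R, 0 < C &
  forall v u, enorm v = 1 -> 0 <= supp_fun Q (v^T *m u) <= C * enorm u.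
Proof.
have [C C0 [hC _]] := supp_fun_mulmx_le; exists C => // v u v1.
rewrite supp_fun_ge0//=; have := hC v u 0 v1.
by rewrite mulmx0 supp_fun0 !subr0 => /(le_trans (ler_norm _)).
Qed.

Lemma proj_density_sphere_bounded u : sphere_bounded (proj_density u).
Proof.
have [C C0 [_ hC]] := supp_fun_mulmx_le.
have [C' C'0 hC'] := supp_fun_mulmx_bound.
split.
  have ch : continuous (fun v => supp_fun Q (v^T *m u)).
    apply: (@enorm_lipschitz_continuous _ _ _ _ (C * enorm u + 1)).
      by rewrite ltr_wpDl// mulr_ge0 ?enorm_ge0// ltW.
    by move=> v v'; rewrite (le_trans (hC _ _ _))// ler_wpM2r ?enorm_ge0// lerDl.
  exact: (measurableT_comp (measurable_powR p) (continuous_mx_measurable ch)).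
exists ((C' * enorm u) `^ p) => v v1; rewrite ger0_norm ?powR_ge0//.
have /andP[h0 h1] := hC' v u v1.
rewrite ge0_ler_powR ?nnegrE ?mulr_ge0 ?enorm_ge0 ?(ltW C'0)//.
exact: le_trans ler01 p1.
Qed.

(** The bound is local because t^p is controlled by [powR_dist] on bounded intervals. *)
Lemma proj_integral_lipschitz (r : R) : 0 <= r -> exists2 L : R, 0 <= L &
  forall u u', enorm u <= r -> enorm u' <= r ->
    `|proj_integral u - proj_integral u'| <= L * enorm (u - u').
Proof.
move=> r0; have [C C0 [hC _]] := supp_fun_mulmx_le.
have [C' C'0 hC'] := supp_fun_mulmx_bound.
have S0 := Lp_surface_area_gt0 n1 hK p1.
have p0 : 0 <= p by exact: le_trans ler01 p1.
exists (p * (C' * r) `^ (p - 1) * C * Lp_surface_area p K).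
  by rewrite !mulr_ge0 ?powR_ge0// ltW.
move=> u u' ur u'r; rewrite -mulrA (mulrC (Lp_surface_area _ _)) mulrA.
apply: (normal_integral_dist n1 hK p1 (proj_density_sphere_bounded u) (proj_density_sphere_bounded u')).
move=> v v1; have /andP[h0 h1] := hC' v u v1; have /andP[h0' h1'] := hC' v u' v1.
apply: (le_trans (@powR_dist _ _ (C' * r) _ _ p1 _ _)).
- by rewrite h0 (le_trans h1)// ler_pM2l.
- by rewrite h0' (le_trans h1')// ler_pM2l.
by rewrite -[leRHS]mulrA ler_wpM2l ?mulr_ge0 ?powR_ge0// hC.
Qed.

Lemma proj_integral_continuous : continuous proj_integral.
Proof.
move=> u0; have [L L0 hL] := @proj_integral_lipschitz (enorm u0 + 1) ltac:(by rewrite addr_ge0 ?enorm_ge0).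
apply/(@cvgrPdist_le R R^o _ (nbhs u0) (nbhs_filter u0)) => e e0.
have L1 : 0 < L + 1 by rewrite ltr_wpDl.
apply/nbhs_enormP; exists (minr 1 (e / (L + 1))); first by rewrite lt_min ltr01 divr_gt0.
move=> u; rewrite lt_min => /andP[d1 d2] /=.
have d0 := enorm_ge0 (u - u0).
rewrite distrC (le_trans (hL _ _ _ _))//.
- have := enormD (u - u0) u0; rewrite subrK; lra.
- by rewrite lerDl.
- move: d2; rewrite ltr_pdivlMr// mulrC mulrDl mul1r; lra.
Qed.

(* If [Q] lies on the side of the origin of its interior point [y0], the
   direction [u *m y0^T] works; otherwise any nonzero column of [u] does. *)
Lemma proj_integral_gt0 u : u != 0 -> 0 < proj_integral u.
Proof.
move=> u0; have [c c0 [y0 hl]] := supp_fun_lower hQ.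
suff [a [a0 aP]] : exists a, a != 0 /\
    forall v, 0 < mdot v a -> 0 < supp_fun Q (v^T *m u).
  apply: (normal_integral_gt0 n1 hK p1 a0 (proj_density_sphere_bounded u)).
    by move=> v _; exact: proj_density_ge0.
  by move=> v v1 va; rewrite powR_gt0// aP.
have [uy|uy] := eqVneq (u *m y0^T) 0; last first.
  exists (u *m y0^T); split=> // v va; apply: lt_le_trans (hl _).
  by rewrite mdot_trmx_mul ltr_pwDl// mulr_ge0 ?enorm_ge0// ltW.
have [i [j uij]] : exists i j, u i j != 0.
  apply: contrapT => H; move/eqP: u0; apply; apply/matrixP => i j; rewrite mxE.
  by apply: contrapT => /eqP uij; apply: H; exists i, j.
exists (col j u); split.
  by apply: contraNneq uij => /matrixP/(_ i 0); rewrite !mxE => ->.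
move=> v va; apply: lt_le_trans (hl _).
rewrite mdot_trmx_mul uy mdot0r add0r mulr_gt0// enorm_gt0.
apply: contraTneq va => /matrixP/(_ 0 j); rewrite trmx_mulE mxE => ->.
by rewrite ltxx.
Qed.

Lemma esphere_neq0 u : esphere R n m u -> u != 0.
Proof. by move=> u1; rewrite -enorm_gt0 [enorm u]u1. Qed.

(** Continuity, positivity and compactness; both bounds are needed because powers of either sign are
    integrated. *)
Lemma proj_integral_bounds : exists2 c, 0 < c &
  forall u, esphere R n m u -> c <= proj_integral u <= c^-1.
Proof.
have S0 : esphere R n m !=set0.
  apply/set0P; apply/eqP => S0; have := @hausdorff_sphere_gt0 R n m.
  by rewrite S0 hausdorff0 ltxx => /(_ (leq_trans n1 (leq_pmulr n m0))).
have wc : {within esphere R n m, continuous proj_integral}.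
  exact: continuous_subspaceT proj_integral_continuous.
have [a aS amin] := compact_EVT_min S0 esphere_compact wc.
have [b bS bmax] := compact_EVT_max S0 esphere_compact wc.
have a0 := proj_integral_gt0 (esphere_neq0 (set_mem aS)).
have b0 := proj_integral_gt0 (esphere_neq0 (set_mem bS)).
have ab (x y z : R) : 0 < x -> 0 < y -> x <= z -> z <= y ->
    minr x y^-1 <= z <= (minr x y^-1)^-1.
  move=> x0 y0 xz zy; rewrite ge_min xz/= (le_trans zy)// -[leLHS]invrK.
  by rewrite lef_pV2 ?posrE ?invr_gt0 ?lt_min ?x0 ?invr_gt0// ge_min lexx orbT.
exists (minr (proj_integral a) (proj_integral b)^-1); first by rewrite lt_min a0 invr_gt0 b0.
by move=> u u1; apply: ab a0 b0 (amin u (mem_set u1)) (bmax u (mem_set u1)).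
Qed.

Lemma proj_integral_bounded_measurable :
  bounded_measurable (n * m).-1 (esphere R n m) proj_integral.
Proof.
split.
  have mid := @measurable_hausdorffMx R n m (n * m).-1.
  have mF := continuous_mx_measurable proj_integral_continuous.
  by apply: measurable_funTS; apply: measurableT_comp mF mid.
have [c c0 cF] := proj_integral_bounds; exists c^-1 => u /cF/andP[F1 F2].
by rewrite ger0_norm// (le_trans (ltW c0)).
Qed.

Lemma proj_integral_powR_bounded_measurable q :
  bounded_measurable (n * m).-1 (esphere R n m) (fun u => proj_integral u `^ q).
Proof.
split; first exact: (measurableT_comp (measurable_powR q) proj_integral_bounded_measurable.1).
have [c c0 cF] := proj_integral_bounds.
have [q0|q0] := leP 0 q.
  exists (c^-1 `^ q) => u /cF/andP[F1 F2]; have F0 := lt_le_trans c0 F1.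
  by rewrite ger0_norm ?powR_ge0// ge0_ler_powR ?nnegrE ?(ltW F0) ?invr_ge0 ?(ltW c0).
exists (c `^ (- q))^-1 => u /cF/andP[F1 F2]; have F0 := lt_le_trans c0 F1.
rewrite ger0_norm ?powR_ge0// -[X in _ `^ X <= _]opprK (powRN _ (- q)) lef_pV2 ?posrE ?powR_gt0//.
by rewrite ge0_ler_powR ?nnegrE ?(ltW F0) ?(ltW c0)// oppr_ge0 ltW.
Qed.

End projection_function.

(** * Rotation invariance *)

(** Codimension-one Hausdorff measures are not sigma-finite on the whole space; restricted to the
    sets [A] and [B] of finite measure they are finite, and Tonelli applies. *)
Lemma fubini_tonelli_on d1 d2 (T1 : measurableType d1) (T2 : measurableType d2)
    (R : realType) (m1 : {measure set T1 -> \bar R}) (m2 : {measure set T2 -> \bar R})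
    (A : set T1) (B : set T2) (f : T1 * T2 -> \bar R) :
  measurable A -> measurable B -> (m1 A < +oo)%E -> (m2 B < +oo)%E ->
  measurable_fun (A `*` B) f -> (forall z, (A `*` B) z -> 0 <= f z)%E ->
  (\int[m1]_(x in A) \int[m2]_(y in B) f (x, y) =
   \int[m2]_(y in B) \int[m1]_(x in A) f (x, y))%E.
Proof.
move=> mA mB Aoo Boo mf f0.
pose n1 : {finite_measure set T1 -> \bar R} := mfrestr mA Aoo.
pose n2 : {finite_measure set T2 -> \bar R} := mfrestr mB Boo.
pose g := f \_ (A `*` B).
have mg : measurable_fun setT g.
  by apply/(measurable_restrictT _ (measurableX mA mB)).
have g0 z : (0 <= g z)%E.
  by rewrite /g patchE; case: ifPn => // /set_mem/f0.
have n1E (h : T1 -> \bar R) : (\int[n1]_(x in A) h x = \int[m1]_(x in A) h x)%E.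
  apply: eq_measure_integral => C mC CA.
  by rewrite /n1/= /mfrestr/= /mrestr setIidl.
have n2E (h : T2 -> \bar R) : (\int[n2]_(x in B) h x = \int[m2]_(x in B) h x)%E.
  apply: eq_measure_integral => C mC CB.
  by rewrite /n2/= /mfrestr/= /mrestr setIidl.
have L x : (\int[n2]_y g (x, y) = ((fun x => \int[m2]_(y in B) f (x, y)) \_ A) x)%E.
  rewrite patchE; case: ifPn => xA.
    rewrite -n2E [RHS]integral_mkcond; apply: eq_integral => y _.
    by rewrite /g !patchE in_setX xA.
  by apply: integral0_eq => y _; rewrite /g patchE in_setX (negbTE xA).
have L' y : (\int[n1]_x g (x, y) = ((fun y => \int[m1]_(x in A) f (x, y)) \_ B) y)%E.
  rewrite patchE; case: ifPn => yB.
    rewrite -n1E [RHS]integral_mkcond; apply: eq_integral => x _.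
    by rewrite /g !patchE in_setX yB andbT.
  by apply: integral0_eq => x _; rewrite /g patchE in_setX (negbTE yB) andbF.
rewrite -n1E -n2E.
transitivity (\int[n1]_x \int[n2]_y g (x, y))%E.
  by rewrite [LHS]integral_mkcond; apply: eq_integral => x _; rewrite L.
rewrite (@fubini_tonelli _ _ _ _ _ n1 n2 g mg g0).
by rewrite [RHS]integral_mkcond; apply: eq_integral => y _; rewrite L'.
Qed.

Section hausdorff_fubini.
Context {R : realType} {n m k l : nat} (s t : nat).
Variables (A : set 'M[R]_(n, m)) (B : set 'M[R]_(k, l)) (f : 'M[R]_(n, m) -> 'M[R]_(k, l) -> R).
Hypotheses (mA : measurable (A : set (hausdorffMx R n m s)))
  (mB : measurable (B : set (hausdorffMx R k l t)))
  (Aoo : (hausdorff s A < +oo)%E) (Boo : (hausdorff t B < +oo)%E)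
  (mf : measurable_fun (A `*` B : set (hausdorffMx R n m s * hausdorffMx R k l t))
    (fun z => f z.1 z.2))
  (f0 : forall x y, A x -> B y -> 0 <= f x y)
  (bfl : forall x, A x -> bounded_measurable t B (f x))
  (bfr : forall y, B y -> bounded_measurable s A (f^~ y)).

Lemma hausdorff_fubini :
  hausdorff_integral s A (fun x => hausdorff_integral t B (f x)) =
  hausdorff_integral t B (fun y => hausdorff_integral s A (f^~ y)).
Proof.
have := @fubini_tonelli_on _ _ (hausdorffMx R n m s) (hausdorffMx R k l t) R
  (@hausdorff_measure R n m s) (@hausdorff_measure R k l t) A B (fun z => (f z.1 z.2)%:E)
  mA mB Aoo Boo.
move=> /(_ _ _)/(congr1 fine) H.
rewrite /hausdorff_integral /Rintegral.
transitivity (fine (\int[@hausdorff_measure R n m s]_(x in A)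
    \int[@hausdorff_measure R k l t]_(y in B) (f x y)%:E)%E).
  (* Bounded sections have finite integrals, so the inner [fine] loses nothing. *)
  congr fine; apply: eq_integral => x /set_mem Ax; rewrite fineK//.
  apply: integrable_fin_num => //.
  exact: (bounded_measurable_integrable mB Boo (bfl Ax)).
rewrite H.
- congr fine; apply: eq_integral => y /set_mem By; rewrite fineK//.
  apply: integrable_fin_num => //.
  exact: (bounded_measurable_integrable mA Aoo (bfr By)).
- exact/measurable_EFinP.
- by move=> [x y] [Ax By]; rewrite lee_fin f0.
Qed.

End hausdorff_fubini.

Section rotations.
Context {R : realType} {n : nat}.

Definition orthogonal_mx (H : 'M[R]_n) := H^T *m H = 1%:M /\ H *m H^T = 1%:M.

Lemma orthogonal_mx_tr H : orthogonal_mx H -> orthogonal_mx H^T.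
Proof. by move=> [h1 h2]; split; rewrite trmxK. Qed.

Lemma enorm_orthogonal m H (x : 'M[R]_(n, m)) : orthogonal_mx H ->
  enorm (H *m x) = enorm x.
Proof.
by move=> [h _]; rewrite /enorm /mdot trmx_mul mulmxA -(mulmxA _ _ H) h mulmx1.
Qed.

(* The reflection in the hyperplane orthogonal to [v - v']. *)
Lemma exists_orthogonal_mx (v v' : 'cV[R]_n) : enorm v = 1 -> enorm v' = 1 ->
  exists2 H, orthogonal_mx H & H *m v = v'.
Proof.
move=> v1 v'1; have [->|vv'] := eqVneq v v'.
  by exists 1%:M; [split; rewrite trmx1 mulmx1|rewrite mul1mx].
pose a := v - v'; have a0 : mdot a a != 0.
  by rewrite -sqr_enorm sqrf_eq0 enorm_eq0 subr_eq0.
pose H : 'M[R]_n := 1%:M - (2 / mdot a a) *: (a *m a^T).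
have HE m (x : 'M[R]_(n, m)) : H *m x = x - (2 / mdot a a) *: (a *m (a^T *m x)).
  by rewrite mulmxBl mul1mx -scalemxAl mulmxA.
have HT : H^T = H.
  by rewrite /H linearB/= linearZ/= trmx_mul trmxK trmx1.
have aa : a^T *m a = (mdot a a)%:M by rewrite [LHS]mx11_scalar -trace_mx11.
have HH : H *m H = 1%:M.
  rewrite HE [a^T *m H]mulmxBr mulmx1 -scalemxAr mulmxA aa mul_scalar_mx scalerA.
  rewrite mulfVK// scaler_nat mulr2n opprD addrA subrr sub0r mulmxN scalerN opprK.
  by rewrite subrK.
(* Equal lengths of v and v' make the reflection send v to v - a = v'. *)
have aa2 : mdot a a = 2 * mdot a v.
  have := sqr_enorm v; have := sqr_enorm v'; rewrite v1 v'1 expr1n => h1 h2.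
  by rewrite /a !(mdotDl, mdotDr, mdotNl, mdotNr) -h1 -h2 (mdotC v' v); ring.
exists H; first by rewrite /orthogonal_mx HT.
rewrite HE [a^T *m v]mx11_scalar -trace_mx11 -/(mdot a v) mul_mx_scalar scalerA.
rewrite mulrAC -aa2 divff// scale1r /a opprB addrC subrK.
by [].
Qed.

End rotations.

Lemma hausdorff_integral_orthogonal {R : realType} {n m : nat} (s : nat) (H : 'M[R]_n)
    (D : set 'M[R]_(n, m)) (phi : 'M[R]_(n, m) -> R) : orthogonal_mx H ->
  measurable (D : set (hausdorffMx R n m s)) ->
  measurable_fun (D : set (hausdorffMx R n m s)) phi ->
  (forall x, D x -> 0 <= phi x) -> (forall x, D (H *m x) <-> D x) ->
  hausdorff_integral s D phi = hausdorff_integral s D (fun x => phi (H *m x)).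
Proof.
move=> oH mD mphi phi0 HD; have [h1 h2] := oH.
rewrite (@hausdorff_integral_similarity R n m s 1 (mulmx H) (mulmx H^T) ltr01 _ _ _ D phi mD mphi phi0).
- rewrite expr1n mul1r (_ : mulmx H @^-1` D = D)//.
  by apply/seteqP; split=> x /HD.
- by move=> x; rewrite mulmxA h1 mul1mx.
- by move=> x; rewrite mulmxA h2 mul1mx.
- by move=> x y; rewrite -mulmxBr enorm_orthogonal// mul1r.
Qed.

Lemma normal_integral_oballE {R : realType} {n : nat} (p r : R) (psi : 'cV[R]_n -> R) :
  (1 < n)%N -> 0 < r ->
  normal_integral (oball r) p psi = hausdorff_integral n.-1 [set z : 'cV[R]_n | enorm z = r]
    (fun z => psi (r^-1 *: z) * r `^ (1 - p)).
Proof.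
move=> n1 r0; rewrite /normal_integral (regular_boundary_oball n1 r0).
apply: eq_hausdorff_integral => z zr.
by rewrite (mdot_outer_normal_oball n1 r0 zr) (outer_normal_oball n1 r0 zr).
Qed.

Section rotation_invariance.
Context {R : realType} {n m : nat}.
Local Notation M := 'cV[R]_n.
Local Notation U := 'M[R]_(n, m).
Variables (p : R) (Q : set 'rV[R]_m).
Hypotheses (n1 : (1 < n)%N) (m0 : (0 < m)%N) (p1 : 1 <= p) (hQ : convex_body_o Q).
Local Notation S := (esphere R n m).
Local Notation s := (n * m).-1.

Let nm1 : (1 < n * m)%N. Proof. exact: leq_trans n1 (leq_pmulr n m0). Qed.
Let mS : measurable (S : set (hausdorffMx R n m s)).
Proof. apply: borel_hausdorff_measurable; apply: closed_mx_measurable; exact: esphere_closed. Qed.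
Let Soo : (hausdorff s S < +oo)%E. Proof. exact: hausdorff_sphere_lty (ltnW nm1). Qed.

Lemma proj_density_measurable u (D : set M) :
  measurable_fun (D : set (hausdorffMx R n 1 n.-1)) (proj_density p Q u).
Proof.
have [mf _] := proj_density_sphere_bounded n1 m0 p1 hQ u.
have mid := @measurable_hausdorffMx R n 1 n.-1.
by apply: measurable_funTS; apply: measurableT_comp mf mid.
Qed.

(** Since v^T (H u) = (H^T v)^T u, a rotation of [u] amounts to a rotation of the normals of the
    ball, which preserves the measure of the sphere. *)
Lemma proj_integral_ball_orthogonal (H : 'M[R]_n) (u : U) : orthogonal_mx H ->
  proj_integral (oball 1) p Q (H *m u) = proj_integral (oball 1) p Q u.
Proof.
move=> oH; rewrite /proj_integral (normal_integral_oballE p (proj_density p Q (H *m u)) n1 ltr01).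
rewrite (normal_integral_oballE p (proj_density p Q u) n1 ltr01).
have E (u' : U) z : proj_density p Q u' (1^-1 *: z) * 1 `^ (1 - p) = proj_density p Q u' z.
  by rewrite invr1 scale1r powR1 mulr1.
rewrite (eq_hausdorff_integral _ (g := proj_density p Q (H *m u))); last by move=> z _; exact: E.
rewrite (eq_hausdorff_integral _ (f := fun z => _ * _) (g := proj_density p Q u)); last by move=> z _; exact: E.
rewrite (hausdorff_integral_orthogonal (orthogonal_mx_tr oH) (phi := proj_density p Q u)).
- by apply: eq_hausdorff_integral => z _; rewrite /proj_density trmx_mul trmxK mulmxA.
- apply: borel_hausdorff_measurable; apply: closed_mx_measurable; exact: esphere_closed.
- exact: proj_density_measurable.
- by move=> z _; exact: proj_density_ge0.
- by move=> z /=; rewrite enorm_orthogonal//; exact: orthogonal_mx_tr.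
Qed.

Lemma proj_density_bounded_measurable (v : M) : enorm v = 1 ->
  bounded_measurable s S (fun u => proj_density p Q u v).
Proof.
move=> v1; have [C C0 [hC _]] := supp_fun_mulmx_le (n := n) n1 m0 hQ.
have [C' C'0 hC'] := supp_fun_mulmx_bound (n := n) n1 m0 hQ.
split.
  have ch : continuous (fun u : U => supp_fun Q (v^T *m u)).
    by apply: (@enorm_lipschitz_continuous _ _ _ _ C) => // u u'; exact: hC.
  have mf := measurableT_comp (measurable_powR p) (continuous_mx_measurable ch).
  have mid := @measurable_hausdorffMx R n m s.
  by apply: measurable_funTS; apply: measurableT_comp mf mid.
exists (C' `^ p) => u u1; rewrite ger0_norm ?powR_ge0//.
have /andP[h0 h1] := hC' v u v1.
rewrite ge0_ler_powR ?nnegrE ?(ltW C'0) ?(le_trans ler01 p1)//.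
by rewrite (le_trans h1)// [enorm u]u1 mulr1.
Qed.

Section weight.
Variable w : U -> R.
Hypotheses (bw : bounded_measurable s S w) (w0 : forall u, S u -> 0 <= w u)
  (wH : forall H u, orthogonal_mx H -> w (H *m u) = w u).

Definition sphere_average (v : M) : R :=
  hausdorff_integral s S (fun u => w u * proj_density p Q u v).

Lemma sphere_average_eq (v v' : M) : enorm v = 1 -> enorm v' = 1 ->
  sphere_average v = sphere_average v'.
Proof.
move=> v1 v'1; have [H oH <-] := exists_orthogonal_mx v1 v'1.
have [mf _] := bounded_measurableM bw (proj_density_bounded_measurable v1).
have f0 u : S u -> 0 <= w u * proj_density p Q u v.
  by move=> Su; rewrite mulr_ge0 ?w0// proj_density_ge0.
have HS u : S (H^T *m u) <-> S u.
  by rewrite /esphere/= enorm_orthogonal//; exact: orthogonal_mx_tr.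
apply: (etrans (hausdorff_integral_orthogonal (orthogonal_mx_tr oH) mS mf f0 HS)).
apply: eq_hausdorff_integral => u _; rewrite wH; last exact: orthogonal_mx_tr.
by rewrite /proj_density trmx_mul mulmxA.
Qed.

Lemma weighted_proj_integral K (v : M) : lipschitz_star_body K -> enorm v = 1 ->
  hausdorff_integral s S (fun u => w u * proj_integral K p Q u) =
  sphere_average v * Lp_surface_area p K.
Proof.
move=> hK v1.
have mD := regular_boundary_measurable n1 hK n.-1.
have Doo := regular_boundary_lty n1 hK.
have bom := normal_weight_bounded_measurable n1 hK p1.
set D := regular_boundary K in mD Doo bom.
pose T : measurableType _ := (hausdorffMx R n m s * hausdorffMx R n 1 n.-1)%type.
pose f (u : U) (z : M) := w u * (proj_density p Q u (outer_normal K z) * normal_weight K p z).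
have bdens u : bounded_measurable n.-1 D
    (fun z => proj_density p Q u (outer_normal K z) * normal_weight K p z).
  apply: bounded_measurableM bom.
  by apply: (sphere_bounded_normal n1 hK); exact: proj_density_sphere_bounded.
transitivity (hausdorff_integral s S (fun u => hausdorff_integral n.-1 D (f u))).
  by apply: eq_hausdorff_integral => u _; rewrite (hausdorff_integralZ mD Doo (w u) (bdens u)).
rewrite (@hausdorff_fubini R n m n 1 s n.-1 S D f mS mD Soo Doo).
- rewrite -(hausdorff_integralZ mD Doo _ bom); apply: eq_hausdorff_integral => z Dz.
  have nz := enorm_outer_normal n1 hK Dz.
  rewrite (sphere_average_eq v1 nz) mulrC -(hausdorff_integralZ mS Soo).
    by apply: eq_hausdorff_integral => u _; rewrite /f mulrA mulrC.
  by apply: bounded_measurableM bw (proj_density_bounded_measurable nz).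
- have m1 : measurable_fun (S `*` D : set T) (fst : T -> hausdorffMx R n m s).
    by apply: measurable_funTS; exact: measurable_fst.
  have m2 : measurable_fun (S `*` D : set T) (snd : T -> hausdorffMx R n 1 n.-1).
    by apply: measurable_funTS; exact: measurable_snd.
  have mw : measurable_fun (S `*` D : set T) (fun z : T => w z.1).
    by apply: (measurable_comp mS _ bw.1 m1) => _ [[u z] [Su _] <-].
  have mom : measurable_fun (S `*` D : set T) (fun z : T => normal_weight K p z.2).
    by apply: (measurable_comp mD _ bom.1 m2) => _ [[u z] [_ Dz] <-].
  (* The normal is only known to be measurable in z, so joint measurability is checked on the
     entries of the matrix product and then composed with the continuous support function. *)
  apply: (measurable_funM mw (measurable_funM _ mom)).
  have mh : measurable_fun setT ((fun x => supp_fun Q x `^ p) : borelMx R 1 m -> R).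
    apply: (measurableT_comp (measurable_powR p)); apply: continuous_mx_measurable.
    exact: supp_fun_continuous.
  apply: (@measurable_mx_comp R 1 m _ T (S `*` D) (fun z => (outer_normal K z.2)^T *m z.1) _ R _ _ mh).
  move=> i j; rewrite (_ : (fun z => _) =
    (fun z : T => \sum_k outer_normal K z.2 k i * (z.1 : U) k j)); last first.
    by apply/funext => z; rewrite mxE; apply: eq_bigr => k _; rewrite mxE.
  apply: measurable_sum => k; apply: measurable_funM.
    have mnu := @outer_normal_measurable R n K n1 hK n.-1 k i.
    by apply: (measurable_comp mD _ mnu m2) => _ [[u z] [_ Dz] <-].
  have mid := @measurable_hausdorffMx R n m s.
  exact: (measurableT_comp (measurable_coord k j) (measurableT_comp mid m1)).
- by move=> u z Su Dz; rewrite !mulr_ge0 ?w0 ?powR_ge0.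
- by move=> u Su; apply: bounded_measurableM (bdens u); exact: bounded_measurable_cst.
- move=> z Dz; apply: bounded_measurableM bw _.
  apply: bounded_measurableM; last exact: bounded_measurable_cst.
  by apply: proj_density_bounded_measurable; exact: enorm_outer_normal Dz.
Qed.

End weight.

End rotation_invariance.

(** * The inequality *)

(** Dilation of the unit sphere contributes r^(n-1) to the measure, and z . nu = r contributes
    r^(1-p) to the weight. *)
Lemma normal_integral_oball {R : realType} {n : nat} (p r : R) (psi : 'cV[R]_n -> R) :
  (1 < n)%N -> 0 < r -> sphere_bounded psi -> (forall v, enorm v = 1 -> 0 <= psi v) ->
  normal_integral (oball r) p psi = r ^+ n.-1 * r `^ (1 - p) * normal_integral (oball 1) p psi.
Proof.
move=> n1 r0 [mpsi [B psiB]] psi0.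
rewrite (normal_integral_oballE p psi n1 r0) (normal_integral_oballE p psi n1 ltr01).
have mS a : measurable ([set z | enorm z = a] : set (hausdorffMx R n 1 n.-1)).
  apply: borel_hausdorff_measurable; apply: closed_mx_measurable.
  apply: (@closed_comp _ _ (@enorm R n 1) [set a]) => [z _|]; last exact: closed_eq.
  exact: enorm_continuous.
have mid := @measurable_hausdorffMx R n 1 n.-1.
have mphi : measurable_fun ([set z | enorm z = r] : set (hausdorffMx R n 1 n.-1))
    (fun z => psi (r^-1 *: z) * r `^ (1 - p)).
  apply: (measurable_funM _ (measurable_cst _)).
  apply: (@measurable_mx_comp R n 1 _ (hausdorffMx R n 1 n.-1) _ (fun z => r^-1 *: z) _ R _ _ mpsi).
  move=> i j; rewrite (_ : (fun z => _) = (fun z : 'cV[R]_n => r^-1 * z i j)); last first.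
    by apply/funext => z; rewrite mxE.
  apply: (measurable_funM (measurable_cst _)).
  by apply: measurable_funTS; apply: measurableT_comp (measurable_coord i j) mid.
have phi0 (z : 'cV[R]_n) : enorm z = r -> 0 <= psi (r^-1 *: z) * r `^ (1 - p).
  move=> zr; rewrite mulr_ge0 ?powR_ge0// psi0//.
  by rewrite enormZ zr gtr0_norm ?invr_gt0// mulVf// gt_eqF.
have r1 : r != 0 by rewrite gt_eqF.
rewrite (@hausdorff_integral_similarity R n 1 n.-1 r (fun z => r *: z) (fun z => r^-1 *: z)
  r0 _ _ _ _ _ (mS r) mphi phi0).
- rewrite -mulrA; congr (_ * _).
  have -> : (fun z : 'cV[R]_n => r *: z) @^-1` [set z | enorm z = r] = [set z | enorm z = 1].
    apply/seteqP; split=> z /=; rewrite enormZ gtr0_norm//; last by move=> ->; rewrite mulr1.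
    by move=> /(congr1 (fun x => r^-1 * x)); rewrite mulKf// mulVf.
  have bpsi : bounded_measurable n.-1 [set z : 'cV[R]_n | enorm z = 1] psi.
    split; last by exists B.
    by apply: measurable_funTS; apply: measurableT_comp mpsi mid.
  have Soo : (hausdorff n.-1 [set z : 'cV[R]_n | enorm z = 1%R] < +oo)%E.
    by have := @hausdorff_sphere_lty R n 1; rewrite muln1 => /(_ (ltnW n1)).
  have -> : hausdorff_integral n.-1 [set z : 'cV[R]_n | enorm z = 1]
      (fun z => psi (1^-1 *: z) * 1 `^ (1 - p)) =
      hausdorff_integral n.-1 [set z : 'cV[R]_n | enorm z = 1] psi.
    by apply: eq_hausdorff_integral => z _; rewrite invr1 scale1r powR1 mulr1.
  rewrite -(hausdorff_integralZ (mS 1) Soo _ bpsi).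
  apply: eq_hausdorff_integral => z _ /=.
  by rewrite scalerA mulVf// scale1r mulrC.
- by move=> z; rewrite scalerA mulVf// scale1r.
- by move=> z; rewrite scalerA mulfV// scale1r.
- by move=> x y; rewrite -scalerBr enormZ gtr0_norm.
Qed.

Lemma powRB1 {R : realType} (a x : R) : 0 < x -> x `^ (a - 1) * x = x `^ a.
Proof.
move=> x0; rewrite -{2}[x]powRr1 ?(ltW x0)// -powRD ?subrK//.
by rewrite (gt_eqF x0) implybT.
Qed.

Lemma powR_tangent_scaled {R : realType} (a l g f : R) :
  a <= 0 -> 0 < l -> 0 < g -> 0 < f ->
  l `^ a * (1 - a) * g `^ a + a * l `^ (a - 1) * (g `^ (a - 1) * f) <= f `^ a.
Proof.
move=> a0 l0 g0 f0; have := powR_tangent a0 (mulr_gt0 l0 g0) f0.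
rewrite (powRM a (ltW l0) (ltW g0)) (powRM (a - 1) (ltW l0) (ltW g0)).
(* Writing x^a = x^(a-1) x for l and g leaves a polynomial identity. *)
rewrite -(powRB1 a l0) -(powRB1 a g0) => h; apply: le_trans h.
by rewrite -subr_ge0 (_ : _ - _ = 0)//; ring.
Qed.

Section affine_surface_area.
Context {R : realType} {n m : nat}.
Local Notation U := 'M[R]_(n, m).
Variables (p : R) (Q : set 'rV[R]_m).
Hypotheses (n1 : (1 < n)%N) (m0 : (0 < m)%N) (p1 : 1 <= p) (hQ : convex_body_o Q).
Local Notation S := (esphere R n m).
Local Notation s := (n * m).-1.
Local Notation q := (- ((n * m)%:R / p) : R).
Local Notation B := (@oball R n 1).

Let p0 : 0 < p. Proof. exact: lt_le_trans ltr01 p1. Qed.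
Let nm1 : (1 < n * m)%N. Proof. exact: leq_trans n1 (leq_pmulr n m0). Qed.
Let mS : measurable (S : set (hausdorffMx R n m s)).
Proof. apply: borel_hausdorff_measurable; apply: closed_mx_measurable; exact: esphere_closed. Qed.
Let Soo : (hausdorff s S < +oo)%E. Proof. exact: hausdorff_sphere_lty (ltnW nm1). Qed.
Let q0 : q < 0. Proof. by rewrite oppr_lt0 divr_gt0// ltr0n ltnW. Qed.
Let hB : lipschitz_star_body B. Proof. exact: oball_star_body. Qed.

Definition proj_energy (K : set 'cV[R]_n) : R :=
  hausdorff_integral s S (fun u => proj_integral K p Q u `^ q).

Lemma affine_surface_areaE (K : set 'cV[R]_n) : affine_surface_area p Q K = proj_energy K `^ q^-1.
Proof.
rewrite /affine_surface_area /proj_energy; congr (_ `^ _); last by rewrite invrN invf_div.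
apply: eq_hausdorff_integral => u _.
by rewrite supp_proj_bodyE -powRrM mulrN mulrC.
Qed.

Lemma proj_energy_gt0 (K : set 'cV[R]_n) : lipschitz_star_body K -> 0 < proj_energy K.
Proof.
move=> hK; apply: (@hausdorff_integral_gt0 R n m s S mS Soo _ S).
- exact: proj_integral_powR_bounded_measurable.
- by move=> u _; exact: powR_ge0.
- by [].
- by apply/eqP; rewrite gt_eqF// hausdorff_sphere_gt0.
- move=> u /esphere_neq0 u0; apply: powR_gt0.
  exact: proj_integral_gt0 n1 m0 hK p1 hQ _ u0.
Qed.

Lemma ge_powR_neg (a x y : R) : a <= 0 -> 0 < x -> x <= y -> y `^ a <= x `^ a.
Proof.
move=> a0 x0 xy; have y0 := lt_le_trans x0 xy.
rewrite -[a]opprK powRN (powRN x) lef_pV2 ?posrE ?powR_gt0//.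
by rewrite ge0_ler_powR ?nnegrE ?(ltW x0) ?(ltW y0)// oppr_ge0.
Qed.

Lemma affine_surface_area_gt0 (K : set 'cV[R]_n) : lipschitz_star_body K -> 0 < affine_surface_area p Q K.
Proof. by move=> hK; rewrite affine_surface_areaE powR_gt0// proj_energy_gt0. Qed.

Lemma powR_scaled_root (l x : R) : 0 < l -> 0 < x -> (l `^ q * x) `^ q^-1 = l * x `^ q^-1.
Proof.
move=> l0 x0; rewrite powRM ?powR_ge0 ?(ltW x0)// -powRrM mulfV ?lt_eqF//.
by rewrite powRr1// ltW.
Qed.

Lemma proj_energy_ge (K : set 'cV[R]_n) : lipschitz_star_body K ->
  (Lp_surface_area p K / Lp_surface_area p B) `^ q * proj_energy B <= proj_energy K.
Proof.
move=> hK.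
have SK := Lp_surface_area_gt0 n1 hK p1; have SB := Lp_surface_area_gt0 n1 hB p1.
have l0 := divr_gt0 SK SB.
have SKl := divfK (lt0r_neq0 SB) (Lp_surface_area p K).
(* Of the quotient only l > 0 and l S_p(B) = S_p(K) are kept. *)
move: (Lp_surface_area p K / Lp_surface_area p B) l0 SKl => l l0 SKl.
pose F := proj_integral K p Q; pose G := proj_integral B p Q.
pose w (u : U) := G u `^ (q - 1).
have bw : bounded_measurable s S w by exact: proj_integral_powR_bounded_measurable.
have wH (H : 'M[R]_n) (u : U) : orthogonal_mx H -> w (H *m u) = w u.
  by move=> oH; rewrite /w /G proj_integral_ball_orthogonal.
have [v v1] : exists v : 'cV[R]_n, enorm v = 1.
  by exists (delta_mx (Ordinal (ltnW n1)) 0); exact: enorm_delta.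
have w0 (u : U) : S u -> 0 <= w u by move=> _; exact: powR_ge0.
have wF := weighted_proj_integral n1 m0 p1 hQ bw w0 wH hK v1.
have wG := weighted_proj_integral n1 m0 p1 hQ bw w0 wH hB v1.
set c := sphere_average _ _ _ _ in wF wG.
have F0 u : S u -> 0 < F u by move=> /esphere_neq0; exact: proj_integral_gt0.
have G0 u : S u -> 0 < G u by move=> /esphere_neq0; exact: proj_integral_gt0.
have bFq : bounded_measurable s S (fun u => F u `^ q) by exact: proj_integral_powR_bounded_measurable.
have bGq : bounded_measurable s S (fun u => G u `^ q) by exact: proj_integral_powR_bounded_measurable.
have bwF : bounded_measurable s S (fun u => w u * F u).
  by apply: (bounded_measurableM bw); exact: proj_integral_bounded_measurable.
(* As G^(q-1) G = G^q, the weighted integral of the ball is its own energy; this eliminates the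
   unknown constant c. *)
have EB : proj_energy B = c * Lp_surface_area p B.
  rewrite -wG; apply: eq_hausdorff_integral => u Su.
  by rewrite -(powRB1 _ (G0 _ Su)).
have b1 : bounded_measurable s S (fun u => (l `^ q * (1 - q)) * G u `^ q).
  by apply: bounded_measurableM bGq; exact: bounded_measurable_cst.
have b2 : bounded_measurable s S (fun u => (q * l `^ (q - 1)) * (w u * F u)).
  by apply: bounded_measurableM bwF; exact: bounded_measurable_cst.
have le1 u : S u -> (l `^ q * (1 - q)) * G u `^ q + (q * l `^ (q - 1)) * (w u * F u) <= F u `^ q.
  by move=> Su; apply: (powR_tangent_scaled (ltW q0) l0 (G0 u Su) (F0 u Su)).
have I1 : hausdorff_integral s S (fun u => l `^ q * (1 - q) * G u `^ q) =
  l `^ q * (1 - q) * proj_energy B.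
  by rewrite (hausdorff_integralZ mS Soo _ bGq).
have I2 : hausdorff_integral s S (fun u => q * l `^ (q - 1) * (w u * F u)) =
    q * l `^ (q - 1) * (c * Lp_surface_area p K).
  by rewrite (hausdorff_integralZ mS Soo _ bwF); congr (_ * _); exact: wF.
have H := le_hausdorff_integral mS Soo (bounded_measurableD b1 b2) bFq le1.
rewrite (hausdorff_integralD mS Soo b1 b2) I1 I2 in H.
(* With S_p(K) = l S_p(B) the terms with coefficient q cancel and l^q c S_p(B) remains. *)
apply: le_trans H; rewrite EB -SKl -(powRB1 q l0).
by rewrite -subr_ge0 (_ : _ - _ = 0)//; ring.
Qed.

Lemma affine_surface_area_le (K : set 'cV[R]_n) : lipschitz_star_body K ->
  affine_surface_area p Q K / affine_surface_area p Q B <=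
  Lp_surface_area p K / Lp_surface_area p B.
Proof.
move=> hK; rewrite (ler_pdivrMr _ _ (affine_surface_area_gt0 hB)) !affine_surface_areaE.
have l0 := divr_gt0 (Lp_surface_area_gt0 n1 hK p1) (Lp_surface_area_gt0 n1 hB p1).
have E := proj_energy_ge hK; have EB := proj_energy_gt0 hB.
rewrite -(powR_scaled_root l0 EB); apply: ge_powR_neg E.
  by rewrite invr_le0 ltW.
by rewrite mulr_gt0 ?powR_gt0.
Qed.

(** Both quotients equal l = r^(n-1) r^(1-p): the projection function and the surface area of the
    ball are multiplied by l, and Phi is homogeneous of degree 1 in the projection function. *)
Lemma affine_surface_area_oball (r : R) : 0 < r ->
  affine_surface_area p Q (oball r : set 'cV[R]_n) / affine_surface_area p Q B =
  Lp_surface_area p (oball r : set 'cV[R]_n) / Lp_surface_area p B.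
Proof.
move=> r0; pose l := r ^+ n.-1 * r `^ (1 - p).
have l0 : 0 < l by rewrite mulr_gt0 ?exprn_gt0 ?powR_gt0.
have SB := Lp_surface_area_gt0 n1 hB p1.
have SE : Lp_surface_area p (oball r : set 'cV[R]_n) = l * Lp_surface_area p B.
  rewrite !Lp_surface_areaE (normal_integral_oball p n1 r0)//.
  exact: sphere_bounded_cst.
have PE : proj_energy (oball r) = l `^ q * proj_energy B.
  rewrite -(hausdorff_integralZ mS Soo); last exact: proj_integral_powR_bounded_measurable.
  apply: eq_hausdorff_integral => u Su.
  have B0 := proj_integral_gt0 n1 m0 hB p1 hQ (esphere_neq0 Su).
  rewrite -(powRM _ (ltW l0) (ltW B0)); congr (_ `^ _).
  apply: (normal_integral_oball p n1 r0); first exact: proj_density_sphere_bounded.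
  by move=> v _; exact: proj_density_ge0.
rewrite !affine_surface_areaE PE (powR_scaled_root l0 (proj_energy_gt0 hB)) SE.
by rewrite !mulfK ?gt_eqF ?powR_gt0 ?proj_energy_gt0.
Qed.

End affine_surface_area.

Theorem proposition5p7 (R : realType) (n m : nat) (p : R)
    (Q : set 'rV[R]_m) (K : set 'cV[R]_n)
    (hn : (2 <= n)%N) (hm : (1 <= m)%N) (hp : 1 <= p < n%:R)
    (hQ : convex_body_o Q) (hK : lipschitz_star_body K) :
  affine_surface_area p Q K / affine_surface_area p Q (eball R n 1) <=
    Lp_surface_area p K / Lp_surface_area p (eball R n 1)
  /\ ((exists2 r : R, 0 < r & K = [set r *: x | x in eball R n 1]) ->
      affine_surface_area p Q K / affine_surface_area p Q (eball R n 1) =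
      Lp_surface_area p K / Lp_surface_area p (eball R n 1)).
Proof.
have /andP[p1 _] := hp; split=> [|[r r0 ->]].
  have H := affine_surface_area_le hn hm p1 hQ hK.
  by rewrite -eball_oball in H.
have H := affine_surface_area_oball hn hm p1 hQ r0.
by rewrite -eball_oball in H.
Qed.
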